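(* Let $H$, $V$, $A$, $B$, $P$, $Q$, $R$ be as in the context. Suppose that $f\in L^2_+(\mathbb{R},H)\cap H^k_{\rm loc}(\mathbb{R},H)$ with $k\ge1$ an integer, that $f$ is causal, and choose $T_0$ so that ${\rm supp}\,f\subset[T_0,\infty)$. Then the causal weak solution $u$ of $$Au'+Pu+Bu+R[u]=f$$ satisfies $u\in C^k(\mathbb{R},H)\cap C^{k-1}(\mathbb{R},V)$. For every $T\ge T_0$ there exists $C_{T_0,T}\ge0$, depending on $T_0$, $T$, $C_*$, $C^*$, $\|B\|_{\mathcal{B}(H)}$ and $\|Q\|_{L^1(\mathbb{R},\mathcal{B}(H))}$, such that for any $t\le T$, $$\|u^{(j)}(t)\|_V^2\le C_{T_0,T}\sum_{l=0}^{j+1}\int_{-\infty}^t\|f^{(l)}(s)\|^2\,ds,\qquad j=0,\dots,k-1 .$$ In particular, $u\in C^1(\mathbb{R},H)\cap C^0(\mathbb{R},V)$ is a strong solution of $Au'+Pu+Bu+R[u]=f$. For each $j=0,\dots,k$, $u^{(j)}$ is the (causal) weak solution of the same equation with right-hand side $f^{(j)}$ in place of $f$.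
   Context: $H$ is a separable real Hilbert space with inner product $\langle\cdot,\cdot\rangle$ and norm $\|\cdot\|$. $V\subset H$ is a dense subspace, itself a separable Hilbert space with norm $\|\cdot\|_V$ defining a stronger topology than that induced by $H$. $\mathcal{B}(H)$ is the space of bounded linear operators on $H$ with the operator norm, and $\mathcal{B}_{\rm symm}(H)$ its subspace of self-adjoint operators. Assumptions: - $A\in\mathcal{B}_{\rm symm}(H)$ with $C_*I\le A\le C^*I$, $0<C_*\le C^*$; - $B\in\mathcal{B}(H)$; - $Q\in L^1(\mathbb{R},\mathcal{B}_{\rm symm}(H))\cap C^0(\mathbb{R}_+,\mathcal{B}(H))$ with $Q(t)=0$ for $t<0$ ($\mathbb{R}_+=[0,\infty)$); - $P$ is a skew-adjoint operator on $H$ with domain $V$, whose graph norm is equivalent to $\|\cdot\|_V$ ($P$, $V$, $\|\cdot\|_V$ are fixed). $L^2_+(\mathbb{R},H)=\{v\in L^2_{\rm loc}(\mathbb{R},H): v\in L^2((-\infty,T],H)\text{ for each }T\in\mathbb{R}\}$. For $u\in L^2_+(\mathbb{R},H)$, $R[u](t)=\int Q(t-s)u(s)\,ds$; the formal adjoint is $R^*[\phi](t)=\int Q(s-t)\phi(s)\,ds$. A function $u\in L^2_{\rm loc}(\mathbb{R},H)$ is causal if ${\rm supp}\,u\subset[T,\infty)$ for some $T\in\mathbb{R}$. A weak solution of $Au'+Pu+Bu+R[u]=f$ is a $u\in L^2_+(\mathbb{R},H)$ such that for all $\phi\in C_0^\infty(\mathbb{R},V)$, $$\int\langle u(t),(A\phi'+P\phi-B^*\phi-R^*[\phi])(t)\rangle\,dt=-\int\langle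 f(t),\phi(t)\rangle\,dt .$$ For every causal $f\in L^2_{\rm loc}(\mathbb{R},H)$ there is exactly one causal weak solution. A strong solution is a $u\in C^1(\mathbb{R},H)\cap C^0(\mathbb{R},V)\cap L^2_+(\mathbb{R},H)$ satisfying the equation pointwise in $t$. *)

(* Defs.v *)
From HB Require Import structures.
From mathcomp Require Import all_boot all_order all_algebra.
From mathcomp Require Import all_classical all_reals all_analysis.
Set Implicit Arguments.
Unset Strict Implicit.
Unset Printing Implicit Defensive.
Import Order.TTheory GRing.Theory Num.Theory.
Import numFieldNormedType.Exports.
Local Open Scope ring_scope.
Local Open Scope classical_set_scope.

Section hilbert.
Context {R : realType}.
Implicit Types H V : completeNormedModType R.

Definition norm_of_dot H (ip : {dot H for idfun}) :=
  forall x : H, `|x| ^+ 2 = ip x x.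

Definition separable_space H :=
  exists2 D : set H, countable D & dense D.

(* The operator norm is a sensible notion for bounded linear [T] only. *)
Definition opnorm H V (T : H -> V) : R :=
  sup [set `|T x| | x in [set x : H | `|x| <= 1]].

Definition symmetric_op H (ip : {dot H for idfun}) (T : H -> H) :=
  forall x y, ip (T x) y = ip x (T y).

(* For bounded linear [T] the set below is a singleton, by the Riesz
   representation theorem. *)
Definition adjoint H (ip : {dot H for idfun}) (T : H -> H) (y : H) : H :=
  xget 0 [set z | forall x, ip (T x) y = ip x z].

(* A subspace [V] of [H] is given by the inclusion map [iota : V -> H], and an
   unbounded operator with domain [V] by a linear map [P : V -> H].
   [adjoint_graph] is the graph of its adjoint. *)
Definition adjoint_graph H V (ip : {dot H for idfun}) (iota P : V -> H)
    : set (H * H) :=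
  [set yz | forall v, ip (P v) yz.1 = ip (iota v) yz.2].

Definition skew_adjoint H V (ip : {dot H for idfun}) (iota P : V -> H) :=
  adjoint_graph ip iota P = [set (iota v, - P v) | v in [set: V]].

Definition graph_norm H V (iota P : V -> H) (v : V) : R :=
  Num.sqrt (`|iota v| ^+ 2 + `|P v| ^+ 2).

Definition graph_norm_equiv H V (iota P : V -> H) :=
  exists c1 c2 : R, [/\ 0 < c1, 0 < c2 &
    forall v, c1 * `|v| <= graph_norm iota P v <= c2 * `|v|].

Definition dense_inclusion H V (iota : V -> H) :=
  [/\ injective iota, continuous iota & dense (range iota)].

End hilbert.

Section bochner.
Context {d : measure_display} {T : measurableType d} {R : realType}
  (mu : {measure set T -> \bar R}) {E : normedModType R}.
Implicit Types f s : T -> E.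

Definition simple_fun s :=
  finite_set (range s) /\ forall y, measurable (s @^-1` [set y]).

Definition strongly_measurable f :=
  exists2 s : nat -> T -> E, forall n, simple_fun (s n) &
    forall x, s ^~ x @ \oo --> f x.

Definition integrable_simple_fun s :=
  simple_fun s /\ forall y, y != 0 -> (mu (s @^-1` [set y]) < +oo)%E.

(* The value y = 0 contributes 0 even when its fibre has infinite measure. *)
Definition simple_integral s : E :=
  \sum_(y \in range s) fine (mu (s @^-1` [set y])) *: y.

Definition is_bochner f (v : E) :=
  strongly_measurable f /\
  exists s : nat -> T -> E, [/\ forall n, integrable_simple_fun (s n),
    (fun n => \int[mu]_x (`|f x - s n x|)%:E)%E @ \oo --> 0%E &
    (fun n => simple_integral (s n)) @ \oo --> v].

Definition bochner_integrable f := exists v, is_bochner f v.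

Definition bochner f : E := xget 0 [set v | is_bochner f v].

End bochner.

(* Classes of functions modulo equality almost everywhere are represented by
   everywhere defined, Borel strongly measurable functions. *)
Section function_spaces.
Context {R : realType}.
Local Notation mu := (@lebesgue_measure R).

Definition L2loc (E : normedModType R) (u : R -> E) :=
  strongly_measurable (u : measurableTypeR R -> E) /\
  forall a b : R, (\int[mu]_(t in `[a, b]) (`|u t| ^+ 2)%:E < +oo)%E.

Definition L2plus (E : normedModType R) (u : R -> E) :=
  L2loc u /\
  forall b : R, (\int[mu]_(t in `]-oo, b]) (`|u t| ^+ 2)%:E < +oo)%E.

(* Support of a class modulo equality almost everywhere: the complement of the
   largest open set on which u vanishes almost everywhere. *)
Definition ess_supp (E : normedModType R) (u : R -> E) : set R :=
  ~` [set t | exists2 U, nbhs t U & {ae mu, forall s, U s -> u s = 0}].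

Definition causal (E : normedModType R) (u : R -> E) :=
  exists T : R, ess_supp u `<=` `[T, +oo[.

Definition Ck (E : normedModType R) (k : nat) (u : R -> E) :=
  (forall j : nat, (j < k)%N -> forall t, derivable (u^`(j)) t 1) /\
  continuous (u^`(k)).

Definition test_fun (E : normedModType R) (phi : R -> E) :=
  (forall k, Ck k phi) /\ compact (closure [set t | phi t != 0]).

Definition is_weak_deriv (E : normedModType R) (l : nat) (f g : R -> E) :=
  forall phi : R -> R, test_fun phi ->
    bochner mu (fun t : R => (phi^`(l))%classic t *: f t) =
    (- 1) ^+ l *: bochner mu (fun t : R => phi t *: g t).

Definition Hkloc (E : normedModType R) (k : nat) (f : R -> E) :=
  L2loc f /\
  forall l, (l <= k)%N -> exists2 g, L2loc g & is_weak_deriv l f g.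

(* A representative of the weak derivative f^(l), which is unique up to
   equality almost everywhere. *)
Definition wderiv (E : normedModType R) (l : nat) (f : R -> E) : R -> E :=
  xget (fun=> 0) [set g | L2loc g /\ is_weak_deriv l f g].

End function_spaces.

Section evolution.
Context {R : realType} {H V : completeNormedModType R}.
Local Notation mu := (@lebesgue_measure R).
Variables (ip : {dot H for idfun}) (iota : V -> H).

(* [Q] is continuous into B(H) on [0, +oo[ and vanishes on ]-oo, 0[, so it is
   automatically strongly measurable and its membership in L^1(R, B(H)) reduces
   to the integrability of its norm; likewise symmetry for almost every t is
   symmetry for every t. *)
Definition memory_kernel (Q : R -> {linear H -> H}) :=
  [/\ forall t, continuous (Q t) /\ symmetric_op ip (Q t),
      forall t, t < 0 -> Q t =1 (fun=> 0),
      forall t, 0 <= t ->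
        (fun s => opnorm (Q s \- Q t)) @ within `[0, +oo[ (nbhs t) --> (0 : R) &
      mu.-integrable setT (fun t => (opnorm (Q t))%:E)].

Definition norm_L1 (Q : R -> {linear H -> H}) : R :=
  \int[mu]_t opnorm (Q t).

Definition memory (Q : R -> {linear H -> H}) (u : R -> H) (t : R) : H :=
  bochner mu (fun s : R => Q (t - s) (u s)).

Definition memory_adj (Q : R -> {linear H -> H}) (phi : R -> H) (t : R) : H :=
  bochner mu (fun s : R => Q (s - t) (phi s)).

Variables (A : H -> H) (P : V -> H) (B : H -> H) (Q : R -> {linear H -> H}).

Definition weak_solution (f u : R -> H) :=
  L2plus u /\
  forall phi : R -> V, test_fun phi ->
    \int[mu]_t ip (u t) (A (iota ((phi^`())%classic t)) + P (phi t)
                         - adjoint ip B (iota (phi t))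
                         - memory_adj Q (iota \o phi) t) =
    - \int[mu]_t ip (f t) (iota (phi t)).

(* The unknown is a V-valued function, iota \o u being the same function viewed
   in H. *)
Definition strong_solution (f : R -> H) (u : R -> V) :=
  [/\ Ck 1 (iota \o u), Ck 0 u, L2plus (iota \o u) &
    forall t, bochner_integrable mu (fun s : R => Q (t - s) (iota (u s))) /\
      A ((iota \o u)^`()%classic t) + P (u t) + B (iota (u t))
        + memory Q (iota \o u) t = f t].

End evolution.

(* Main.v *)
Require Import Defs.
From HB Require Import structures.
From mathcomp Require Import all_boot all_order all_algebra.
From mathcomp Require Import all_classical all_reals all_analysis.
From mathcomp Require Import measurable_realfun.
From mathcomp Require Import ring lra.
Set Implicit Arguments.
Unset Strict Implicit.
Unset Printing Implicit Defensive.
Import Order.TTheory GRing.Theory Num.Theory.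
Import numFieldNormedType.Exports.
Local Open Scope ring_scope.
Local Open Scope classical_set_scope.

(* Mollify in time: testing the weak equation with [K (tau - t) *: w], [K] a
   derivative of a mollifier supported in [0, a], turns it into a pointwise
   equation for the convolution [K * u], which lies in the domain of [P] because
   [P] is skew-adjoint.  Skewness gives [<A y', y> <= (|z| + |B||y| + |R y|)|y|]
   for a solution [y] with source [z], hence an energy estimate
   [|y t|^2 <= C int_(-oo)^t |z|^2].  Convolutions of the weak derivatives of [f]
   converge in L^2 on bounded intervals, so by the estimate applied to differences
   all derivatives up to order k of the mollified solutions converge uniformly on
   each ]-oo, T].  The limits are successive derivatives of a representative of
   [u]; closedness of the graph of [P] and the equation give values and
   regularity in [V], and the bounds and weak equations pass to the limit. *)

(** The weak solution is merely L^2 in time and satisfies the equation only against test functions,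
    so it cannot be inserted into its own energy identity; its mollifications can. Skew-adjointness
    is used in two strengths: equality of the two graphs puts the convolutions and their limits into
    [V], while the energy estimate only needs [<P v, v> = 0]. The mollifier is supported to the
    right of 0, so every step respects the past: supports, the memory term and integrals over ]-oo,
    t]. Because the source vanishes before [T0], exponential growth acts for a time of at most
    [T - T0]; this is how [T0] enters the constant. The shift of one order between [H] and [V] comes
    from [P u = f - A u' - B u - R u]: order j in [V] needs u up to order j+1 and a pointwise bound
    of f^(j), which the same energy estimate, applied to the trivial equation with solution f^(j),
    extracts from f^(j+1). As [Q] may jump at 0, time derivatives of the memory term are always put
    on u. Bochner integrals are handled by pairing with a fixed vector, which reduces their
    identities to scalar integrals. *)

Lemma le_of_sqr {R : realDomainType} (a b : R) : 0 <= b -> a ^+ 2 <= b ^+ 2 -> a <= b.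
Proof. by move=> b0 h; rewrite leNgt; apply/negP => ba; nra. Qed.

(** * Inner products: bilinearity, Cauchy-Schwarz, joint continuity *)

Section inner_product.
Context {R : realType} {H : completeNormedModType R}.
Variable ip : {dot H for idfun}.

Lemma ipC x y : ip x y = ip y x.
Proof. by rewrite hermC /= expr0 mul1r. Qed.
Lemma ipDl x y z : ip (x + y) z = ip x z + ip y z.
Proof. exact: linearDl. Qed.
Lemma ipBl x y z : ip (x - y) z = ip x z - ip y z.
Proof. exact: linearBl. Qed.
Lemma ipDr x y z : ip x (y + z) = ip x y + ip x z.
Proof. by rewrite ipC ipDl !(ipC x). Qed.
Lemma ipBr x y z : ip x (y - z) = ip x y - ip x z.
Proof. by rewrite ipC ipBl !(ipC x). Qed.
Lemma ipZl a x y : ip (a *: x) y = a * ip x y.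
Proof. by rewrite linearZl_LR. Qed.
Lemma ipZr a x y : ip x (a *: y) = a * ip x y.
Proof. by rewrite ipC ipZl ipC. Qed.
Lemma ip0l x : ip 0 x = 0.
Proof. exact: linear0l. Qed.
Lemma ip0r x : ip x 0 = 0.
Proof. by rewrite ipC ip0l. Qed.
Lemma ipNl x y : ip (- x) y = - ip x y.
Proof. exact: linearNl. Qed.
Lemma ipNr x y : ip x (- y) = - ip x y.
Proof. by rewrite ipC ipNl ipC. Qed.

Lemma ip_suml I (r : seq I) (P : pred I) (F : I -> H) y :
  ip (\sum_(i <- r | P i) F i) y = \sum_(i <- r | P i) ip (F i) y.
Proof. by rewrite linear_sumlz. Qed.

Hypothesis hip : norm_of_dot ip.

Lemma ip_CS x y : `|ip x y| <= `|x| * `|y|.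
Proof.
have [->|y0] := eqVneq y 0; first by rewrite ip0r !normr0 mulr0.
have b0 : 0 < `|y| by rewrite normr_gt0.
(* The component of [x] orthogonal to [y], scaled by [|y|^2] to avoid a division. *)
have : 0 <= `|(`|y| ^+ 2) *: x - ip x y *: y| ^+ 2 by rewrite sqr_ge0.
rewrite hip ipBl !ipBr !ipZl !ipZr (ipC y x) -!hip => h.
have {h} : 0 <= `|y| ^+ 2 * ((`|x| * `|y|) ^+ 2 - ip x y ^+ 2).
  by apply: le_trans h _; rewrite le_eqVlt; apply/orP; left; apply/eqP; ring.
rewrite pmulr_rge0 ?exprn_gt0// subr_ge0 => h.
by apply: le_of_sqr; rewrite ?mulr_ge0// real_normK// num_real.
Qed.

Lemma ip_le x y : ip x y <= `|x| * `|y|.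
Proof. exact: le_trans (ler_norm _) (ip_CS _ _). Qed.

Lemma normr2D (x y : H) : `|x + y| ^+ 2 <= 2 * `|x| ^+ 2 + 2 * `|y| ^+ 2.
Proof.
apply: (@le_trans _ _ ((`|x| + `|y|) ^+ 2)).
  by rewrite ler_pXn2r ?nnegrE ?addr_ge0// ler_normD.
rewrite -subr_ge0.
have -> : 2 * `|x| ^+ 2 + 2 * `|y| ^+ 2 - (`|x| + `|y|) ^+ 2 = (`|x| - `|y|) ^+ 2.
  ring.
exact: sqr_ge0.
Qed.

Lemma cvg_ip T (F : set_system T) (FF : Filter F) (f g : T -> H) a b :
  f x @[x --> F] --> a -> g x @[x --> F] --> b ->
  ip (f x) (g x) @[x --> F] --> ip a b.
Proof.
move=> fa gb; apply/cvgrPdistC_lt => e e0.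
have h : `|f x - a| * `|g x| + `|a| * `|g x - b| @[x --> F] --> (0 : R).
  rewrite [X in _ --> X](_ : 0 = `|a - a| * `|b| + `|a| * `|b - b|); last first.
    by rewrite !subrr normr0 mul0r mulr0 addr0.
  apply: cvgD; apply: cvgM; try exact: cvg_cst.
  - by apply: cvg_norm; apply: cvgB => //; exact: cvg_cst.
  - exact: cvg_norm.
  - by apply: cvg_norm; apply: cvgB => //; exact: cvg_cst.
move/cvgrPdistC_lt : h => /(_ _ e0); apply: filterS => x.
rewrite !subr0 ger0_norm ?addr_ge0 ?mulr_ge0//; apply: le_lt_trans.
have -> : ip (f x) (g x) - ip a b = ip (f x - a) (g x) + ip a (g x - b).
  by rewrite ipBl ipBr; ring.
by apply: le_trans (ler_normD _ _) _; rewrite lerD ?ip_CS.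
Qed.

Lemma ip_ext x y : (forall z, ip x z = ip y z) -> x = y.
Proof.
move=> h; apply/eqP; rewrite -subr_eq0 -normr_eq0 -sqrf_eq0 hip ipBl h subrr.
by rewrite eqxx.
Qed.

End inner_product.

Lemma invn_small {R : realType} (e : R) : 0 < e ->
  exists N : nat, forall n, (N <= n)%N -> n.+1%:R^-1 <= e.
Proof.
move=> e0; have /cvgrPdistC_lt/(_ _ e0) := @cvg_harmonic R.
move=> [N _ hN]; exists N => n /hN /=; rewrite subr0 => h.
by apply: le_trans (ltW h); exact: ler_norm.
Qed.

(** * Completeness and the Riesz representation theorem *)

Section complete.
Context {R : realType} {H : completeNormedModType R}.

Lemma cauchy_seq_cvg (u : nat -> H) :
  (forall e : R, 0 < e -> exists N : nat, forall n m : nat,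
     (N <= n)%N -> (N <= m)%N -> `|u n - u m| <= e) ->
  u n @[n --> \oo] --> lim (u n @[n --> \oo]).
Proof.
move=> h; suff: cvg (u n @[n --> \oo]) by [].
apply: cauchy_cvg; apply: cauchy_exP => e e0.
have [N hN] := h _ (divr_gt0 e0 (ltr0n _ 2)).
exists (u N), N => // n /= Nn; rewrite -ball_normE /=.
by apply: le_lt_trans (hN _ _ _ _) _ => //; rewrite ltr_pdivrMr// mulr_natr mulr2n ltrDl.
Qed.

Variable ip : {dot H for idfun}.
Hypothesis hip : norm_of_dot ip.

(* The Riesz vector is the limit of a minimizing sequence of |x|^2 - 2 l x. *)
Lemma riesz (l : H -> R) (M : R) :
  (forall a x y, l (a *: x + y) = a * l x + l y) -> (forall x, `|l x| <= M * `|x|) ->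
  exists z, forall x, l x = ip x z.
Proof.
move=> ll lM.
have l0 : l 0 = 0 by have := ll (-1) 0 0; rewrite scaler0 addr0 mulN1r addNr.
have lD x y : l (x + y) = l x + l y by rewrite -{1}(scale1r x) ll mul1r.
have lZ a x : l (a *: x) = a * l x by rewrite -[_ *: _]addr0 ll l0 addr0.
pose J (x : H) : R := `|x| ^+ 2 - 2 * l x.
have lbJ : has_lbound (range J).
  exists (- M ^+ 2) => _ [x _ <-]; rewrite /J.
  have := le_trans (ler_norm _) (lM x).
  have := sqr_ge0 (`|x| - M); rewrite sqrrB => *; lra.
have infJ : has_inf (range J) by split=> //; exists (J 0), 0.
set m := inf (range J).
have mJ x : m <= J x by apply: ge_inf => //; exists x.
have hx n : exists x, J x < m + n.+1%:R^-1.
  have n0 : 0 < n.+1%:R^-1 :> R by rewrite invr_gt0.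
  by have [_ [x _ <-] Jx] := inf_adherent n0 infJ; exists x.
pose u n := projT1 (cid (hx n)).
have uJ n : J (u n) < m + n.+1%:R^-1 by rewrite /u; case: cid.
(* Parallelogram law; the linear parts of [J] cancel. With [J >= m] at the midpoint it makes
   minimizing sequences Cauchy. *)
have JE x y : `|x - y| ^+ 2 = 2 * J x + 2 * J y - 4 * J ((1/2) *: (x + y)).
  rewrite /J lZ lD.
  by rewrite !hip !ipBl !ipBr !ipZl !ipZr !ipDl !ipDr (ipC _ y x); field.
have uC n k : `|u n - u k| ^+ 2 <= 2 * (n.+1%:R^-1 + k.+1%:R^-1).
  rewrite JE; have := uJ n; have := uJ k; have := mJ ((1/2) *: (u n + u k)).
  by move: (J _) (J _) (J _) (n.+1%:R^-1) (k.+1%:R^-1) => *; lra.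
have uz : u n @[n --> \oo] --> lim (u n @[n --> \oo]).
  apply: cauchy_seq_cvg => e e0.
  have [N hN] := invn_small (divr_gt0 (exprn_gt0 2 e0) (ltr0n _ 4)).
  exists N => n k Nn Nk.
  apply: le_of_sqr; first exact: ltW.
  apply: le_trans (uC _ _) _.
  have := hN _ Nn; have := hN _ Nk.
  move: (n.+1%:R^-1) (k.+1%:R^-1) (e ^+ 2) => *; lra.
set z := lim _ in uz; exists z => y.
(* Near-minimality of [u n] along the line [t *: y + u n], passed to the limit. A quadratic in [t]
   without constant term that stays nonnegative has vanishing linear coefficient. *)
have key t : 0 <= 2 * t * (ip z y - l y) + t ^+ 2 * `|y| ^+ 2.
  have c1 : 2 * t * (ip (u n) y - l y) + t ^+ 2 * `|y| ^+ 2 + n.+1%:R^-1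
      @[n --> \oo] --> 2 * t * (ip z y - l y) + t ^+ 2 * `|y| ^+ 2 + 0.
    apply: cvgD; last exact: cvg_harmonic.
    apply: cvgD; last exact: cvg_cst.
    apply: cvgM; first exact: cvg_cst.
    apply: cvgB; last exact: cvg_cst.
    by apply: cvg_ip => //; exact: cvg_cst.
  rewrite addr0 in c1; apply: (cvgr_to_ge c1).
  apply: nearW => n; have := mJ (t *: y + u n); have := uJ n.
  have -> : J (t *: y + u n) = J (u n) + (2 * t * (ip (u n) y - l y) + t ^+ 2 * `|y| ^+ 2).
    by rewrite /J ll !hip !ipDl !ipDr !ipZl !ipZr (ipC _ y (u n)); ring.
  move: (J _) (n.+1%:R^-1) (_ + t ^+ 2 * _) => *; lra.
have [y0|y0] := eqVneq y 0; first by rewrite y0 l0 ip0l.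
rewrite ipC; apply/eqP; rewrite -subr_eq0 -oppr_eq0 opprB; apply/eqP.
set D := ip z y - l y in key *.
have b0 : 0 < `|y| ^+ 2 by rewrite exprn_gt0 // normr_gt0.
(* The minimizer of the quadratic, where its value is [- D ^+ 2 / |y|^2]. *)
have := key (- D / `|y| ^+ 2).
have -> : 2 * (- D / `|y| ^+ 2) * D + (- D / `|y| ^+ 2) ^+ 2 * `|y| ^+ 2
   = - (D ^+ 2 / `|y| ^+ 2) by field; rewrite normr_eq0.
rewrite oppr_ge0 pmulr_lle0 ?invr_gt0// => h.
by apply/eqP; rewrite -sqrf_eq0; apply/eqP/le_anti/andP; split=> //; exact: sqr_ge0.
Qed.

End complete.

(** * Vector-valued derivatives on the real line *)

Section calculus.
Context {R : realType}.
Implicit Types E F : normedModType R.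

(** Differentiability and the value of the derivative in one relation, so that rules compose without
    separate derivability side conditions. *)
Definition isD E (f : R -> E) (t : R) (d : E) :=
  h^-1 *: (f (h + t) - f t) @[h --> 0^'] --> d.

Lemma isDP E (f : R -> E) t d :
  isD f t d <-> derivable f t 1 /\ f^`() t = d.
Proof.
have eqf : (fun h : R => h^-1 *: ((f \o shift t) (h *: 1) - f t)) =
           (fun h : R => h^-1 *: (f (h + t) - f t)).
  by apply/funext => h /=; rewrite [h *: 1]mulr1.
split=> [fd|[fd <-]].
  by split; [rewrite /derivable eqf; apply/cvg_ex; exists d | exact: cvg_lim].
by rewrite /isD /derive1; rewrite /derivable eqf in fd.
Qed.

Lemma isD_derive1 E (f : R -> E) t d : isD f t d -> f^`() t = d.
Proof. by move=> /isDP[]. Qed.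

Lemma isD_derivable E (f : R -> E) t d : isD f t d -> derivable f t 1.
Proof. by move=> /isDP[]. Qed.

Lemma derivable_isD E (f : R -> E) t : derivable f t 1 -> isD f t (f^`() t).
Proof. by move=> fd; apply/isDP. Qed.

Lemma isD_is_derive (f : R -> R) t (d : R) : isD f t d <-> is_derive t 1 f d.
Proof.
split=> [/isDP[fd <-]|[fd <-]]; last by apply/isDP; rewrite derive1E.
by apply: DeriveDef => //; rewrite derive1E.
Qed.

(** Multiplying the difference quotient by [h] removes the division and the exclusion of [h = 0];
    limits and mean value bounds are fed in through this form. *)
Lemma isD_ed E (f : R -> E) t d : isD f t d <->
  forall e : R, 0 < e -> exists2 dl, 0 < dl &
    forall h, `|h| < dl -> `|f (h + t) - f t - h *: d| <= e * `|h|.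
Proof.
split=> [/cvgrPdistC_le fd e e0|fd].
  have /= [dl dl0 hdl] := fd _ e0.
  exists dl => // h hd; have [->|h0] := eqVneq h 0.
    by rewrite add0r subrr scale0r subr0 !normr0 mulr0.
  have := hdl h; rewrite /= sub0r normrN => /(_ hd h0).
  rewrite -(ler_pM2l (_ : 0 < `|h|)) ?normr_gt0// -normrZ scalerBr.
  by rewrite scalerA divff// scale1r mulrC.
apply/cvgrPdistC_le => e e0; have [dl dl0 hdl] := fd _ e0.
exists dl => // h /=; rewrite sub0r normrN => hd h0.
rewrite -(ler_pM2l (_ : 0 < `|h|)) ?normr_gt0// -normrZ scalerBr.
by rewrite scalerA divff// scale1r mulrC; exact: hdl.
Qed.

Lemma cts_ed E (f : R -> E) t : {for t, continuous f} <->
  forall e : R, 0 < e -> exists2 dl, 0 < dl &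
    forall s, `|s - t| < dl -> `|f s - f t| <= e.
Proof.
split=> [/cvgrPdistC_le fd e e0|fd].
  have /= [dl dl0 hdl] := fd _ e0.
  by exists dl => // s st; apply: hdl; rewrite /= distrC.
apply/cvgrPdistC_le => e e0; have [dl dl0 hdl] := fd _ e0.
by exists dl => // s /=; rewrite distrC => /hdl.
Qed.

Lemma isD_cts E (f : R -> E) t d : isD f t d -> {for t, continuous f}.
Proof.
move=> /isD_ed fd; apply/cts_ed => e e0.
have [dl dl0 hdl] := fd 1 ltr01.
have d1 : 0 < 1 + `|d| by rewrite ltr_wpDr.
exists (Num.min dl (e / (1 + `|d|))); first by rewrite lt_min dl0 divr_gt0.
move=> s; rewrite lt_min => /andP[/hdl]; rewrite subrK mul1r => h.
rewrite ltr_pdivlMr// => he.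
rewrite -(subrK ((s - t) *: d) (f s - f t)).
apply: le_trans (ler_normD _ _) _; rewrite normrZ.
apply: le_trans (lerD h (lexx _)) _; apply: le_trans (ltW he).
by rewrite mulrDr mulr1.
Qed.

Lemma derivable_continuous E (f : R -> E) :
  (forall t, derivable f t 1) -> continuous f.
Proof. by move=> fd t; apply/isD_cts/derivable_isD/fd. Qed.

Lemma isDD E (f g : R -> E) t a b : isD f t a -> isD g t b ->
  isD (fun x => f x + g x) t (a + b).
Proof.
move=> fa gb; rewrite /isD.
under eq_fun do rewrite opprD addrACA scalerDr.
exact: cvgD.
Qed.

Lemma isDZ E (f : R -> E) t a (c : R) : isD f t a -> isD (fun x => c *: f x) t (c *: a).
Proof.
move=> fa; rewrite /isD.
under eq_fun do rewrite -scalerBr scalerA mulrC -scalerA.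
by apply: cvgZl_tmp; exact: fa.
Qed.

Lemma isDB E (f g : R -> E) t a b : isD f t a -> isD g t b ->
  isD (fun x => f x - g x) t (a - b).
Proof.
move=> fa gb; rewrite /isD.
under eq_fun do rewrite opprD addrACA -opprD scalerDr scalerN.
exact: cvgB.
Qed.

Lemma isD_lin E F (L : {linear E -> F}) (f : R -> E) t a : continuous L ->
  isD f t a -> isD (L \o f) t (L a).
Proof.
move=> cL fa; rewrite /isD /comp.
under eq_fun do rewrite -linearB -linearZ.
by apply: continuous_cvg => //; exact: cL.
Qed.

Lemma isD_cst E (c : E) t : isD (fun=> c) t 0.
Proof. by rewrite /isD; under eq_fun do rewrite subrr scaler0; exact: cvg_cst. Qed.

End calculus.

Section hilbert_calculus.
Context {R : realType} {H : completeNormedModType R}.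
Variable ip : {dot H for idfun}.
Hypothesis hip : norm_of_dot ip.

Lemma isD_ip (f g : R -> H) t a b : isD f t a -> isD g t b ->
  isD (fun x => ip (f x) (g x)) t (ip a (g t) + ip (f t) b).
Proof.
move=> fa gb; rewrite /isD.
rewrite (_ : (fun h => _) = fun h : R => ip (h^-1 *: (f (h + t) - f t)) (g (h + t))
   + ip (f t) (h^-1 *: (g (h + t) - g t))); last first.
  by apply/funext => h; rewrite ipZl ipZr ipBl ipBr /GRing.scale /=; ring.
apply: cvgD; apply: cvg_ip => //; last exact: cvg_cst.
have ht : (h + t) @[h --> (0 : R)^'] --> t.
  rewrite -[X in _ --> X]add0r; apply: cvgD; last exact: cvg_cst.
  exact: nbhs_dnbhs.
exact: (cvg_comp _ _ ht (isD_cts gb)).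
Qed.

(* Mean value inequality, by testing against the increment itself. *)
Lemma mean_value_le (f f' : R -> H) (c : H) (M a b : R) : a <= b ->
  (forall s, a <= s <= b -> isD f s (f' s)) ->
  (forall s, a <= s <= b -> `|f' s - c| <= M) ->
  `|f b - f a - (b - a) *: c| <= M * (b - a).
Proof.
rewrite le_eqVlt => /predU1P[<- _ _|ab fd fM].
  by rewrite !subrr scale0r subr0 normr0 mulr0.
set D := f b - f a - _.
pose g s := ip (f s - s *: c) D.
pose g' s := ip (f' s - c) D.
have gd s : a <= s <= b -> isD g s (g' s).
  move=> sab; rewrite /g (_ : g' s = g' s + ip (f s - s *: c) 0); last by rewrite ip0r addr0.
  apply: isD_ip; last exact: isD_cst.
  apply: isDB; first exact: fd.
  rewrite /isD; apply: cvg_near_cst.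
  near=> h; rewrite -scalerBl addrK scalerA mulVf ?scale1r//.
  by near: h; exact: nbhs_dnbhs_neq.
have [||z zab] := @MVT _ g g' a b ab.
- by move=> x xab; apply/isD_is_derive/gd; rewrite !(itvP xab).
- by apply: continuous_in_subspaceT => x; rewrite inE /= in_itv => /gd/isD_cts.
move=> eqg.
have : `|D| ^+ 2 <= M * (b - a) * `|D|.
  rewrite hip (_ : ip D D = g b - g a); last first.
    rewrite /g -ipBl; congr (ip _ D); rewrite /D scalerBl !opprB.
    by rewrite addrACA [RHS]addrACA [X in _ = _ + X]addrC.
  rewrite eqg /g' mulrAC; apply: ler_wpM2r; first by rewrite subr_ge0 ltW.
  apply: le_trans (ip_le hip _ _) _; apply: ler_wpM2r => //.
  by apply: fM; rewrite !(itvP zab).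
have [->|D0] := eqVneq D 0.
  move=> _; rewrite normr0 mulr_ge0 ?subr_ge0 ?(ltW ab)//.
  by apply: le_trans (fM a _); rewrite ?normr_ge0// lexx ltW.
by rewrite expr2 ler_pM2r// normr_gt0.
Unshelve. all: by end_near. Qed.

Lemma mean_value_norm_le (f f' : R -> H) (c : H) (M t h : R) :
  (forall s, isD f s (f' s)) ->
  (forall s, `|s - t| <= `|h| -> `|f' s - c| <= M) ->
  `|f (h + t) - f t - h *: c| <= M * `|h|.
Proof.
move=> fd fM; have [h0|h0] := leP 0 h.
  have := @mean_value_le f f' c M t (h + t); rewrite addrK ger0_norm//; apply=> //.
    by rewrite lerDr.
  by move=> s /andP[ts sh]; apply: fM; rewrite !ger0_norm ?subr_ge0// lerBlDr.
have := @mean_value_le f f' c M (h + t) t.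
rewrite opprD addrCA subrr addr0 ltr0_norm// scaleNr -normrN !opprD !opprK.
rewrite [- f t + _]addrC; apply => //.
  by rewrite gerDr ltW.
move=> s /andP[ts sh]; apply: fM; rewrite (ltr0_norm h0) ler0_norm ?subr_le0//.
by rewrite opprB lerBlDl -lerBlDr opprK addrC.
Qed.

(* Locally uniform convergence of the derivatives is passed to the limit
   through the mean value inequality. *)
Lemma isD_lim (f f' : nat -> R -> H) (g g' : R -> H) (t : R) :
  (forall n s, isD (f n) s (f' n s)) ->
  (forall s, f n s @[n --> \oo] --> g s) ->
  {for t, continuous g'} ->
  (forall e : R, 0 < e -> exists N : nat, forall n : nat, (N <= n)%N ->
     forall s, `|s - t| <= 1 -> `|f' n s - g' s| <= e) ->
  isD g t (g' t).
Proof.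
move=> fd fg cg' unif; apply/isD_ed => e e0.
have e2 : 0 < e / 2 by rewrite divr_gt0.
have /cts_ed/(_ _ e2)[dl dl0 hdl] := cg'.
have [N hN] := unif _ e2.
exists (Num.min dl 1); first by rewrite lt_min dl0 ltr01.
move=> h; rewrite lt_min => /andP[hd h1].
have c1 : `|f n (h + t) - f n t - h *: g' t| @[n --> \oo] -->
          `|g (h + t) - g t - h *: g' t|.
  by apply: cvg_norm; apply: cvgB; [exact: cvgB|exact: cvg_cst].
apply: (cvgr_to_le c1); exists N => // n /= Nn.
apply: mean_value_norm_le => // s sh.
rewrite -(subrK (g' s) (f' n s)) -addrA (splitr e).
apply: le_trans (ler_normD _ _) _; apply: lerD.
  by apply: hN => //; apply: le_trans sh (ltW h1).
by apply: hdl; apply: le_lt_trans hd.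
Qed.

End hilbert_calculus.

(** * Bounded linear operators and the operator norm *)

Section bounded_operators.
Context {R : realType}.

Lemma bounded_op (E F : normedModType R) (L : {linear E -> F}) : continuous L ->
  exists2 M : R, 0 <= M & forall x, `|L x| <= M * `|x|.
Proof.
move=> /linear_bounded_continuous/linear_boundedP[r [_ hr]].
(* Every constant strictly above [r] is admissible, hence [r + 1]; the maximum secures the sign. *)
exists (Num.max (r + 1) 0); first by rewrite le_max lexx orbT.
by apply: hr; rewrite lt_max ltrDl ltr01.
Qed.

Lemma opnorm_le (E F : completeNormedModType R) (L : {linear E -> F}) x :
  continuous L -> `|L x| <= opnorm L * `|x|.
Proof.
move=> cL; have [M M0 hM] := bounded_op cL.
have [->|x0] := eqVneq x 0; first by rewrite linear0 !normr0 mulr0.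
have nx : 0 < `|x| by rewrite normr_gt0.
rewrite -ler_pdivrMr//.
have -> : `|L x| / `|x| = `|L (`|x|^-1 *: x)|.
  by rewrite linearZ normrZ normfV normr_id mulrC.
apply: ub_le_sup; last first.
  exists (`|x|^-1 *: x) => //=.
  by rewrite normrZ normfV normr_id mulVf ?gt_eqF.
exists M => _ [y /= y1 <-]; apply: le_trans (hM y) _.
by rewrite ler_piMr.
Qed.

(** Holds for arbitrary maps: if the norms on the unit ball are unbounded, [sup] takes its default
    value 0. *)
Lemma opnorm_ge0 (E F : completeNormedModType R) (L : E -> F) : 0 <= opnorm L.
Proof.
rewrite /opnorm; have [h|/sup_out->//] := pselect (has_sup [set `|L x| | x in [set x : E | `|x| <= 1]]).
apply: (@le_trans _ _ `|L 0|) => //; apply: ub_le_sup; first exact: h.2.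
by exists 0 => //=; rewrite normr0.
Qed.

End bounded_operators.

(** * The energy estimate for an abstract differential inequality *)

Section energy.
Context {R : realType} {H : completeNormedModType R}.
Variable ip : {dot H for idfun}.
Hypothesis hip : norm_of_dot ip.
Variables (A : {linear H -> H}) (Cl nB nQ : R).
Hypotheses (A_cont : continuous A) (A_sym : symmetric_op ip A)
  (Cl_gt0 : 0 < Cl) (A_coer : forall x, Cl * ip x x <= ip (A x) x)
  (nB_ge0 : 0 <= nB) (nQ_ge0 : 0 <= nQ).

(** The 1 comes from [2 z |y| <= z^2 + |y|^2], the other two terms from [B] and the memory in twice
    [<A y', y>]. Division by [Cl] compensates the factor [Cl / 2] of the exponential to which the
    energy is compared. *)
Definition growth_rate (Cl nB nQ : R) := (1 + 2 * nB + 2 * nQ) / Cl.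

(** [2 / Cl] bounds [|y|^2] by the source integral at the point where the weighted norm is maximal;
    the exponential carries the bound from there to the final time. *)
Definition energy_const (Cl nB nQ T0 T : R) :=
  2 / Cl * expR (2 * growth_rate Cl nB nQ * (T - T0)).

Lemma energy_const_ge0 T0 T : 0 <= energy_const Cl nB nQ T0 T.
Proof. by rewrite mulr_ge0 ?expR_ge0 ?divr_ge0 ?ltW. Qed.

(* Instead of Gronwall's lemma, evaluate the energy balance at a point m where
   the exponentially weighted norm |y s|^2 e^(-2 lam s) is maximal on [a, t]. *)
Lemma energy_estimate (y y' : R -> H) (z Z : R -> R) (a t T0 T : R) :
  (forall s, isD y s (y' s)) -> (forall s, s <= a -> y s = 0) ->
  (forall s S, s <= t -> (forall r, r <= s -> `|y r| <= S) ->
     ip (A (y' s)) (y s) <= (z s + nB * `|y s| + nQ * S) * `|y s|) ->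
  (forall s, a <= s -> isD Z s (z s ^+ 2)) -> 0 <= Z a ->
  (forall s, a <= s <= T0 -> Z s = 0) ->
  a <= t -> t <= T ->
  `|y t| ^+ 2 <= energy_const Cl nB nQ T0 T * Z t.
Proof.
move=> yd y0 ybal Zd Za Z0 at_ tT.
set lam := growth_rate Cl nB nQ.
have K0 : 0 < 1 + 2 * nB + 2 * nQ by move: nB_ge0 nQ_ge0 => *; lra.
have lam0 : 0 < lam by rewrite divr_gt0.
have ycts : continuous y by move=> s; exact: isD_cts (yd s).
pose w s := `|y s| ^+ 2 * expR (- (2 * lam * s)).
have wc : continuous w.
  move=> s; apply: (@cvgM _ _ _ _ (fun s => `|y s| ^+ 2) (fun s => expR (- (2 * lam * s)))).
    rewrite expr2; under eq_fun do rewrite expr2.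
    by apply: cvgM; apply: cvg_norm; exact: ycts.
  apply: (cvg_comp (fun s => - (2 * lam * s)) expR); last exact: continuous_expR.
  by apply: cvgN; apply: cvgM; [exact: cvg_cst|exact: cvg_id].
have w0 s : 0 <= w s by rewrite mulr_ge0 ?expR_ge0 ?sqr_ge0.
have [m mat mmax] := EVT_max at_ (continuous_subspaceT wc).
have {mat} [am mt] : a <= m /\ m <= t by rewrite !(itvP mat).
have wm s : s <= t -> w s <= w m.
  move=> st; have [sa|sa] := leP s a.
    by rewrite {1}/w y0// normr0 expr0n mul0r.
  by apply: mmax; rewrite in_itv /= (ltW sa).
have wE s : w s * expR (2 * lam * s) = `|y s| ^+ 2.
  by rewrite /w -mulrA -expRD addNr expR0 mulr1.
have ywm s : s <= t -> `|y s| ^+ 2 <= w m * expR (2 * lam * s).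
  by move=> st; rewrite -wE ler_pM2r ?expR_gt0// wm.
pose N := Num.sqrt (w m).
have N2 : N ^+ 2 = w m by rewrite sqr_sqrtr.
have N0 : 0 <= N by exact: sqrtr_ge0.
have yN s : s <= t -> `|y s| <= N * expR (lam * s).
  move=> st; apply: le_of_sqr; first by rewrite mulr_ge0 ?expR_ge0.
  apply: le_trans (ywm _ st) _; rewrite exprMn N2 expr2 -expRD.
  by rewrite -mulrDl -mulr2n -[lam *+ 2]mulr_natl.
(* The last term equals [Cl / 2 * |y m|^2] at [m]. So [G m <= 0] together with coercivity leaves
   [Cl / 2 * |y m|^2 <= Z m]. *)
pose G s := ip (A (y s)) (y s) - Z s - Cl / 2 * w m * expR (2 * lam * s).
pose G' s := 2 * ip (A (y' s)) (y s) - z s ^+ 2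
  - (1 + 2 * nB + 2 * nQ) * w m * expR (2 * lam * s).
have Gd s : a <= s -> isD G s (G' s).
  move=> as_.
  have eD : isD (fun s => expR (2 * lam * s)) s (2 * lam * expR (2 * lam * s)).
    apply/isD_is_derive; rewrite [X in is_derive _ _ _ X]mulrC.
    have d1 : is_derive s 1 (fun s => 2 * lam * s) (2 * lam).
      apply/isD_is_derive; rewrite -[X in isD _ _ X]mulr1.
      by apply: (@isDZ _ _ id); apply/isD_is_derive; exact: is_derive_id.
    have h := @is_derive1_comp _ expR _ _ _ _ (is_derive_expR (2 * lam * s)) d1. exact: h.
  have -> : G' s = (ip (A (y' s)) (y s) + ip (A (y s)) (y' s)) - z s ^+ 2
     - (Cl / 2 * w m) *: (2 * lam * expR (2 * lam * s)).
    rewrite (A_sym (y s)) (ipC _ (y s)) /G' /lam /growth_rate /GRing.scale /=.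
    field; exact: lt0r_neq0.
  apply: isDB; last exact: isDZ.
  apply: isDB; last exact: Zd.
  by apply: isD_ip => //; exact: (isD_lin A_cont).
have G'le s : a <= s -> s <= t -> G' s <= 0.
  move=> as_ st; rewrite /G'.
  (* Maximality at [m] bounds [|y r|] by [N * expR (lam * r)], and this increases in [r]; its value
     at [s] therefore bounds the whole past of [s], as the memory term requires. *)
  have := ybal s (N * expR (lam * s)) st.
  set X := N * _; have X2 : X ^+ 2 = w m * expR (2 * lam * s).
    by rewrite exprMn N2 expr2 -expRD -mulrDl -mulr2n -[lam *+ 2]mulr_natl.
  have yX := yN s st; rewrite -/X in yX.
  have -> : (1 + 2 * nB + 2 * nQ) * w m * expR (2 * lam * s) = (1 + 2 * nB + 2 * nQ) * X ^+ 2.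
    by rewrite X2 [RHS]mulrA.
  move=> h; have {}h := h _; have {}h : ip (A (y' s)) (y s) <= (z s + nB * `|y s| + nQ * X) * `|y s|.
    apply: h => r rs; apply: le_trans (yN _ (le_trans rs st)) _.
    by rewrite ler_wpM2l// ler_expR ler_pM2l.
  have u0 : 0 <= `|y s| by [].
  move: (ip _ _) (`|y s|) h u0 yX => i u h u0 uX.
  have X0 : 0 <= X by apply: le_trans uX.
  have h1 : u * u <= X ^+ 2 by rewrite expr2 ler_pM.
  have h2 : X * u <= X ^+ 2 by rewrite expr2 ler_pM.
  have h3 := sqr_ge0 (z s - u); rewrite sqrrB in h3.
  have h4 : nB * (u * u) <= nB * X ^+ 2 by rewrite ler_wpM2l.
  have h5 : nQ * (X * u) <= nQ * X ^+ 2 by rewrite ler_wpM2l.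
  nra.
have Gam : G m <= G a.
  apply: (@ler0_derive1_le_cc _ G a m) => //.
  - by move=> x xam; apply: isD_derivable (Gd _ _); rewrite (itvP xam).
  - move=> x xam; rewrite (isD_derive1 (Gd _ _)) ?(itvP xam)//.
    by apply: G'le; rewrite ?(itvP xam)// (le_trans _ mt)// (itvP xam).
  - apply: continuous_in_subspaceT => x; rewrite inE /= in_itv => /andP[ax _].
    exact: isD_cts (Gd _ ax).
  - by rewrite in_itv /= lexx am.
  - by rewrite in_itv /= lexx am.
have Ga : G a <= 0.
  rewrite /G y0// ip0r sub0r -opprD oppr_le0 addr_ge0// !mulr_ge0 ?expR_ge0//.
    exact: ltW.
have ym : `|y m| ^+ 2 <= 2 / Cl * Z m.
  have := le_trans Gam Ga; rewrite /G => h.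
  have hA := A_coer (y m); rewrite -hip in hA.
  have wmm := wE m; rewrite -mulrA wmm in h.
  have -> : 2 / Cl * Z m = (2 * Z m) / Cl by field; exact: lt0r_neq0.
  rewrite ler_pdivlMr//; move: (`|y m| ^+ 2) h hA => u h hA.
  move: h hA; move: (ip _ _) => i h hA; nra.
have Zmt : Z m <= Z t.
  move: mt; rewrite le_eqVlt => /predU1P[->//|mt].
  apply: (@ger0_derive1_le_cc _ Z m t) => //.
  - by move=> x xam; apply: isD_derivable (Zd _ _); rewrite (le_trans am)// (itvP xam).
  - move=> x xam; rewrite (isD_derive1 (Zd _ _)) ?sqr_ge0//.
    by rewrite (le_trans am)// (itvP xam).
  - apply: continuous_in_subspaceT => x; rewrite inE /= in_itv => /andP[mx _].
    by apply: isD_cts (Zd _ _); exact: le_trans am mx.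
  - by rewrite in_itv /= lexx (ltW mt).
  - by rewrite in_itv /= lexx (ltW mt).
  - exact: ltW.
have yt : `|y t| ^+ 2 <= 2 / Cl * expR (2 * lam * (t - m)) * Z m.
  apply: le_trans (ywm _ (lexx t)) _.
  have -> : w m * expR (2 * lam * t) = `|y m| ^+ 2 * expR (2 * lam * (t - m)).
    by rewrite /w -mulrA -expRD; congr (_ * expR _); ring.
  by rewrite [leRHS]mulrAC ler_wpM2r ?expR_ge0.
have Zm0 : 0 <= Z m.
  by have := le_trans (sqr_ge0 _) ym; rewrite pmulr_rge0//; apply: divr_gt0.
apply: le_trans yt _; rewrite /energy_const -/lam.
(* If the maximum occurs up to [T0], then [Z m = 0] and [y t] vanishes; otherwise
   [t - m <= T - T0]. *)
have [mT0|mT0] := leP m T0.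
  by rewrite Z0 ?am// mulr0 mulr_ge0 ?energy_const_ge0//; exact: le_trans Zmt.
apply: ler_pM => //.
  by rewrite mulr_ge0 ?expR_ge0 ?divr_ge0 ?ltW.
apply: ler_wpM2l; first by apply: divr_ge0 => //; exact: ltW.
rewrite ler_expR; apply: ler_wpM2l; first by apply: mulr_ge0 => //; exact: ltW.
by apply: lerB => //; exact: ltW.
Qed.

End energy.

(** * Bochner integration in a Hilbert space *)

Section real_integrals.
Context {d : measure_display} {T : measurableType d} {R : realType}
  (mu : {measure set T -> \bar R}).
Implicit Types f g : T -> R.

(** The real integral is the finite part of an extended one and is linear only on such functions, so
    this predicate accompanies every computation. *)
Definition rint f := mu.-integrable setT (EFin \o f).

Lemma rint_measurable f : rint f -> measurable_fun setT f.
Proof. by move=> /measurable_int/measurable_EFinP. Qed.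

Lemma rint_le f g : measurable_fun setT f -> (forall x, `|f x| <= g x) ->
  rint g -> rint f.
Proof.
move=> mf fg; apply: le_integrable => //; first exact/measurable_EFinP.
by move=> x _ /=; rewrite lee_fin; apply: le_trans (fg x) (ler_norm _).
Qed.

Lemma rintP f : measurable_fun setT f ->
  rint f <-> (\int[mu]_x (`|f x|)%:E < +oo)%E.
Proof.
by move=> mf; split=> [/integrableP[]//|h]; apply/integrableP; split=> //; exact/measurable_EFinP.
Qed.

Lemma rint_norm f : rint f -> rint (fun x => `|f x|).
Proof.
move=> fi; apply: (rint_le _ (_ : forall x, `| `|f x| | <= `|f x|)).
- by apply: measurableT_comp => //; exact: rint_measurable.
- by move=> x; rewrite normr_id.
exact: integrable_norm.
Qed.

Lemma rintD f g : rint f -> rint g -> rint (fun x => f x + g x).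
Proof. by move=> fi gi; exact: (integrableD measurableT fi gi). Qed.

Lemma rintZ (c : R) f : rint f -> rint (fun x => c * f x).
Proof. by move=> fi; exact: (integrableZl measurableT c fi). Qed.

Lemma rintB f g : rint f -> rint g -> rint (fun x => f x - g x).
Proof. by move=> fi gi; exact: (integrableB measurableT fi gi). Qed.

Lemma rint0 : rint (fun=> 0).
Proof. exact: integrable0. Qed.

Lemma rint_sum I (r : seq I) (F : I -> T -> R) : (forall i, rint (F i)) ->
  rint (fun x => \sum_(i <- r) F i x) /\
  \int[mu]_x (\sum_(i <- r) F i x) = \sum_(i <- r) \int[mu]_x F i x.
Proof.
move=> Fi; elim: r => [|i r [IHi IHI]].
  rewrite (_ : (fun x => _) = fun=> 0); last by apply/funext => x; rewrite big_nil.
  by split; [exact: rint0 | rewrite big_nil Rintegral_cst// mul0r].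
rewrite (_ : (fun x => \sum_(_ <- i :: _) _) =
   fun x => F i x + \sum_(j <- r) F j x); last by apply/funext => x; rewrite big_cons.
split; first exact: rintD.
by rewrite big_cons -IHI; exact: (RintegralD measurableT (Fi i) IHi).
Qed.

Lemma EFin_Rint f : rint f -> (\int[mu]_x f x)%:E = (\int[mu]_x (f x)%:E)%E.
Proof. by move=> fi; rewrite /Rintegral fineK//; exact: integrable_fin_num. Qed.

Lemma le_norm_Rint f g : rint f -> rint g -> (forall x, `|f x| <= g x) ->
  `|\int[mu]_x f x| <= \int[mu]_x g x.
Proof.
move=> fi gi fg; apply: le_trans (le_normr_Rintegral _ fi) _ => //.
by apply: le_Rintegral => //; exact: rint_norm.
Qed.

Lemma rdct (f_ : nat -> T -> R) f g : (forall n, measurable_fun setT (f_ n)) ->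
  (forall x, f_ n x @[n --> \oo] --> f x) -> rint g ->
  (forall n x, `|f_ n x| <= g x) ->
  [/\ rint f, (forall n, rint (f_ n)) &
      (\int[mu]_x f_ n x) @[n --> \oo] --> \int[mu]_x f x].
Proof.
move=> mf cf gi fg.
have mlim : measurable_fun setT f by apply: (measurable_fun_cvg mf) => x _.
have fi : rint f.
  apply: rint_le gi => // x.
  apply: (cvgr_to_le (cvg_norm (cf x))); apply: nearW => n; exact: fg.
have fni n : rint (f_ n) by apply: rint_le gi.
split=> //.
have h : (\int[mu]_x (f_ n x)%:E)%E @[n --> \oo] --> (\int[mu]_x (f x)%:E)%E.
  apply: (@dominated_cvg _ _ _ mu _ measurableT _ _ (EFin \o g)) => //.
  - by move=> n; exact/measurable_EFinP.
  - by move=> x _; apply: cvg_EFin; [exact: nearW | exact: cf].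
  - by move=> n x _ /=; rewrite lee_fin.
rewrite -EFin_Rint// in h.
exact: fine_cvg h.
Qed.

End real_integrals.

(** * Strongly measurable functions as limits of simple functions *)

Section strong_measurability.
Context {d : measure_display} {T : measurableType d} {R : realType}.
Implicit Types E F G : normedModType R.

Lemma simple_fun_preimage E (s : T -> E) (B : set E) : simple_fun s ->
  measurable (s @^-1` B).
Proof.
move=> [fs ms].
rewrite (_ : _ @^-1` _ = \bigcup_(y in range s `&` B) s @^-1` [set y]).
  apply: fin_bigcup_measurable; last by move=> y _; exact: ms.
  by apply: sub_finite_set fs => y [].
apply/seteqP; split => [x Bx|x [y [_ By] /= sy]]; last by rewrite /preimage /= sy.
by exists (s x) => //; split=> //; exists x.
Qed.

Lemma simple_fun_comp E F (g : E -> F) (s : T -> E) : simple_fun s ->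
  simple_fun (g \o s).
Proof.
move=> hs; split; last by move=> y; rewrite comp_preimage; exact: simple_fun_preimage.
by rewrite -(image_comp s g); apply: finite_image; exact: hs.1.
Qed.

Lemma simple_fun_pair E F G (g : E -> F -> G) (s : T -> E) (r : T -> F) :
  simple_fun s -> simple_fun r -> simple_fun (fun x => g (s x) (r x)).
Proof.
move=> hs hr.
have fin : finite_set (range s `*` range r) by apply: finite_setX; [exact: hs.1|exact: hr.1].
split.
  apply: (@sub_finite_set _ _ ((fun p => g p.1 p.2) @` (range s `*` range r))).
    by move=> _ [x _ <-]; exists (s x, r x) => //; split; exists x.
  exact: finite_image.
move=> y; rewrite (_ : _ @^-1` _ =
  \bigcup_(p in (range s `*` range r) `&` [set p | g p.1 p.2 = y])
    (s @^-1` [set p.1] `&` r @^-1` [set p.2])).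
  apply: fin_bigcup_measurable; first by apply: sub_finite_set fin => p [].
  by move=> p _; apply: measurableI; [exact: hs.2|exact: hr.2].
apply/seteqP; split => [x /= <-|x [p [_ /= <-] [/= -> ->]]//].
by exists (s x, r x) => //; split=> //; split; exists x.
Qed.

Lemma simple_fun_measurable (s : T -> R) : simple_fun s -> measurable_fun setT s.
Proof. by move=> hs _ B mB; rewrite setTI; exact: simple_fun_preimage. Qed.

Lemma simple_fun_if E (D : set T) (a b : E) : measurable D ->
  simple_fun (fun x => if x \in D then a else b).
Proof.
move=> mD; split.
  apply: (@sub_finite_set _ _ [set a; b]); last exact: finite_set2.
  by move=> _ [x _ <-]; case: ifP; [left|right].
move=> y.
rewrite (_ : _ @^-1` _ = (D `&` [set x | a = y]) `|` (~` D `&` [set x | b = y])).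
  apply: measurableU; apply: measurableI => //; try exact: measurableC.
    by have [ay|ay] := pselect (a = y); [rewrite (_ : mkset _ = setT)|rewrite (_ : mkset _ = set0)]; rewrite // predeqE.
  by have [ay|ay] := pselect (b = y); [rewrite (_ : mkset _ = setT)|rewrite (_ : mkset _ = set0)]; rewrite // predeqE.
apply/seteqP; split => [x /=|x [[Dx /= <-]|[Dx /= <-]] /=].
- by case: ifPn => [/set_mem Dx|/negP Dx] <-; [left|right; split=> // Dx'; apply/Dx/mem_set].
- by rewrite mem_set.
- by rewrite memNset.
Qed.

Lemma sm_comp E F (g : E -> F) (f : T -> E) : continuous g ->
  strongly_measurable f -> strongly_measurable (g \o f).
Proof.
move=> cg [s hs sf]; exists (fun n => g \o s n) => [n|x]; first exact: simple_fun_comp.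
by apply: (cvg_comp _ _ (sf x)); exact: cg.
Qed.

(** Joint continuity is stated with filters so that sums, scalings, the inner product and the action
    of the memory kernel are all instances. *)
Lemma sm_comp2 E F G (g : E -> F -> G) (f : T -> E) (h : T -> F) :
  (forall S (FS : set_system S) (FF : Filter FS) (u : S -> E) (v : S -> F) a b,
    u x @[x --> FS] --> a -> v x @[x --> FS] --> b -> g (u x) (v x) @[x --> FS] --> g a b) ->
  strongly_measurable f -> strongly_measurable h ->
  strongly_measurable (fun x => g (f x) (h x)).
Proof.
move=> cg [s hs sf] [r hr rh]; exists (fun n x => g (s n x) (r n x)).
  by move=> n; exact: simple_fun_pair.
by move=> x; apply: cg.
Qed.

Lemma simple_sm E (s : T -> E) : simple_fun s -> strongly_measurable s.
Proof. by move=> hs; exists (fun=> s) => // x; exact: cvg_cst. Qed.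

Lemma sm_measurable (f : T -> R) : strongly_measurable f -> measurable_fun setT f.
Proof.
move=> [s hs sf]; apply: (@measurable_fun_cvg _ _ _ _ s).
  by move=> n; apply: simple_fun_measurable; exact: hs.
by move=> x _; exact: sf.
Qed.

Lemma sm_norm E (f : T -> E) : strongly_measurable f ->
  measurable_fun setT (fun x => `|f x|).
Proof.
move=> mf; apply: sm_measurable.
exact: (@sm_comp E R (fun y => `|y|) f (@norm_continuous _ E) mf).
Qed.

Lemma sm_cst E (a : E) : strongly_measurable (fun _ : T => a).
Proof.
apply: simple_sm; rewrite (_ : (fun=> _) = fun x : T => if x \in setT then a else a).
  by apply: simple_fun_if.
by apply/funext => x; case: ifP.
Qed.

Lemma smD E (f g : T -> E) : strongly_measurable f -> strongly_measurable g ->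
  strongly_measurable (fun x => f x + g x).
Proof. by move=> *; apply: (@sm_comp2 _ _ _ +%R) => // *; exact: cvgD. Qed.

Lemma smB E (f g : T -> E) : strongly_measurable f -> strongly_measurable g ->
  strongly_measurable (fun x => f x - g x).
Proof. by move=> *; apply: (@sm_comp2 _ _ _ (fun a b => a - b)) => // *; exact: cvgB. Qed.

Lemma smZ E (f : T -> R) (g : T -> E) : strongly_measurable f ->
  strongly_measurable g -> strongly_measurable (fun x => f x *: g x).
Proof.
move=> mf mg; apply: (@sm_comp2 R E E (fun (a : R) b => a *: b) f g) => //.
by move=> *; exact: cvgZ.
Qed.

Lemma sm_if E (D : set T) (f g : T -> E) : measurable D ->
  strongly_measurable f -> strongly_measurable g ->
  strongly_measurable (fun x => if x \in D then f x else g x).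
Proof.
move=> mD mf mg.
rewrite (_ : (fun x => _) = fun x => (if x \in D then 1 else 0 : R) *: f x +
   (if x \in D then 0 else 1 : R) *: g x); last first.
  by apply/funext => x; case: ifP; rewrite scale1r scale0r ?addr0 ?add0r.
by apply: smD; apply: smZ => //; apply: simple_sm; exact: simple_fun_if.
Qed.

Lemma sm_comp_measurable d' (T' : measurableType d') E (f : T -> E) (h : T' -> T) :
  measurable_fun setT h -> strongly_measurable f -> strongly_measurable (f \o h).
Proof.
move=> mh [s hs sf]; exists (fun n => s n \o h); last by move=> x; exact: sf.
move=> n; split.
  by apply: sub_finite_set (hs n).1 => _ [x _ <-]; exists (h x).
by move=> y; rewrite comp_preimage -[X in measurable X]setTI; apply: mh => //; exact: (hs n).2.
Qed.

(* Truncating to the set where |s_n| <= 2 |f| makes the simple approximations dominated. *)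
Lemma sm_dominated E (f : T -> E) : strongly_measurable f ->
  exists s : nat -> T -> E, [/\ forall n, simple_fun (s n),
    forall n x, `|s n x| <= 2 * `|f x| & forall x, s n x @[n --> \oo] --> f x].
Proof.
move=> mf; have [s hs sf] := mf.
pose D n := [set x | `|s n x| <= 2 * `|f x|].
have mD n : measurable (D n).
  have ms := sm_norm (simple_sm (hs n)); have mfn := sm_norm mf.
  rewrite (_ : D n = setT `&` [set x | `|s n x| <= 2 * `|f x|]); last by rewrite setTI.
  apply: (@measurable_fun_le _ _ _ _ (fun x => `|s n x|) (fun x => 2 * `|f x|)) => //.
  exact: measurable_funM.
exists (fun n x => (if x \in D n then 1 else 0 : R) *: s n x); split.
- move=> n; apply: (@simple_fun_pair R E E (fun (a : R) (b : E) => a *: b)) => //.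
  exact: simple_fun_if.
- move=> n x; case: ifPn => [/set_mem|_]; first by rewrite scale1r.
  by rewrite scale0r normr0 mulr_ge0.
- move=> x; have [fx0|fx0] := eqVneq (f x) 0.
    rewrite fx0 (_ : (fun n => _) = fun=> 0); first exact: cvg_cst.
    apply/funext => n; case: ifPn => [/set_mem|_]; last by rewrite scale0r.
    by rewrite /D /= fx0 normr0 mulr0 normr_le0 => /eqP ->; rewrite scaler0.
  have fx : 0 < `|f x| by rewrite normr_gt0.
  apply: cvg_trans (sf x).
  apply: near_eq_cvg; have := sf x => /cvgrPdistC_lt/(_ _ fx); apply: filterS => n h.
  rewrite mem_set ?scale1r// /D /= mulr_natl mulr2n.
  by rewrite -lerBlDr; apply: le_trans (ltW h); exact: lerB_dist.
Qed.

End strong_measurability.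

(** * Existence and weak characterization of the Bochner integral *)

Section bochner_theory.
Context {d : measure_display} {T : measurableType d} {R : realType}
  (mu : {measure set T -> \bar R}) {H : completeNormedModType R}.
Variable ip : {dot H for idfun}.
Hypothesis hip : norm_of_dot ip.
Implicit Types f s : T -> H.

Definition bint f := strongly_measurable f /\ rint mu (fun x => `|f x|).

Lemma sm_ip f g : strongly_measurable f -> strongly_measurable g ->
  measurable_fun setT (fun x => ip (f x) (g x)).
Proof.
move=> mf mg; apply: sm_measurable.
apply: (@sm_comp2 _ _ _ H H R (fun x y => ip x y)) => // *; exact: cvg_ip.
Qed.

Lemma bint_ip f x : bint f -> rint mu (fun t => ip (f t) x).
Proof.
move=> [mf fi]; apply: (@rint_le _ _ _ _ _ (fun t => `|x| * `|f t|)).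
- by apply: sm_ip => //; exact: sm_cst.
- by move=> t; rewrite mulrC ip_CS.
- exact: rintZ.
Qed.

(** Chebyshev: [|y|] times the measure of the fibre over [y] is at most the integral of [|s|], which
    domination by [f] makes finite. *)
Lemma bint_simple f s : bint f -> simple_fun s -> (forall x, `|s x| <= 2 * `|f x|) ->
  integrable_simple_fun mu s /\ bint s.
Proof.
move=> [mf fi] hs sf; have smf := sm_norm (simple_sm hs).
have si : rint mu (fun x => `|s x|).
  apply: (@rint_le _ _ _ _ _ (fun t => 2 * `|f t|)) => //; last exact: rintZ.
  by move=> x; rewrite normr_id.
split; last by split=> //; exact: simple_sm.
split=> // y y0; have mA : measurable (s @^-1` [set y]) by exact: hs.2.
have /(rintP mu smf) h := si.
have : (`|y|%:E * mu (s @^-1` [set y]) < +oo)%E.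
  apply: le_lt_trans h.
  rewrite -integral_cst//; rewrite -[leLHS](_ : (\int[mu]_(x in s @^-1` [set y]) (`|s x|)%:E = _)%E); last first.
    by apply: eq_integral => x; rewrite inE /= => ->.
  under [leRHS]eq_integral do rewrite normr_id.
  apply: ge0_subset_integral => //.
  exact/measurable_EFinP.
have ny : 0 < `|y| by rewrite normr_gt0.
have := leey (mu (s @^-1` [set y])); rewrite le_eqVlt => /predU1P[->|//].
by rewrite gt0_muley.
Qed.

Lemma simple_integral_ip s x : integrable_simple_fun mu s ->
  rint mu (fun t => ip (s t) x) /\
  ip (simple_integral mu s) x = \int[mu]_t ip (s t) x.
Proof.
move=> [hs si]; have fs := hs.1.
set r : seq H := finmap.enum_fset (fset_set (range s)).
have ur : uniq r by exact: finmap.fset_uniq.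
have mr t : s t \in r.
  by rewrite in_fset_set// inE; exists t.
pose F y t := ip y x * (\1_(s @^-1` [set y]) t : R).
have mI y : measurable_fun setT (\1_(s @^-1` [set y]) : T -> R).
  exact/measurable_indicP/(hs.2 y).
have I0 y t : (0 : R) <= \1_(s @^-1` [set y]) t by rewrite indicE; case: (_ \in _).
have Ii y : y != 0 -> rint mu (\1_(s @^-1` [set y]) : T -> R).
  move=> y0; apply/rintP => //.
  under eq_integral do rewrite ger0_norm//.
  by rewrite integral_indic ?setIT//; [exact: si|exact: hs.2].
(* The fibre of 0 may have infinite measure; its term is harmless because [ip 0 x] vanishes. *)
have Fi y : rint mu (F y).
  have [->|y0] := eqVneq y 0; last by apply: rintZ; exact: Ii.
  by rewrite (_ : F 0 = fun=> 0); [exact: rint0|apply/funext => t; rewrite /F ip0l mul0r].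
have IF y : \int[mu]_t F y t = fine (mu (s @^-1` [set y])) * ip y x.
  have [->|y0] := eqVneq y 0.
    rewrite (_ : F 0 = fun=> 0); last by apply/funext => t; rewrite /F ip0l mul0r.
    by rewrite Rintegral_cst// mul0r ip0l mulr0.
  rewrite /F RintegralZl//; last exact: Ii.
  by rewrite mulrC /Rintegral integral_indic ?setIT//; exact: hs.2.
(* Exactly one indicator, that of the fibre through [t], is nonzero. *)
have sE t : ip (s t) x = \sum_(y <- r) F y t.
  rewrite (bigD1_seq (s t))//= {1}/F indicE mem_set// mulr1.
  rewrite big1 ?addr0// => y yst; rewrite /F indicE memNset ?mulr0//.
  by move=> /= /esym/eqP; rewrite (negPf yst).
have [sumi sumE] := rint_sum r Fi.
split; first by rewrite (_ : (fun t => _) = fun t => \sum_(y <- r) F y t)//; exact/funext.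
have -> : \int[mu]_t ip (s t) x = \int[mu]_t \sum_(y <- r) F y t.
  by apply: eq_Rintegral => t _; exact: sE.
rewrite sumE /simple_integral fsbig_finite//= ip_suml.
by apply: eq_bigr => y _; rewrite ipZl IF.
Qed.

(** Covers every integrable simple [s], dominated by [f] or not, because the sequence hidden in
    [is_bochner] is arbitrary. Integrability of [|s|] is therefore recovered from its finitely many
    values. *)
Lemma simple_integral_close f s x : bint f -> integrable_simple_fun mu s ->
  rint mu (fun t => `|f t - s t|) /\
  `|ip (simple_integral mu s) x - \int[mu]_t ip (f t) x| <=
   `|x| * \int[mu]_t `|f t - s t|.
Proof.
move=> hf hs; have [si sE] := simple_integral_ip x hs.
have msf : strongly_measurable (fun t => f t - s t).
  by apply: smB; [exact: hf.1|exact: simple_sm hs.1].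
suff fsi : rint mu (fun t => `|f t - s t|).
  split=> //; rewrite sE -RintegralB//; last exact: bint_ip.
  rewrite -RintegralZl//; apply: le_norm_Rint => //; first by apply: rintB => //; exact: bint_ip.
    exact: rintZ.
  by move=> t; rewrite -ipBl mulrC distrC ip_CS.
have [hfs hfi] := hf.
suff ssi : rint mu (fun t => `|s t|).
  apply: rint_le (rintD hfi ssi); first exact: sm_norm.
  by move=> t; rewrite normr_id; exact: ler_normB.
have ns : simple_fun (fun t => `|s t|) by exact: (simple_fun_comp (fun y : H => `|y|) hs.1).
have fr := hs.1.1.
set r : seq H := finmap.enum_fset (fset_set (range s)).
pose F y t := `|y| * (\1_(s @^-1` [set y]) t : R).
have I0 y t : (0 : R) <= \1_(s @^-1` [set y]) t by rewrite indicE; case: (_ \in _).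
have Fi y : rint mu (F y).
  have [->|y0] := eqVneq y 0.
    by rewrite (_ : F 0 = fun=> 0); [exact: rint0|apply/funext => t; rewrite /F normr0 mul0r].
  apply: rintZ; apply/rintP; first exact/measurable_indicP/(hs.1.2 y).
  under eq_integral do rewrite ger0_norm//.
  by rewrite integral_indic ?setIT//; [exact: hs.2|exact: hs.1.2].
have [sumi _] := rint_sum r Fi.
apply: rint_le sumi; first exact: simple_fun_measurable.
move=> t; rewrite normr_id.
have mr : s t \in r by rewrite in_fset_set// inE; exists t.
rewrite (bigD1_seq (s t))//= ?finmap.fset_uniq// {1}/F indicE mem_set// mulr1.
by rewrite lerDl sumr_ge0// => y _; rewrite mulr_ge0.
Qed.

Lemma L1_close_fine f (s : nat -> T -> H) : (forall n, rint mu (fun t => `|f t - s n t|)) ->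
  (fun n => \int[mu]_x (`|f x - s n x|)%:E)%E @ \oo --> 0%E <->
  \int[mu]_x `|f x - s n x| @[n --> \oo] --> (0 : R).
Proof.
move=> h; split=> [|h0]; first exact: fine_cvg.
rewrite (_ : (fun n => _) = EFin \o (fun n => \int[mu]_x `|f x - s n x|)).
  by apply: cvg_EFin; [exact: nearW|exact: h0].
by apply/funext => n /=; rewrite EFin_Rint.
Qed.

(** Pairings determine a vector, so the integral is unique and [bochner_eq] can verify vector
    identities one scalar pairing at a time. *)
Lemma is_bochner_ip f v x : bint f -> is_bochner mu f v ->
  ip v x = \int[mu]_t ip (f t) x.
Proof.
move=> hf [_ [s [hs s0 sv]]].
have c n := simple_integral_close x hf (hs n).
have {}s0 := (L1_close_fine (fun n => (c n).1)).1 s0.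
have h1 : ip (simple_integral mu (s n)) x @[n --> \oo] --> ip v x.
  by apply: cvg_ip => //; exact: cvg_cst.
have h2 : ip (simple_integral mu (s n)) x @[n --> \oo] --> \int[mu]_t ip (f t) x.
  apply/cvgrPdistC_le => e e0.
  have h0 : `|x| * \int[mu]_t `|f t - s n t| @[n --> \oo] --> (0 : R).
    by rewrite -(mulr0 `|x|); apply: cvgM => //; exact: cvg_cst.
  move/cvgrPdistC_le/(_ _ e0) : h0; apply: filterS => n; rewrite subr0 => h.
  by apply: le_trans (le_trans (c n).2 _) h; exact: ler_norm.
by rewrite -(cvg_lim _ h1)// -(cvg_lim _ h2).
Qed.

(** The integrals of the dominated approximations form a Cauchy sequence: pairing the difference of
    two of them with itself bounds its norm by the sum of the two L^1 errors. *)
Lemma bint_is_bochner f : bint f -> exists v, is_bochner mu f v.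
Proof.
move=> hf; have [s [hs s2 sf]] := sm_dominated hf.1.
have hsi n := (bint_simple hf (hs n) (s2 n)).1.
have c x n := simple_integral_close x hf (hsi n).
have [_ _ d0] : [/\ rint mu (fun t => 0), (forall n, rint mu (fun t => `|f t - s n t|)) &
   \int[mu]_t `|f t - s n t| @[n --> \oo] --> \int[mu]_t (0 : R)].
  apply: (@rdct _ _ _ mu _ _ (fun t => 3 * `|f t|)).
  - by move=> n; apply: sm_norm; apply: smB; [exact: hf.1|exact: simple_sm].
  - move=> t; rewrite -(normr0 H) -(subrr (f t)); apply: cvg_norm.
    by apply: cvgB; [exact: cvg_cst|exact: sf].
  - apply: rintZ; exact: hf.2.
  - move=> n t; rewrite normr_id; apply: le_trans (ler_normB _ _) _.
    by have := s2 n t; lra.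
rewrite Rintegral_cst// mul0r in d0.
have key n m : `|simple_integral mu (s n) - simple_integral mu (s m)| <=
   \int[mu]_t `|f t - s n t| + \int[mu]_t `|f t - s m t|.
  set D := _ - _.
  have : `|D| ^+ 2 <= (\int[mu]_t `|f t - s n t| + \int[mu]_t `|f t - s m t|) * `|D|.
    rewrite hip {1}/D ipBl.
    have [_ c1] := c D n; have [_ c2] := c D m.
    rewrite mulrDl ![_ * `|D|]mulrC; set J := \int[mu]_t ip (f t) D in c1 c2.
    rewrite -(subrKA J); apply: le_trans (lerD (le_trans (ler_norm _) c1) _) _; last first.
      exact: lexx.
    by apply: le_trans (ler_norm _) _; rewrite distrC.
  have [->|D0] := eqVneq D 0.
    by rewrite normr0 => _; rewrite addr_ge0// Rintegral_ge0.
  by rewrite expr2 ler_pM2r// normr_gt0.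
have := @cauchy_seq_cvg _ _ (fun n => simple_integral mu (s n)).
move=> h; have {}h := h _; exists (lim (simple_integral mu (s n) @[n --> \oo])).
split; first exact: hf.1.
exists s; split => //; first exact/(L1_close_fine (fun n => (c 0 n).1)).
apply: h => e e0; have e2 : 0 < e / 2 by rewrite divr_gt0.
have /cvgrPdistC_le/(_ _ e2)[N _ hN] := d0; exists N => n m Nn Nm.
apply: le_trans (key _ _) _; rewrite (splitr e).
have := hN n Nn; have := hN m Nm; rewrite /= !subr0 => h1 h2.
by apply: lerD; [apply: le_trans h2|apply: le_trans h1]; exact: ler_norm.
Qed.

Lemma bochner_is_bochner f : bint f -> is_bochner mu f (bochner mu f).
Proof.
by move=> /bint_is_bochner[v hv]; rewrite /bochner; case: xgetP => [? -> //|/(_ v)].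
Qed.

Lemma ip_bochner f x : bint f -> ip (bochner mu f) x = \int[mu]_t ip (f t) x.
Proof. by move=> hf; apply: is_bochner_ip => //; exact: bochner_is_bochner. Qed.

Lemma norm_bochner_le f : bint f -> `|bochner mu f| <= \int[mu]_t `|f t|.
Proof.
move=> hf; set v := bochner mu f.
have : `|v| ^+ 2 <= (\int[mu]_t `|f t|) * `|v|.
  rewrite hip ip_bochner// -RintegralZr//; last exact: hf.2.
  apply: le_trans (ler_norm _) _; apply: le_norm_Rint.
  - exact: bint_ip.
  - have h := rintZ `|v| hf.2.
    by rewrite (_ : (fun x => _) = fun x => `|v| * `|f x|)//; apply/funext => x; rewrite mulrC.
  - by move=> t; exact: ip_CS.
have [->|D0] := eqVneq v 0.
  by rewrite normr0 => _; rewrite Rintegral_ge0.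
by rewrite expr2 ler_pM2r// normr_gt0.
Qed.

Lemma bochner_eq f v : bint f -> (forall x, ip v x = \int[mu]_t ip (f t) x) ->
  bochner mu f = v.
Proof. by move=> hf hv; apply: (ip_ext hip) => x; rewrite ip_bochner// hv. Qed.

End bochner_theory.

(** * Measurability on the line; reflection and translation of Lebesgue measure *)

Section lebesgue.
Context {R : realType}.
Local Notation mu := (@lebesgue_measure R).

Import HBSimple.

Lemma measurable_sm d (T : measurableType d) (f : T -> R) :
  measurable_fun setT f -> strongly_measurable f.
Proof.
move=> mf.
have [g gf] := @approximation_sfun _ T R (EFin \o f) setT measurableT ((measurable_EFinP _ _).2 mf).
exists (fun n => g n : T -> R) => [n|x].
  split; first exact: fimfunP.
  by move=> y; exact: measurable_sfunP.
exact: fine_cvg (gf x I).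
Qed.

(** [f] is composed with the identity of the line, itself a limit of simple functions; the
    approximation takes place in [R] and not in [E]. *)
Lemma continuous_sm (E : normedModType R) (f : R -> E) : continuous f ->
  strongly_measurable (f : measurableTypeR R -> E).
Proof.
move=> cf; apply: (@sm_comp _ (measurableTypeR R) R R E f id) => //.
apply: measurable_sm; exact: measurable_id.
Qed.

Lemma measurable_reflect (c : R) :
  measurable_fun setT ((fun x => c - x) : measurableTypeR R -> measurableTypeR R).
Proof.
apply: continuous_measurable_fun => x.
by apply: cvgB; [exact: cvg_cst|exact: cvg_id].
Qed.

Lemma measurable_shift (c : R) :
  measurable_fun setT ((fun x => x - c) : measurableTypeR R -> measurableTypeR R).
Proof.
apply: continuous_measurable_fun => x.
by apply: cvgB; [exact: cvg_id|exact: cvg_cst].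
Qed.

(** Lebesgue measure is determined by half-open intervals, and the preimage of []a, b]] is [[c - b,
    c - a[], of the same length. *)
Lemma lebesgue_reflect (c : R) (A : set (measurableTypeR R)) : measurable A ->
  pushforward mu (fun x : measurableTypeR R => (c - x : measurableTypeR R)) A = mu A.
Proof.
have mphi := measurable_reflect c.
pose phi : {mfun measurableTypeR R >-> measurableTypeR R} :=
  HB.pack (fun x : R => c - x) (isMeasurableFun.Build _ _ _ _ _ mphi).
move=> mA; apply/esym; apply: (@lebesgue_measure_unique R (pushforward mu phi)) => //.
move=> X /ocitvP [->|[[a b] /= ab ->]]; first by rewrite !measure0.
rewrite /pushforward.
rewrite (_ : phi @^-1` _ = `[c - b, c - a[); last first.
  by apply/seteqP; split => x; rewrite /= !in_itv /= !lerBlDl !ltrBrDl andbC (addrC a x) (addrC b x).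
rewrite !lebesgue_measure_itv /= !lte_fin ab.
have -> : c - b < c - a by lra.
by rewrite -!EFinB; congr EFin; ring.
Qed.

Lemma lebesgue_shift (c : R) (A : set (measurableTypeR R)) : measurable A ->
  pushforward mu (fun x : measurableTypeR R => (x - c : measurableTypeR R)) A = mu A.
Proof.
have mphi := measurable_shift c.
pose phi : {mfun measurableTypeR R >-> measurableTypeR R} :=
  HB.pack (fun x : R => x - c) (isMeasurableFun.Build _ _ _ _ _ mphi).
move=> mA; apply/esym; apply: (@lebesgue_measure_unique R (pushforward mu phi)) => //.
move=> X /ocitvP [->|[[a b] /= ab ->]]; first by rewrite !measure0.
rewrite /pushforward.
rewrite (_ : phi @^-1` _ = `]a + c, b + c]); last first.
  by apply/seteqP; split => x; rewrite /= !in_itv /= !lerBlDr !ltrBrDr.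
rewrite !lebesgue_measure_itv /= !lte_fin ab.
have -> : a + c < b + c by lra.
by rewrite -!EFinB; congr EFin; ring.
Qed.

Lemma integral_reflect (c : R) (g : R -> \bar R) :
  measurable_fun (setT : set (measurableTypeR R)) g -> (forall x, 0 <= g x)%E ->
  (\int[mu]_x g (c - x)%R = \int[mu]_x g x)%E.
Proof.
move=> mg g0.
have h := @ge0_integral_pushforward _ _ _ _ R _ (measurable_reflect c) mu setT g measurableT mg (fun x _ => g0 x).
rewrite preimage_setT in h; rewrite -h.
apply: eq_measure_integral => [|? A mA _]; first exact: measurable_reflect.
exact: lebesgue_reflect.
Qed.

Lemma integral_shift (c : R) (g : R -> \bar R) :
  measurable_fun (setT : set (measurableTypeR R)) g -> (forall x, 0 <= g x)%E ->
  (\int[mu]_x g (x - c)%R = \int[mu]_x g x)%E.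
Proof.
move=> mg g0.
have h := @ge0_integral_pushforward _ _ _ _ R _ (measurable_shift c) mu setT g measurableT mg (fun x _ => g0 x).
rewrite preimage_setT in h; rewrite -h.
apply: eq_measure_integral => [|? A mA _]; first exact: measurable_shift.
exact: lebesgue_shift.
Qed.

Lemma rint_reflect (c : R) (g : R -> R) : rint mu g -> rint mu (fun x => g (c - x)).
Proof.
move=> gi; have mg := rint_measurable gi.
have mr : measurable_fun (setT : set (measurableTypeR R)) (fun x : R => g (c - x)).
  exact: (measurableT_comp mg (measurable_reflect c)).
apply/(rintP _ mr).
rewrite (integral_reflect c (g := fun x => (`|g x|)%:E)) //; first exact/(rintP _ mg).
by apply/measurable_EFinP; apply: measurableT_comp.
Qed.

Lemma Rint_reflect (c : R) (g : R -> R) : rint mu g ->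
  \int[mu]_x g (c - x) = \int[mu]_x g x.
Proof.
move=> gi; rewrite /Rintegral; congr fine.
have mg : measurable_fun (setT : set (measurableTypeR R)) (EFin \o g).
  by apply/measurable_EFinP; exact: (rint_measurable gi).
have h := @integral_pushforward _ _ _ _ R _ (measurable_reflect c) mu setT _ mg.
rewrite preimage_setT in h; have := h (rint_reflect c gi) measurableT.
move=> <-.
apply: eq_measure_integral => [|? A mA _]; first exact: measurable_reflect.
exact: lebesgue_reflect.
Qed.

End lebesgue.

(** * Mollifiers and convolution *)

Section smooth.
Context {R : realType}.

(** A class of functions stable under differentiation consists of smooth functions. The bump
    function and the reflected test functions obtain their smoothness from suitable classes. *)
Lemma smooth_ind (E : normedModType R) (P : (R -> E) -> Prop) :
  (forall f, P f -> exists2 f', P f' & forall t, isD f t (f' t)) ->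
  forall f, P f -> forall k, P f^`(k) /\ Ck k f.
Proof.
move=> hP f Pf; have dP g : P g -> (forall t, derivable g t 1) /\ P g^`().
  move=> /hP[g' Pg' gd]; split=> [t|]; first exact: isD_derivable (gd t).
  by rewrite (_ : g^`() = g')//; apply/funext => t; exact: isD_derive1.
have Pk k : P f^`(k) by elim: k => [|k IH]; [rewrite derive1n0|rewrite derive1nS; exact: (dP _ IH).2].
move=> k; split=> //; split.
  by move=> j _ t; exact: (dP _ (Pk j)).1.
by apply: derivable_continuous => t; exact: (dP _ (Pk k)).1.
Qed.

Lemma smooth_isD (E : normedModType R) (f : R -> E) : (forall k, Ck k f) ->
  forall j t, isD f^`(j) t (f^`(j.+1) t).
Proof. by move=> hf j t; rewrite derive1nS; apply: derivable_isD; exact: (hf j.+1).1. Qed.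

Lemma smooth_continuous (E : normedModType R) (f : R -> E) : (forall k, Ck k f) ->
  forall j, continuous f^`(j).
Proof. by move=> hf j; exact: (hf j).2. Qed.

Lemma isD_reflect (E : normedModType R) (f : R -> E) c t d :
  isD f (c - t) d -> isD (fun x => f (c - x)) t (- d).
Proof.
move=> /isD_ed fd; apply/isD_ed => e e0; have [dl dl0 hdl] := fd e e0.
exists dl => // h hd; have := hdl (- h); rewrite normrN => /(_ hd).
by rewrite scaleNr scalerN (_ : c - (h + t) = - h + (c - t))//; ring.
Qed.

(** Differentiating e^(-1/x) produces the factors x^(-n) e^(-1/x); with all [n] included, their
    linear span is closed under differentiation. *)
Definition expinv (n : nat) (x : R) : R :=
  if 0 < x then x^-1 ^+ n * expR (- x^-1) else 0.

Lemma expinv_ge0 n x : 0 <= expinv n x.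
Proof.
rewrite /expinv; case: ltP => // x0.
by rewrite mulr_ge0 ?expR_ge0 ?exprn_ge0 ?invr_ge0 ?ltW.
Qed.

Lemma exprn_le_expR (n : nat) (y : R) : 0 <= y -> y ^+ n <= n%:R ^+ n * expR y.
Proof.
move=> y0; case: n => [|n]; first by rewrite !expr0 mul1r; apply: le_trans (expR_ge1Dx y); rewrite lerDl.
rewrite -{2}(divfK (_ : n.+1%:R != 0 :> R) y) ?pnatr_eq0// expRM_natr -exprMn.
apply: lerXn2r; rewrite ?nnegrE ?mulr_ge0 ?expR_ge0//.
rewrite -ler_pdivrMl// mulrC; apply: le_trans (expR_ge1Dx _).
by rewrite lerDr.
Qed.

(** Raising the exponent by two trades the bound of [exprn_le_expR] for a factor [x ^+ 2], which
    makes the extension by zero differentiable at 0 with derivative 0. *)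
Lemma expinv_small n (x : R) : 0 <= x -> expinv n x <= n.+2%:R ^+ n.+2 * x ^+ 2.
Proof.
move=> x0; rewrite /expinv; case: ifPn => [x1|_]; last by rewrite mulr_ge0 ?exprn_ge0.
have := @exprn_le_expR n.+2 x^-1; rewrite invr_ge0 => /(_ x0) h.
rewrite expRN ler_pdivrMr ?expR_gt0//.
have -> : x^-1 ^+ n = x^-1 ^+ n.+2 * x ^+ 2.
  by rewrite -addn2 exprD -mulrA -exprMn mulVf ?expr1n ?mulr1// gt_eqF.
  by rewrite [leRHS]mulrAC ler_wpM2r// exprn_ge0.
Qed.

Lemma expinv_isD n (x : R) : isD (expinv n) x (expinv n.+2 x - n%:R * expinv n.+1 x).
Proof.
have [x0|x0|->] := ltgtP x 0.
- have near0 t : t < 0 -> expinv n t = 0 by move=> t0; rewrite /expinv ltNge (ltW t0).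
  rewrite /expinv ltNge (ltW x0) /= mulr0 subr0; apply/isD_ed => e e0.
  exists (- x); first by rewrite oppr_gt0.
  move=> h hx; rewrite -!/(expinv _ _) !near0// ?subr0 ?scaler0 ?subr0 ?normr0 ?mulr_ge0//.
    by rewrite ltW.
  by have := ler_norm h; move: hx; lra.
- pose F (t : R) : R := t^-1 ^+ n * expR (- t^-1).
  have Fd : isD F x (expinv n.+2 x - n%:R * expinv n.+1 x).
    apply/isD_is_derive; rewrite /expinv x0.
    have xn0 : x != 0 by rewrite gt_eqF.
    have hV : is_derive x 1 (fun t : R => t^-1) (- x^-1 ^+ 2).
      apply: DeriveDef; first by apply: derivableV => //; exact: derivable_id.
      by rewrite deriveV// derive_id exprVn [_ *: _]mulr1.
    have hX : is_derive x 1 (fun t : R => t^-1 ^+ n) ((n%:R * x^-1 ^+ n.-1) *: - x^-1 ^+ 2).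
      by have := is_deriveX n hV; rewrite exprfctE.
    have hE := @is_derive1_comp _ expR (fun t : R => - t^-1) x _ _ (is_derive_expR _) (is_deriveN hV).
    have h : is_derive x 1 F _ := is_deriveM hX hE.
    apply: (is_derive_eq h).
    rewrite /GRing.scale /= opprK.
    case: (n) => [|n1]; first by rewrite !mul0r; ring.
    by rewrite /= !exprS; ring.
  apply: (isD_ed _ _ _).2 => e e0; have [dl dl0 hdl] := (isD_ed _ _ _).1 Fd e e0.
  exists (Num.min dl x); first by rewrite lt_min dl0.
  move=> h; rewrite lt_min => /andP[h1 h2].
  have hx : 0 < h + x by have := ler_norm (- h); rewrite normrN; move: h2; lra.
  by rewrite {1}/expinv hx {1}/expinv x0; exact: hdl.
- have z0 k : expinv k 0 = 0 by rewrite /expinv ltxx.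
  rewrite !z0 mulr0 subr0; apply: (isD_ed _ _ _).2 => e e0.
  set C := n.+2%:R ^+ n.+2 : R.
  have C0 : 0 < C by rewrite exprn_gt0.
  exists (e / C); first by rewrite divr_gt0.
  move=> h; rewrite ltr_pdivlMr// => hd; rewrite addr0 z0 scaler0 !subr0.
  rewrite ger0_norm ?expinv_ge0//.
  have [h0|h0] := leP 0 h; last first.
    have -> : expinv n h = 0 by rewrite /expinv ltNge (ltW h0).
    by apply: mulr_ge0 => //; exact: ltW.
  apply: le_trans (expinv_small n h0) _; rewrite -/C (ger0_norm h0) expr2 mulrA.
  by apply: ler_wpM2r => //; move: hd; rewrite (ger0_norm h0) mulrC; exact: ltW.
Qed.

(** Products of a factor that is flat at 0 with the mirror image of such a factor at [a], closed
    under linear combinations: the smallest convenient class that contains a bump on [0, a] and all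
    its derivatives. *)
Inductive bumpspan (a : R) : (R -> R) -> Prop :=
| bumpspan_prod n m : bumpspan a (fun x => expinv n x * expinv m (a - x))
| bumpspan_add f g : bumpspan a f -> bumpspan a g -> bumpspan a (fun x => f x + g x)
| bumpspan_scale c f : bumpspan a f -> bumpspan a (fun x => c * f x).

Lemma bumpspan_isD a f : bumpspan a f -> exists2 f', bumpspan a f' & forall t, isD f t (f' t).
Proof.
elim=> [n m|{}f g _ [f' hf fd] _ [g' hg gd]|c {}f _ [f' hf fd]].
- pose B i j x : R := expinv i x * expinv j (a - x).
  have Bs i j : bumpspan a (B i j) by exact: bumpspan_prod.
  exists (fun x => (B n.+2 m x + - n%:R * B n.+1 m x) + (- 1 * B n m.+2 x + m%:R * B n m.+1 x)).
    apply: (@bumpspan_add a (fun x => B n.+2 m x + - n%:R * B n.+1 m x)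
      (fun x => -1 * B n m.+2 x + m%:R * B n m.+1 x)).
      apply: (@bumpspan_add a (B n.+2 m) (fun x => - n%:R * B n.+1 m x)) => //.
      exact: (@bumpspan_scale a (- n%:R) (B n.+1 m)).
    apply: (@bumpspan_add a (fun x => -1 * B n m.+2 x) (fun x => m%:R * B n m.+1 x)).
      exact: (@bumpspan_scale a (-1) (B n m.+2)).
    exact: (@bumpspan_scale a m%:R (B n m.+1)).
  move=> t; apply/isD_is_derive.
  have h1 := (isD_is_derive _ _ _).1 (@expinv_isD n t).
  have h2 := (isD_is_derive _ _ _).1 (isD_reflect (@expinv_isD m (a - t))).
  have h : is_derive t 1 (fun x => expinv n x * expinv m (a - x)) _ := is_deriveM h1 h2.
  apply: (is_derive_eq h).
  rewrite /GRing.scale /= /B; ring.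
- by exists (fun x => f' x + g' x); [exact: bumpspan_add|move=> t; exact: isDD].
- by exists (fun x => c * f' x); [exact: bumpspan_scale|move=> t; exact: isDZ].
Qed.

End smooth.

(** * Linearity of the Bochner integral; adjoints of bounded operators *)

Section bochner_linear.
Context {d : measure_display} {T : measurableType d} {R : realType}
  (mu : {measure set T -> \bar R}) {H : completeNormedModType R}.
Variable ip : {dot H for idfun}.
Hypothesis hip : norm_of_dot ip.
Implicit Types f g : T -> H.

Lemma bintD f g : bint mu f -> bint mu g -> bint mu (fun t => f t + g t).
Proof.
move=> [mf fi] [mg gi]; have m := smD mf mg; split=> //.
apply: rint_le (rintD fi gi); first exact: sm_norm.
by move=> t; rewrite normr_id ler_normD.
Qed.

Lemma bintB f g : bint mu f -> bint mu g -> bint mu (fun t => f t - g t).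
Proof.
move=> [mf fi] [mg gi]; have m := smB mf mg; split=> //.
apply: rint_le (rintD fi gi); first exact: sm_norm.
by move=> t; rewrite normr_id ler_normB.
Qed.

Lemma bintZ (c : R) f : bint mu f -> bint mu (fun t => c *: f t).
Proof.
move=> [mf fi]; have m := smZ (sm_cst c) mf; split=> //.
apply: rint_le (rintZ `|c| fi); first exact: sm_norm.
by move=> t; rewrite normr_id normrZ.
Qed.

Lemma bint_le f (g : T -> R) : strongly_measurable f -> (forall t, `|f t| <= g t) ->
  rint mu g -> bint mu f.
Proof.
move=> mf fg gi; split=> //; apply: rint_le gi; first exact: sm_norm.
by move=> t; rewrite normr_id.
Qed.

Lemma bochnerD f g : bint mu f -> bint mu g ->
  bochner mu (fun t => f t + g t) = bochner mu f + bochner mu g.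
Proof.
move=> hf hg; apply: (bochner_eq hip); first exact: bintD.
move=> x; rewrite ipDl (ip_bochner hip x hf) (ip_bochner hip x hg).
rewrite -(RintegralD measurableT (bint_ip hip x hf) (bint_ip hip x hg)).
by apply: eq_Rintegral => t _; rewrite ipDl.
Qed.

Lemma bochnerB f g : bint mu f -> bint mu g ->
  bochner mu (fun t => f t - g t) = bochner mu f - bochner mu g.
Proof.
move=> hf hg; apply: (bochner_eq hip); first exact: bintB.
move=> x; rewrite ipBl (ip_bochner hip x hf) (ip_bochner hip x hg).
rewrite -(RintegralB measurableT (bint_ip hip x hf) (bint_ip hip x hg)).
by apply: eq_Rintegral => t _; rewrite ipBl.
Qed.

Lemma bochnerZ (c : R) f : bint mu f ->
  bochner mu (fun t => c *: f t) = c *: bochner mu f.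
Proof.
move=> hf; apply: (bochner_eq hip); first exact: bintZ.
move=> x; rewrite ipZl !(ip_bochner hip)// -RintegralZl//; try exact: (bint_ip hip).
by apply: eq_Rintegral => t _; rewrite ipZl.
Qed.

Lemma adjoint_vec (L : {linear H -> H}) y : continuous L ->
  exists z, forall x, ip (L x) y = ip x z.
Proof.
move=> cL; have [M M0 hM] := bounded_op cL.
have [||z hz] := @riesz _ _ _ hip (fun x => ip (L x) y) (M * `|y|).
- by move=> a u v; rewrite linearP ipDl ipZl.
- move=> x; apply: le_trans (ip_CS hip _ _) _.
  by rewrite mulrAC ler_wpM2r.
by exists z => x; rewrite hz ipC.
Qed.

Lemma adjointE (L : {linear H -> H}) x y : continuous L ->
  ip (L x) y = ip x (adjoint ip L y).
Proof.
move=> cL; have [z hz] := adjoint_vec y cL.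
by rewrite /adjoint; case: xgetP => [w _ hw|/(_ z)//]; exact: hw.
Qed.

End bochner_linear.

(** * Mollifiers and the test functions built from them *)

Section mollifier.
Context {R : realType}.
Local Notation mu := (@lebesgue_measure R).

Lemma smooth_vanish (E : normedModType R) (f : R -> E) (U : set R) : open U ->
  (forall x, U x -> f x = 0) -> forall j x, U x -> f^`(j) x = 0.
Proof.
move=> oU fU; elim=> [|j IH] x Ux; first by rewrite derive1n0 fU.
rewrite derive1nS; apply: isD_derive1; apply/isD_ed => e e0.
have /nbhs_ballP[dl /= dl0 hdl] : nbhs x U by exact: open_nbhs_nbhs.
exists dl => // h hd.
have Uh : U (h + x) by apply: hdl; rewrite -ball_normE /= opprD addrCA subrr addr0 normrN.
by rewrite !IH// scaler0 !subr0 normr0 mulr_ge0// ltW.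
Qed.

Lemma bounded_support (E : normedModType R) (f : R -> E) (a b : R) : continuous f ->
  (forall x, x < a \/ b < x -> f x = 0) -> exists2 M, 0 <= M & forall x, `|f x| <= M.
Proof.
move=> cf f0; have [ab|ab] := leP a b; last first.
  exists 0 => // x; rewrite f0 ?normr0//.
  by have [xa|ax] := ltP x a; [left|right; exact: lt_le_trans ax].
have cn : continuous (fun x => `|f x|) by move=> x; apply: cvg_norm; exact: cf.
have [c _ hc] := EVT_max ab (continuous_subspaceT cn).
exists `|f c| => // x; have [xa|ax] := ltP x a.
  by rewrite f0 ?normr0//; left.
have [bx|xb] := ltP b x; first by rewrite f0 ?normr0//; right.
by apply: hc; rewrite in_itv /= ax.
Qed.

Lemma rint_itv (a b : R) : rint mu (\1_(`[a, b]%classic) : R -> R).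
Proof.
have m : measurable_fun (setT : set (measurableTypeR R)) (\1_(`[a, b]%classic) : R -> R).
  exact/measurable_indicP.
apply/(rintP _ m).
under eq_integral do rewrite ger0_norm ?indicE ?ler0n//.
rewrite (_ : (fun x => _) = fun x => (\1_(`[a, b]%classic) x)%:E)//.
rewrite integral_indic// setIT [X in (X < _)%E]lebesgue_measure_itv/=.
by case: ifP => _; rewrite ?ltry// -EFinB ltry.
Qed.

Lemma rint_bounded_support (f : R -> R) (a b M : R) :
  measurable_fun (setT : set (measurableTypeR R)) f -> (forall x, `|f x| <= M) ->
  (forall x, x < a \/ b < x -> f x = 0) -> rint mu f.
Proof.
move=> mf fM f0; apply: (rint_le mf _ (rintZ M (rint_itv a b))) => x.
rewrite indicE; have [xab|xab] := boolP (x \in _); first by rewrite mulr1.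
rewrite mulr0 f0 ?normr0//; have [xa|ax] := ltP x a; first by left.
have [bx|xb] := ltP b x; first by right.
by move: xab; rewrite mem_set//= in_itv /= ax.
Qed.

(** The support lies in [0, a] instead of being symmetric about 0: a convolution at [tau] then
    involves only times in [tau - a, tau], so vanishing before a given time and bounds on ]-oo, t]
    are preserved. *)
Definition mollifier (a : R) (psi : R -> R) :=
  [/\ forall k, Ck k psi, forall x, 0 <= psi x,
      forall j x, x < 0 \/ a < x -> psi^`(j) x = 0, rint mu psi &
      \int[mu]_x psi x = 1].

Lemma mollifier_exists (a : R) : 0 < a -> exists psi, mollifier a psi.
Proof.
move=> a0; pose f x : R := expinv 0 x * expinv 0 (a - x).
have fs : bumpspan a f by exact: bumpspan_prod.
have fk k : Ck k f := (smooth_ind (@bumpspan_isD _ a) fs k).2.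
have f0 x : 0 <= f x by rewrite mulr_ge0 ?expinv_ge0.
have fout x : x < 0 \/ a < x -> f x = 0.
  case=> h; rewrite /f; first by rewrite {1}/expinv ltNge (ltW h) mul0r.
  by rewrite [X in _ * X]/expinv subr_gt0 ltNge (ltW h) mulr0.
have cf : continuous f by have [] := fk 0%N.
have mf : measurable_fun (setT : set (measurableTypeR R)) f by exact: continuous_measurable_fun.
have [M M0 hM] := bounded_support cf fout.
have fi : rint mu f by exact: rint_bounded_support mf hM fout.
set I := \int[mu]_x f x.
have I0 : 0 < I.
  (* On [a/4, 3a/4] both [x] and [a - x] are at least a/4, so each factor is at least e^(-4/a). *)
  have hc : 0 < expR (- (4 / a)) * expR (- (4 / a)) :> R by rewrite mulr_gt0 ?expR_gt0.
  set c := _ * _ in hc.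
  apply: (@lt_le_trans _ _ (c * (a / 2))); first by rewrite mulr_gt0 ?divr_gt0.
  have -> : c * (a / 2) = \int[mu]_x (c * \1_(`[a / 4, 3 * a / 4]%classic) x).
    rewrite RintegralZl//; last exact: rint_itv.
    congr (_ * _); rewrite /Rintegral integral_indic// setIT.
    rewrite [X in fine X]lebesgue_measure_itv/= lte_fin ifT; first by rewrite -EFinB /=; field.
    by rewrite ltr_pM2r ?invr_gt0//; lra.
  apply: le_Rintegral => //; first by apply: rintZ; exact: rint_itv.
  move=> x _; rewrite indicE; have [/set_mem|_] := boolP (x \in _); last by rewrite mulr0.
  rewrite /= in_itv /= mulr1 => /andP[h1 h2]; rewrite /c /f.
  have key y : a / 4 <= y -> expR (- (4 / a)) <= expinv 0 y.
    move=> ya; have y0 : 0 < y by apply: lt_le_trans ya; rewrite divr_gt0.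
    rewrite /expinv y0 expr0 mul1r ler_expR lerN2 -[leRHS]invrK lef_pV2 ?posrE ?invr_gt0 ?divr_gt0//.
    by rewrite invf_div.
  by apply: ler_pM; rewrite ?expR_ge0//; apply: key => //; lra.
exists (fun x => I^-1 * f x); split.
- have gs : bumpspan a (fun x => I^-1 * f x) by exact: bumpspan_scale.
  by move=> k; exact: (smooth_ind (@bumpspan_isD _ a) gs k).2.
- by move=> x; apply: mulr_ge0 => //; rewrite invr_ge0 ltW.
- move=> j x [xo|xo].
    apply: (@smooth_vanish _ _ [set y : R | y < 0]); [exact: open_lt| |exact: xo].
    by move=> y /= y0; rewrite fout ?mulr0//; left.
  apply: (@smooth_vanish _ _ [set y : R | a < y]); [exact: open_gt| |exact: xo].
  by move=> y /= y0; rewrite fout ?mulr0//; right.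
- exact: rintZ.
- by rewrite RintegralZl// -/I mulVf// gt_eqF.
Qed.

Lemma isDZl (E : normedModType R) (f : R -> R) t d (w : E) :
  isD f t d -> isD (fun x => f x *: w) t (d *: w).
Proof.
move=> fd; rewrite /isD; under eq_fun do rewrite -scalerBl scalerA.
exact: cvgZr_tmp.
Qed.

(** These are the test functions inserted into the weak equation. The argument [tau - t] is
    reflected, so each derivative contributes a sign; in the proof the sign is stored in the vector,
    which keeps the family closed under differentiation. *)
Lemma test_fun_mollifier (E : normedModType R) a psi j (tau : R) (w : E) : mollifier a psi ->
  test_fun (fun t => derive1n j psi (tau - t) *: w) /\
  forall l t, derive1n l (fun t => derive1n j psi (tau - t) *: w) t =
              ((-1) ^+ l * derive1n (j + l) psi (tau - t)) *: w.
Proof.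
move=> [sp _ p0 _ _].
pose F j (w : E) t := derive1n j psi (tau - t) *: w.
have FD i v t : isD (F i v) t (F i.+1 (- v) t).
  rewrite /F scalerN -scaleNr; apply: isDZl.
  have := @smooth_isD _ _ psi sp i (tau - t).
  exact: (@isD_reflect _ _ (derive1n i psi) tau t).
have Fl i v l : (F i v)^`(l) = F (i + l)%N ((-1) ^+ l *: v).
  elim: l => [|l IH]; first by rewrite derive1n0 addn0 scale1r.
  rewrite derive1nS IH; apply/funext => t; rewrite (isD_derive1 (FD _ _ t)) addnS.
  by rewrite exprS mulN1r scaleNr.
split; last by move=> l t; rewrite -/(F j w) Fl /F scalerA mulrC.
pose P f := exists i v, f = F i v.
split.
  move=> k; have PF : P (F j w) by exists j, w.
  apply: (smooth_ind _ PF k).2 => _ [i [v ->]].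
  by exists (F i.+1 (- v)) => //; exists i.+1, (- v).
have sub : closure [set t | F j w t != 0] `<=` `[tau - a, tau].
  rewrite [X in _ `<=` X]((closure_id `[tau - a, tau]%classic).1 _); last exact: interval_closed.
  apply: closure_subset => t /= Ft; rewrite in_itv /= lerBlDr -lerBlDl.
  rewrite leNgt [_ <= tau]leNgt -negb_or; apply/negP => /orP h.
  move: Ft; rewrite /F p0 ?scale0r ?eqxx//.
  by case: h => h; [right|left; rewrite subr_lt0].
apply: (subclosed_compact _ (@segment_compact _ (tau - a) tau) sub).
exact: closed_closure.
Qed.

End mollifier.

(** * Uniform continuity, indicator factors and almost-everywhere statements *)

Section real_line.
Context {R : realType}.
Local Notation mu := (@lebesgue_measure R).
Implicit Types E : normedModType R.

(** Only [s] is confined to [a, b]; [t] may leave the interval, as shifted arguments do. *)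
Lemma heine E (f : R -> E) (a b : R) : continuous f -> forall e : R, 0 < e ->
  exists2 dl, 0 < dl & forall s t, a <= s <= b -> `|t - s| < dl -> `|f t - f s| <= e.
Proof.
move=> cf e e0.
have cK := @segment_compact R a b.
pose P (dl : R) (s : R) := forall t, `|t - s| < dl -> `|f t - f s| <= e.
have /compact_near_coveringP/(_ R (0 : R)^'+ P _) := cK.
move=> h; have {h} : \forall dl \near (0 : R)^'+, `[a, b] `<=` P dl.
  apply: h => s _; have e2 : 0 < e / 2 by rewrite divr_gt0.
  have /cts_ed/(_ _ e2)[d d0 hd] := cf s.
  have d2 : 0 < d / 2 by rewrite divr_gt0.
  exists (ball s (d / 2), [set dl | 0 < dl < d / 2]).
    split; first exact: nbhsx_ballx.
    near=> dl; apply/andP; split; first by near: dl; exact: nbhs_right_gt.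
    by near: dl; exact: nbhs_right_lt.
  move=> [x dl] [/=]; rewrite -ball_normE /= => sx /andP[dl0 dld] t tx.
  rewrite (_ : f t - f x = (f t - f s) - (f x - f s)); last by rewrite opprB addrA subrK.
  rewrite (splitr e); apply: le_trans (ler_normB _ _) _; apply: lerD; apply: hd.
    rewrite (_ : t - s = (t - x) - (s - x)); last by ring.
    by rewrite (splitr d); apply: le_lt_trans (ler_normB _ _) _; apply: ltrD => //; exact: lt_trans tx dld.
  by rewrite distrC (lt_le_trans sx)// ler_pdivrMr// mulr_natr mulr2n lerDl ltW.
move=> h.
have [d /= d0 hd] := h.
exists (d / 2); first by rewrite divr_gt0.
move=> s t sab ts; apply: (hd (d / 2)) => //=.
- rewrite sub0r normrN gtr0_norm ?divr_gt0// ltr_pdivrMr// mulr_natr mulr2n.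
  by rewrite ltrDl.
- by rewrite divr_gt0.
Unshelve. all: by end_near. Qed.

(** Integrals over a subset are rewritten with an indicator factor, so that the single predicate
    [rint] on the whole line serves all domains. *)
Lemma integral_indic_mul (D : set R) (g : R -> R) :
  (\int[mu]_(x in D) (g x)%:E = \int[mu]_x (\1_D x * g x)%:E)%E.
Proof.
rewrite integral_mkcond; apply: eq_integral => x _.
by rewrite patchE indicE; case: ifP; rewrite ?mul1r ?mul0r.
Qed.

Lemma indic_ge0 (D : set R) (x : R) : (0 : R) <= \1_D x.
Proof. by rewrite indicE. Qed.

Lemma indic_le1 (D : set R) (x : R) : \1_D x <= (1 : R).
Proof. by rewrite indicE; case: (_ \in _). Qed.

Lemma measurable_indicM (D : set R) (g : R -> R) :
  measurable (D : set (measurableTypeR R)) ->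
  measurable_fun (setT : set (measurableTypeR R)) g ->
  measurable_fun (setT : set (measurableTypeR R)) (fun x => \1_D x * g x).
Proof. by move=> mD mg; apply: measurable_funM => //; exact/measurable_indicP. Qed.

Lemma rint_indicP (D : set R) (g : R -> R) :
  measurable (D : set (measurableTypeR R)) ->
  measurable_fun (setT : set (measurableTypeR R)) g -> (forall x, 0 <= g x) ->
  (rint mu (fun x => \1_D x * g x) <-> (\int[mu]_(x in D) (g x)%:E < +oo)%E).
Proof.
move=> mD mg g0; rewrite integral_indic_mul rintP; last exact: measurable_indicM.
by under eq_integral do rewrite ger0_norm ?mulr_ge0 ?indic_ge0//.
Qed.

Lemma rint_indic (D : set R) (g : R -> R) :
  measurable (D : set (measurableTypeR R)) -> rint mu g ->
  rint mu (fun x => \1_D x * g x).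
Proof.
move=> mD gi; have mg := rint_measurable gi.
apply: rint_le (rint_norm gi); first exact: measurable_indicM.
by move=> x; rewrite normrM ger0_norm ?indic_ge0// ler_piMl// indic_le1.
Qed.

Lemma aeS (P Q : R -> Prop) : (forall x, P x -> Q x) ->
  {ae mu, forall x, P x} -> {ae mu, forall x, Q x}.
Proof. exact: (@filterS _ _ (ae_filter_ringOfSetsType mu)). Qed.

Lemma aeT (P : R -> Prop) : (forall x, P x) -> {ae mu, forall x, P x}.
Proof. by move=> h; apply: aeS (@filterT _ _ (ae_filter_ringOfSetsType mu)) => x _. Qed.

Lemma aeI (P Q : R -> Prop) : {ae mu, forall x, P x} -> {ae mu, forall x, Q x} ->
  {ae mu, forall x, P x /\ Q x}.
Proof. exact: (@filterI _ _ (ae_filter_ringOfSetsType mu)). Qed.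

Lemma Rint_ae (f g : R -> R) : rint mu f -> rint mu g ->
  {ae mu, forall x, f x = g x} -> \int[mu]_x f x = \int[mu]_x g x.
Proof.
move=> fi gi fg; rewrite /Rintegral; congr fine.
apply: ae_eq_integral => //.
- by apply/measurable_EFinP; exact: rint_measurable fi.
- by apply/measurable_EFinP; exact: rint_measurable gi.
- by move: fg; apply: aeS => x /= ->.
Qed.

(* Lindelof: the union of the open sets on which u vanishes almost everywhere
   is covered by countably many rational intervals. *)
Lemma ae_ess_supp E (u : R -> E) T : ess_supp u `<=` `[T, +oo[ ->
  {ae mu, forall t, t < T -> u t = 0}.
Proof.
move=> uT.
(* Rational intervals are enumerated through [unpickle], so that countably many null sets can be
   united. *)
pose Q n (x : R) := if @unpickle (rat * rat)%type n is Some (p, q) then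
  {ae mu, forall s, ratr p < s < ratr q -> u s = 0} -> ratr p < x < ratr q -> u x = 0
  else True.
have : {ae mu, forall x, forall n, Q n x}.
  apply: ae_foralln => n; rewrite /Q.
  case: unpickle => [[p q]|]; last exact: aeT.
  have [h|h] := pselect ({ae mu, forall s, ratr p < s < ratr q -> u s = 0}).
    by apply: aeS h => x hx _.
  by apply: aeT => x /h.
apply: aeS => x hx xT.
have : ~ ess_supp u x by move=> /uT /=; rewrite in_itv /= andbT leNgt xT.
rewrite /ess_supp /= => /contrapT[U /nbhs_ballP[e /= e0 he] Uu].
have xe : x - e < x by rewrite ltrBlDr ltrDl.
have [p] := rat_in_itvoo xe; rewrite in_itv /= => /andP[p1 p2].
have ex : x < x + e by rewrite ltrDl.
have [q] := rat_in_itvoo ex; rewrite in_itv /= => /andP[q1 q2].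
have := hx (pickle (p, q)); rewrite /Q pickleK; apply; last by rewrite p2 q1.
apply: aeS Uu => s Us /andP[ps sq]; apply: Us; apply: he.
rewrite -ball_normE /= ltr_norml; apply/andP; split; lra.
Qed.

Lemma vanish_ess_supp E (u : R -> E) T : (forall t, t < T -> u t = 0) ->
  ess_supp u `<=` `[T, +oo[.
Proof.
move=> uT x; rewrite /ess_supp /= => hx; rewrite in_itv /= andbT leNgt; apply/negP => xT.
apply: hx; exists [set t | t < T]; first exact: open_nbhs_nbhs (conj (@open_lt _ T) xT).
exact: aeT.
Qed.

End real_line.

(** * Convolution of a compactly supported kernel with a locally integrable function *)

Section convolution.
Context {R : realType} {H : completeNormedModType R}.
Local Notation mu := (@lebesgue_measure R).
Variable ip : {dot H for idfun}.
Hypothesis hip : norm_of_dot ip.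
Implicit Types (u : R -> H) (K psi : R -> R).

Definition L1loc u := strongly_measurable (u : measurableTypeR R -> H) /\
  forall a b : R, rint mu (fun t => \1_(`[a, b]) t * `|u t|).

Lemma measurable_normX2 u : strongly_measurable (u : measurableTypeR R -> H) ->
  measurable_fun (setT : set (measurableTypeR R)) (fun t => `|u t| ^+ 2).
Proof.
move=> mu_; apply: (@measurable_funX _ _ _ _ (fun t => `|u t|)); exact: sm_norm.
Qed.

Lemma L2loc_rint u a b : L2loc u -> rint mu (fun t => \1_(`[a, b]) t * `|u t| ^+ 2).
Proof.
by move=> [mu_ ui]; apply/rint_indicP => //; exact: measurable_normX2.
Qed.

Lemma L2loc_L1loc u : L2loc u -> L1loc u.
Proof.
move=> hu; split=> [|a b]; first exact: hu.1.
apply: rint_le (rintD (rint_itv a b) (L2loc_rint a b hu)).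
  by apply: measurable_indicM => //; exact: sm_norm hu.1.
move=> t; rewrite ger0_norm ?mulr_ge0 ?indic_ge0//.
rewrite -[X in _ <= X + _]mulr1 -mulrDr; apply: ler_wpM2l; first exact: indic_ge0.
have := sqr_ge0 (`|u t| - 1); have := normr_ge0 (u t); nra.
Qed.

Lemma continuous_L1loc u : continuous u -> L1loc u.
Proof.
move=> cu; split=> [|a b]; first exact: continuous_sm.
have [M M0 hM] : exists2 M, 0 <= M & forall t, a <= t <= b -> `|u t| <= M.
  have [ab|ab] := leP a b; last by exists 0 => // t /andP[h1 h2]; lra.
  have cn : continuous (fun x => `|u x|) by move=> x; apply: cvg_norm; exact: cu.
  have [c _ hc] := EVT_max ab (continuous_subspaceT cn).
  by exists `|u c| => // t tab; apply: hc; rewrite in_itv.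
apply: rint_le (rintZ M (rint_itv a b)).
  by apply: measurable_indicM => //; apply: sm_norm; exact: continuous_sm.
move=> t; rewrite ger0_norm ?mulr_ge0 ?indic_ge0// indicE.
have [/set_mem|] := boolP (t \in _); last by rewrite mul0r mulr0.
by rewrite /= in_itv /= mul1r mulr1 => /hM.
Qed.

Definition conv K u (tau : R) : H := bochner mu (fun t : R => K (tau - t) *: u t).

Definition kernel_on (a : R) K := continuous K /\ forall x, x < 0 \/ a < x -> K x = 0.

Lemma kernel_bounded a K : kernel_on a K -> exists2 M, 0 <= M & forall x, `|K x| <= M.
Proof. by move=> [cK K0]; exact: bounded_support cK K0. Qed.

Lemma mollifier_kernel a psi j : mollifier a psi -> kernel_on a psi^`(j).
Proof. by move=> [sp _ p0 _ _]; split; [exact: smooth_continuous|exact: p0]. Qed.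

Lemma kernel_refl_continuous (E : normedModType R) (K : R -> E) tau : continuous K -> continuous (fun t => K (tau - t)).
Proof.
move=> cK t; apply: (cvg_comp (fun t => tau - t) K); last exact: cK.
by apply: cvgB; [exact: cvg_cst|exact: cvg_id].
Qed.

Lemma bint_conv a K u tau : kernel_on a K -> L1loc u ->
  bint mu (fun t => K (tau - t) *: u t).
Proof.
move=> hK hu; have [M M0 hM] := kernel_bounded hK.
apply: (bint_le _ _ (rintZ M (hu.2 (tau - a) tau))).
  apply: smZ; last exact: hu.1.
  by apply: continuous_sm; apply: kernel_refl_continuous; exact: hK.1.
move=> t; rewrite normrZ indicE; have [tI|tI] := boolP (t \in _).
  by rewrite mul1r ler_wpM2r.
rewrite hK.2 ?normr0 ?mul0r ?mulr0//.
move: tI; rewrite notin_setE /= in_itv /= => /negP; rewrite negb_and -!ltNge.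
by case/orP => h; [right; lra|left; lra].
Qed.

Lemma ip_conv a K u tau x : kernel_on a K -> L1loc u ->
  ip (conv K u tau) x = \int[mu]_t (K (tau - t) * ip (u t) x).
Proof.
move=> hK hu; rewrite /conv (ip_bochner hip); last exact: bint_conv hK hu.
by apply: eq_Rintegral => t _; rewrite ipZl.
Qed.

Lemma rint_conv a K u tau x : kernel_on a K -> L1loc u ->
  rint mu (fun t => K (tau - t) * ip (u t) x).
Proof.
move=> hK hu; have := bint_ip hip x (bint_conv tau hK hu).
by congr (rint mu _); apply/funext => t; rewrite ipZl.
Qed.

Lemma convB a K u v tau : kernel_on a K -> L1loc u -> L1loc v ->
  conv K (fun t => u t - v t) tau = conv K u tau - conv K v tau.
Proof.
move=> hK hu hv; rewrite /conv -(bochnerB hip); try exact: bint_conv hK _.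
by congr bochner; apply/funext => t; rewrite scalerBr.
Qed.

Lemma convD a K u v tau : kernel_on a K -> L1loc u -> L1loc v ->
  conv K (fun t => u t + v t) tau = conv K u tau + conv K v tau.
Proof.
move=> hK hu hv; rewrite /conv -(bochnerD hip); try exact: bint_conv hK _.
by congr bochner; apply/funext => t; rewrite scalerDr.
Qed.

Lemma conv_ae a K u v tau : kernel_on a K -> L1loc u -> L1loc v ->
  {ae mu, forall t, tau - a <= t <= tau -> u t = v t} -> conv K u tau = conv K v tau.
Proof.
move=> hK hu hv uv; apply: (ip_ext hip) => x.
rewrite (ip_conv tau x hK hu) (ip_conv tau x hK hv).
apply: Rint_ae; [exact: rint_conv hK hu|exact: rint_conv hK hv|].
move: uv; apply: aeS => t huv.
have [h|h] := boolP (tau - a <= t <= tau); first by rewrite huv.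
rewrite hK.2 ?mul0r//; move: h; rewrite negb_and -!ltNge.
by case/orP => h; [right; lra|left; lra].
Qed.

Lemma L1loc0 : L1loc (fun=> 0).
Proof. by apply: continuous_L1loc => x; exact: cvg_cst. Qed.

Lemma conv_vanish a K u T tau : kernel_on a K -> L1loc u ->
  {ae mu, forall t, t < T -> u t = 0} -> tau < T -> conv K u tau = 0.
Proof.
move=> hK hu u0 tT; rewrite (conv_ae hK hu L1loc0).
  apply: (ip_ext hip) => x; rewrite (ip_conv _ _ hK L1loc0).
  rewrite (_ : (fun t => _) = fun=> 0); first by rewrite Rintegral_cst// mul0r ip0l.
  by apply/funext => t; rewrite ip0l mulr0.
move: u0; apply: aeS => t h /andP[_ tt]; apply: h; lra.
Qed.

(* A Lipschitz bound on the derivative of the kernel gives the quadratic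
   remainder needed to differentiate under the integral sign. *)
Lemma conv_isD a K K1 K2 u tau : L1loc u ->
  (forall x, isD K x (K1 x)) -> (forall x, isD K1 x (K2 x)) ->
  kernel_on a K -> kernel_on a K1 -> kernel_on a K2 ->
  isD (conv K u) tau (conv K1 u tau).
Proof.
move=> hu dK dK1 hK hK1 hK2; have [M M0 hM] := kernel_bounded hK2.
have lagrange (f f' : R -> R) x h : (forall x, isD f x (f' x)) ->
    exists2 c, `|c - x| <= `|h| & f (h + x) - f x = h * f' c.
  move=> fd; have fc : continuous f by move=> z; exact: isD_cts (fd z).
  have [h0|h0|->] := ltgtP h 0; last by exists x; rewrite ?subrr ?add0r ?subrr ?mul0r.
    have hx : h + x < x by rewrite gtrDr.
    have [|c cI E] := MVT hx _ (continuous_subspaceT fc) (df := f').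
      by move=> z _; apply/isD_is_derive.
    exists c; last by rewrite -opprB E; ring.
    have /andP[c1 c2] : h + x < c < x by rewrite !(itvP cI).
    by rewrite (ltr0_norm h0) ltr0_norm ?subr_lt0//; lra.
  have hx : x < h + x by rewrite ltrDr.
  have [|c cI E] := MVT hx _ (continuous_subspaceT fc) (df := f').
    by move=> z _; apply/isD_is_derive.
  exists c; last by rewrite E; ring.
  have /andP[c1 c2] : x < c < h + x by rewrite !(itvP cI).
  by rewrite (gtr0_norm h0) gtr0_norm ?subr_gt0//; lra.
have rem x h : `|K (h + x) - K x - h * K1 x| <= M * h ^+ 2.
  have [c cx ->] := lagrange K K1 x h dK.
  have [c' _ E] := lagrange K1 K2 x (c - x) dK1; rewrite subrK in E.
  rewrite -mulrBr E !normrM mulrA.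
  have hh : `|h| * `|c - x| <= h ^+ 2 by rewrite -(real_normK (num_real h)) expr2 ler_wpM2l.
  by rewrite [leRHS]mulrC; apply: ler_pM.
(* The window is enlarged by one on each side: for [|h| < 1] the kernels centred at [tau] and at
   [h + tau] both vanish outside it. *)
pose J t : R := \1_(`[tau - a - 1, tau + 1]) t * `|u t|.
have Ji : rint mu J by exact: hu.2.
have J0 : 0 <= \int[mu]_t J t by apply: Rintegral_ge0 => t _; rewrite mulr_ge0 ?indic_ge0.
have key h : `|h| < 1 ->
    `|conv K u (h + tau) - conv K u tau - h *: conv K1 u tau| <= M * h ^+ 2 * \int[mu]_t J t.
  move=> h1.
  have b1 := bint_conv (h + tau) hK hu; have b2 := bint_conv tau hK hu.
  have b3 := bint_conv tau hK1 hu.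
  rewrite /conv -(bochnerZ hip h b3) -(bochnerB hip b1 b2).
  rewrite -(bochnerB hip (bintB b1 b2) (bintZ h b3)).
  rewrite -RintegralZl//.
  have b4 := bintB (bintB b1 b2) (bintZ h b3).
  apply: le_trans (norm_bochner_le hip b4) _.
  apply: le_Rintegral => //; [exact: b4.2|exact: rintZ|].
  move=> t _; rewrite scalerA -!scalerBl normrZ /J indicE.
  have [_|tI] := boolP (t \in _).
    rewrite mul1r ler_wpM2r//; have := rem (tau - t) h.
    by rewrite [h + (tau - t)]addrA.
  have : t < tau - a - 1 \/ tau + 1 < t.
    move: tI; rewrite notin_setE /= in_itv /= => /negP; rewrite negb_and -!ltNge.
    by case/orP => ?; [left|right].
  have [hl hr] : - 1 < h /\ h < 1 by move: h1; rewrite ltr_norml => /andP[].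
  move=> tt; rewrite hK.2 ?hK.2 ?hK1.2 ?mulr0 ?subrr ?normr0 ?mul0r ?mulr0//;
    by case: tt => tt; [right; lra|left; lra].
apply/isD_ed => e e0; set I := \int[mu]_t J t in J0 key.
have MI : 0 < 1 + M * I by rewrite ltr_wpDr// mulr_ge0.
exists (Num.min 1 (e / (1 + M * I))); first by rewrite lt_min ltr01 divr_gt0.
move=> h; rewrite lt_min => /andP[h1 h2]; apply: le_trans (key h h1) _.
rewrite -(real_normK (num_real h)) mulrAC expr2 mulrA ler_wpM2r//.
move: h2; rewrite ltr_pdivlMr// => h2; apply: le_trans (ltW h2).
by rewrite mulrC ler_wpM2l// lerDr.
Qed.

Lemma conv_mollifier_isD a psi j u tau : mollifier a psi -> L1loc u ->
  isD (conv psi^`(j) u) tau (conv psi^`(j.+1) u tau).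
Proof.
move=> hp hu; have [sp _ _ _ _] := hp.
apply: (@conv_isD a _ _ psi^`(j.+2)) => //; try exact: mollifier_kernel hp;
  move=> x; exact: smooth_isD.
Qed.

Lemma conv_continuous a psi j u : mollifier a psi -> L1loc u -> continuous (conv psi^`(j) u).
Proof. by move=> hp hu t; exact: (isD_cts (@conv_mollifier_isD a psi j u t hp hu)). Qed.

End convolution.

(** * Mollification as a contraction of L^2 *)

Section L2.
Context {R : realType} {H : completeNormedModType R}.
Local Notation mu := (@lebesgue_measure R).
Variable ip : {dot H for idfun}.
Hypothesis hip : norm_of_dot ip.
Implicit Types (h g : R -> H) (psi : R -> R).

Definition isL2 h := strongly_measurable (h : measurableTypeR R -> H) /\
  rint mu (fun t => `|h t| ^+ 2).

Lemma isL2_L1loc h : isL2 h -> L1loc h.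
Proof.
move=> hh; split=> [|a b]; first exact: hh.1.
apply: rint_le (rintD (rint_itv a b) hh.2).
  by apply: measurable_indicM => //; exact: sm_norm hh.1.
move=> t; rewrite ger0_norm ?mulr_ge0 ?indic_ge0//.
have [h1 h2] := (indic_ge0 `[a, b] t, indic_le1 `[a, b] t).
move: (\1_ _ t : R) h1 h2 => i i0 i1.
have := sqr_ge0 (`|h t| - 1); have := normr_ge0 (h t); nra.
Qed.

Lemma isL2D h g : isL2 h -> isL2 g -> isL2 (fun t => h t + g t).
Proof.
move=> hh hg; have m := smD hh.1 hg.1; split=> //.
apply: rint_le (rintD (rintZ 2 hh.2) (rintZ 2 hg.2)); first exact: measurable_normX2.
by move=> t; rewrite ger0_norm ?sqr_ge0// normr2D.
Qed.

Lemma isL2B h g : isL2 h -> isL2 g -> isL2 (fun t => h t - g t).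
Proof.
move=> hh hg; have m := smB hh.1 hg.1; split=> //.
apply: rint_le (rintD (rintZ 2 hh.2) (rintZ 2 hg.2)); first exact: measurable_normX2.
by move=> t; rewrite ger0_norm ?sqr_ge0// -[X in _ + 2 * X ^+ 2]normrN normr2D.
Qed.

(** Stands in for the L^2 triangle inequality; the lost constants are harmless in approximation
    arguments. *)
Lemma nrm2_le h g : isL2 h -> isL2 g ->
  \int[mu]_t `|h t + g t| ^+ 2 <= 2 * \int[mu]_t `|h t| ^+ 2 + 2 * \int[mu]_t `|g t| ^+ 2.
Proof.
move=> hh hg; rewrite -!RintegralZl//; [|exact: hg.2|exact: hh.2].
rewrite -RintegralD//; [|exact: rintZ hh.2|exact: rintZ hg.2].
apply: le_Rintegral => //; first exact: (isL2D hh hg).2.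
  exact: rintD (rintZ 2 hh.2) (rintZ 2 hg.2).
by move=> t _; exact: normr2D.
Qed.

Lemma mollifier_kernel0 a psi : mollifier a psi -> kernel_on a psi.
Proof. by move=> /(mollifier_kernel 0); rewrite derive1n0. Qed.

Lemma conv0_continuous a psi h : mollifier a psi -> L1loc h -> continuous (conv psi h).
Proof. by move=> hp hh; have := @conv_continuous _ _ _ hip a psi 0 h hp hh; rewrite derive1n0. Qed.

Lemma mollifier_shift a psi c : mollifier a psi ->
  rint mu (fun t => psi (c - t)) /\ \int[mu]_t psi (c - t) = 1.
Proof.
by move=> [_ _ _ pi p1]; split; [exact: rint_reflect|rewrite Rint_reflect].
Qed.

Lemma measurable_diff : measurable_fun (setT : set (measurableTypeR R * measurableTypeR R))
  ((fun p => p.1 - p.2) : measurableTypeR R * measurableTypeR R -> measurableTypeR R).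
Proof.
exact: (@measurable_funB _ (measurableTypeR R * measurableTypeR R)%type R setT
  (fun p => p.1 : R) (fun p => p.2 : R) measurable_fst measurable_snd).
Qed.

(* Jensen through the inner product: |z|^2 = int psi <h, z> <= int psi (|h|^2 + |z|^2) / 2. *)
Lemma conv_contraction a psi h : mollifier a psi -> isL2 h ->
  isL2 (conv psi h) /\ \int[mu]_t `|conv psi h t| ^+ 2 <= \int[mu]_t `|h t| ^+ 2.
Proof.
move=> hp hh; have hK := mollifier_kernel0 hp; have hl := isL2_L1loc hh.
have [_ p0 _ pi p1] := hp.
have mp : measurable_fun (setT : set (measurableTypeR R)) psi by exact: rint_measurable pi.
have mh : measurable_fun (setT : set (measurableTypeR R)) (fun t => `|h t| ^+ 2).
  exact: rint_measurable hh.2.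
have [M M0 hM] := kernel_bounded hK.
have mpr tau : measurable_fun (setT : set (measurableTypeR R)) (fun t => psi (tau - t)).
  exact: rint_measurable (mollifier_shift tau hp).1.
have Ji tau : rint mu (fun t => psi (tau - t) * `|h t| ^+ 2).
  apply: rint_le (rintZ M hh.2); first exact: measurable_funM.
  by move=> t; rewrite normrM (ger0_norm (sqr_ge0 _)) ler_wpM2r ?sqr_ge0.
have jensen tau : `|conv psi h tau| ^+ 2 <= \int[mu]_t (psi (tau - t) * `|h t| ^+ 2).
  set z := conv psi h tau; have [si s1] := mollifier_shift tau hp.
  have : `|z| ^+ 2 <= 2^-1 * \int[mu]_t (psi (tau - t) * `|h t| ^+ 2) + (2^-1 * `|z| ^+ 2) * \int[mu]_t psi (tau - t).
    have r1 := rintZ 2^-1 (Ji tau); have r2 := rintZ (2^-1 * `|z| ^+ 2) si.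
    have E1 : \int[mu]_t (2^-1 * (psi (tau - t) * `|h t| ^+ 2)) =
      2^-1 * \int[mu]_t (psi (tau - t) * `|h t| ^+ 2) by apply: RintegralZl => //; exact: Ji.
    have E2 : \int[mu]_t (2^-1 * `|z| ^+ 2 * psi (tau - t)) =
      2^-1 * `|z| ^+ 2 * \int[mu]_t psi (tau - t) by apply: RintegralZl.
    have E3 := RintegralD measurableT r1 r2.
    rewrite {1}hip {1}/z (ip_conv hip _ _ hK hl) -E1 -E2 -E3.
    apply: le_Rintegral => //; [exact: (rint_conv hip _ _ hK hl)|exact: rintD r1 r2|].
    move=> t _; have := ip_le hip (h t) z; have := sqr_ge0 (`|h t| - `|z|).
    move: (p0 (tau - t)) (ip _ _) (`|h t|) (`|z|) => + i x y; move: (psi _) => q q0 h1 h2.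
    have h3 : i <= 2^-1 * x ^+ 2 + 2^-1 * y ^+ 2 by move: h1 h2; rewrite sqrrB; lra.
    by apply: le_trans (ler_wpM2l q0 h3) _; rewrite le_eqVlt; apply/orP; left; apply/eqP; ring.
  (* Since [psi] has integral 1, half of [|z|^2] is absorbed by the left side. *)
  rewrite s1; move: (`|z| ^+ 2) (\int[mu]_t _) => *; lra.
have cc := conv0_continuous hp hl.
have mc : strongly_measurable (conv psi h : measurableTypeR R -> H) by exact: continuous_sm.
have mc2 := measurable_normX2 mc.
pose F (p : R * R) : \bar R := (psi (p.1 - p.2) * `|h p.2| ^+ 2)%:E.
have mF : measurable_fun (setT : set (measurableTypeR R * measurableTypeR R)) F.
  apply/measurable_EFinP; apply: measurable_funM.
    exact: (measurableT_comp mp measurable_diff).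
  exact: (measurableT_comp mh measurable_snd).
have F0 p : (0 <= F p)%E by rewrite lee_fin mulr_ge0 ?sqr_ge0.
have key : (\int[mu]_t (`|conv psi h t| ^+ 2)%:E <= \int[mu]_t (`|h t| ^+ 2)%:E)%E.
  (* Tonelli: after exchanging the order, the inner integral of the translated mollifier is 1. *)
  apply: (@le_trans _ _ (\int[mu]_x \int[mu]_y F (x, y))%E).
    apply: ge0_le_integral => //.
    - exact/measurable_EFinP.
    - exact: (@measurable_fun_fubini_tonelli_F _ _ _ _ R mu F mF F0).
    - move=> x _; rewrite -EFin_Rint; last exact: Ji.
      by rewrite lee_fin; exact: jensen.
  rewrite (@fubini_tonelli _ _ _ _ R mu mu F mF F0) le_eqVlt; apply/orP; left; apply/eqP.
  apply: eq_integral => y _; rewrite /F /=.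
  under eq_integral do rewrite mulrC EFinM.
  rewrite ge0_integralZl//; last 2 first.
  - apply/measurable_EFinP; exact: (measurableT_comp mp (measurable_shift y)).
  - by move=> x _; rewrite lee_fin.
  rewrite (@integral_shift R y (fun x => (psi x)%:E)).
  - by rewrite -EFin_Rint// p1 mule1.
  - exact/measurable_EFinP.
  - by move=> x; rewrite lee_fin.
have hL2 : rint mu (fun t => `|conv psi h t| ^+ 2).
  apply/rintP => //; under eq_integral do rewrite ger0_norm ?sqr_ge0//.
  by apply: le_lt_trans key _; rewrite -EFin_Rint ?ltry//; exact: hh.2.
split; first by split.
by rewrite -lee_fin !EFin_Rint//; exact: hh.2.
Qed.

(** The threshold is uniform over all mollifiers of small support, so no particular sequence needs
    to be fixed beforehand. *)
Definition approx_id h := forall e : R, 0 < e -> exists2 dl : R, 0 < dl &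
  forall a psi, 0 < a -> a <= dl -> mollifier a psi ->
    \int[mu]_t `|conv psi h t - h t| ^+ 2 <= e.

Lemma approx_idD h g : isL2 h -> isL2 g -> approx_id h -> approx_id g ->
  approx_id (fun t => h t + g t).
Proof.
move=> lh lg hh hg e e0; have e4 : 0 < e / 4 by rewrite divr_gt0.
have [d1 d10 h1] := hh _ e4; have [d2 d20 h2] := hg _ e4.
exists (Num.min d1 d2); first by rewrite lt_min d10.
move=> a psi a0; rewrite le_min => /andP[a1 a2] hp.
have hK := mollifier_kernel0 hp.
have := nrm2_le (isL2B (conv_contraction hp lh).1 lh) (isL2B (conv_contraction hp lg).1 lg).
have := h1 a psi a0 a1 hp; have := h2 a psi a0 a2 hp.
rewrite (_ : (fun t => `|conv psi (fun t => h t + g t) t - (h t + g t)| ^+ 2) =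
  (fun t => `|conv psi h t - h t + (conv psi g t - g t)| ^+ 2)); last first.
  apply/funext => t; rewrite (convD hip _ hK (isL2_L1loc lh) (isL2_L1loc lg)).
  by rewrite opprD addrACA.
move: (\int[mu]_t _) (\int[mu]_t _) (\int[mu]_t _) => *; lra.
Qed.

(** The error splits into the mollified [h - g], the error of [g], and [g - h]; by contraction the
    first is no larger than the last. *)
Lemma approx_id_closed h : isL2 h ->
  (forall e : R, 0 < e -> exists g, [/\ isL2 g, approx_id g & \int[mu]_t `|h t - g t| ^+ 2 <= e]) ->
  approx_id h.
Proof.
(* The three pieces enter with factors 2, 4 and 4 after two uses of [nrm2_le], which [e / 12]
   covers. *)
move=> lh hg e e0; have e9 : 0 < e / 12 by rewrite divr_gt0.
have [g [lg ag hge]] := hg _ e9; have [dl dl0 hdl] := ag _ e9.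
exists dl => // a psi a0 adl hp; have hK := mollifier_kernel0 hp.
have lhg := isL2B lh lg; have [lc cle] := conv_contraction hp lhg.
have lcg := isL2B (conv_contraction hp lg).1 lg.
have lgh := isL2B lg lh.
have i1 := nrm2_le lc (isL2D lcg lgh); have i2 := nrm2_le lcg lgh.
have E : \int[mu]_t `|g t - h t| ^+ 2 = \int[mu]_t `|h t - g t| ^+ 2.
  by apply: eq_Rintegral => t _; rewrite distrC.
have i3 := hdl a psi a0 adl hp.
rewrite (_ : (fun t => `|conv psi h t - h t| ^+ 2) =
  (fun t => `|conv psi (fun t => h t - g t) t + (conv psi g t - g t + (g t - h t))| ^+ 2)); last first.
  apply/funext => t; rewrite (convB hip _ hK (isL2_L1loc lh) (isL2_L1loc lg)).
  by rewrite !subrKA.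
move: i1 i2 i3 cle hge; rewrite E.
move: (\int[mu]_t _) (\int[mu]_t _) (\int[mu]_t _) (\int[mu]_t _) (\int[mu]_t _) => *; lra.
Qed.

End L2.

(** * Mollifiers approximate the identity on L^2 functions of bounded support *)

Section L2_approximation.
Context {R : realType} {H : completeNormedModType R}.
Local Notation mu := (@lebesgue_measure R).
Variable ip : {dot H for idfun}.
Hypothesis hip : norm_of_dot ip.
Implicit Types (h g : R -> H) (psi : R -> R).

(** A convolution is an average over [tau - a, tau]; pairing the difference [D] with itself reduces
    this to a scalar average. *)
Lemma conv_near a psi h tau (e : R) : mollifier a psi -> L1loc h -> 0 <= e ->
  (forall t, tau - a <= t <= tau -> `|h t - h tau| <= e) ->
  `|conv psi h tau - h tau| <= e.
Proof.
move=> hp hh e0 hte; have hK := mollifier_kernel0 hp.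
have [_ p0 _ _ _] := hp.
set D := _ - _.
have [si s1] := mollifier_shift tau hp.
have E1 : \int[mu]_t (ip (h tau) D * psi (tau - t)) = ip (h tau) D * \int[mu]_t psi (tau - t).
  exact: RintegralZl.
have r1 := rint_conv hip tau D hK hh; have r2 := rintZ (ip (h tau) D) si.
have r3 := rintZ (e * `|D|) si.
have E3 : \int[mu]_t (e * `|D| * psi (tau - t)) = e * `|D| * \int[mu]_t psi (tau - t).
  exact: RintegralZl.
have : `|D| ^+ 2 <= e * `|D|.
  rewrite hip {1}/D ipBl (ip_conv hip _ _ hK hh) -[X in _ - X]mulr1 -s1 -E1.
  have E2 := RintegralB measurableT r1 r2.
  rewrite -E2 -[leRHS]mulr1 -s1 -E3; apply: le_Rintegral => //; first exact: rintB r1 r2.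
  move=> t _; rewrite mulrC -mulrBl -ipBl.
  have [tt|tt] := boolP (tau - a <= t <= tau).
    apply: ler_wpM2r; first exact: p0.
    by apply: le_trans (ip_le hip _ _) _; rewrite ler_wpM2r// hte.
  rewrite hK.2 ?mulr0//; move: tt; rewrite negb_and -!ltNge.
  by case/orP => ?; [right; lra|left; lra].
have [->|D0] := eqVneq D 0; first by rewrite normr0.
by rewrite expr2 ler_pM2r// normr_gt0.
Qed.

Lemma continuous_isL2 h (b c : R) : continuous h -> (forall t, t < b \/ c < t -> h t = 0) ->
  isL2 h.
Proof.
move=> ch h0; have [M M0 hM] := bounded_support ch h0.
have mh : strongly_measurable (h : measurableTypeR R -> H) by exact: continuous_sm.
split=> //; apply: (@rint_bounded_support _ _ b c (M ^+ 2)).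
- exact: measurable_normX2.
- by move=> x; rewrite ger0_norm ?sqr_ge0// lerXn2r ?nnegrE.
- by move=> x /h0 ->; rewrite normr0 expr0n.
Qed.

Lemma approx_id_continuous h (b c : R) : continuous h ->
  (forall t, t < b \/ c < t -> h t = 0) -> approx_id h.
Proof.
move=> ch h0 e e0.
have lh := continuous_isL2 ch h0; have hl := isL2_L1loc lh.
(* For [a <= 1] the error lives on [b, c + 1], whose length [L] bounds. A pointwise error [eta <= 1]
   with [eta <= e / L] has [eta ^+ 2 <= e / L]. *)
pose L := Num.max (c + 1 - b) 1.
have L0 : 0 < L by rewrite lt_max ltr01 orbT.
pose eta := Num.min 1 (e / L).
have eta0 : 0 < eta by rewrite lt_min ltr01 divr_gt0.
have [dl dl0 hdl] := heine (b - 1) (c + 1) ch eta0.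
exists (Num.min 1 (dl / 2)); first by rewrite lt_min ltr01 divr_gt0.
move=> a psi a0; rewrite le_min => /andP[a1 adl] hp; have hK := mollifier_kernel0 hp.
have eta2 : eta ^+ 2 <= e / L.
  apply: (@le_trans _ _ eta); last by rewrite ge_min lexx orbT.
  by rewrite expr2 ler_piMr ?(ltW eta0)// ge_min lexx.
have key t : `|conv psi h t - h t| ^+ 2 <= eta ^+ 2 * \1_(`[b, c + 1]) t.
  rewrite indicE; have [tI|tI] := boolP (t \in _).
    rewrite mulr1 lerXn2r ?nnegrE ?(ltW eta0)//.
    apply: (conv_near hp hl (ltW eta0)) => s /andP[s1 s2].
    apply: hdl; first by move: tI; rewrite inE /= in_itv /= => /andP[? ?]; lra.
    by rewrite ler0_norm ?subr_le0//; move: adl; rewrite ler_pdivlMr// ; lra.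
  have tt : t < b \/ c + 1 < t.
    move: tI; rewrite notin_setE /= in_itv /= => /negP; rewrite negb_and -!ltNge.
    by case/orP => ?; [left|right].
  have ht : h t = 0 by apply: h0; case: tt => ?; [left|right; lra].
  have : `|conv psi h t - h t| <= 0.
    apply: (conv_near hp hl) => // s /andP[s1 s2]; rewrite ht subr0 h0 ?normr0//.
    by case: tt => ?; [left|right]; lra.
  by rewrite normr_le0 => /eqP ->; rewrite normr0 expr0n /= mulr0.
have l2 := isL2B (conv_contraction hip hp lh).1 lh.
apply: (@le_trans _ _ (\int[mu]_t (eta ^+ 2 * \1_(`[b, c + 1]) t))).
  apply: le_Rintegral => //; first exact: l2.2.
  by apply: rintZ; exact: rint_itv.
rewrite RintegralZl//; last exact: rint_itv.
rewrite /Rintegral integral_indic// setIT [X in fine X]lebesgue_measure_itv/= lte_fin.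
have [bc|bc] := ltP b (c + 1); last by rewrite mulr0 ltW.
apply: (@le_trans _ _ (e / L * (c + 1 - b))).
  by apply: ler_wpM2r => //; rewrite subr_ge0 ltW.
rewrite -mulrA ler_piMr ?(ltW e0)// mulrC ler_pdivrMr// mul1r.
by rewrite le_max lexx.
Qed.

Definition clip01 (x : R) := Num.max 0 (Num.min 1 x).

Lemma clip01_bound x : 0 <= clip01 x <= 1.
Proof. by rewrite /clip01 le_max lexx /= ge_max ler01 ge_min lexx. Qed.

Lemma clip01_continuous : continuous clip01.
Proof.
move=> x.
have c1 : {for x, continuous (fun y : R => Num.min 1 y)}.
  by apply: (@continuous_min R R (fun=> 1) id x); [exact: cvg_cst|exact: cvg_id].
by apply: (@continuous_max R R (fun=> 0) (fun y => Num.min 1 y) x) => //; exact: cvg_cst.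
Qed.

Lemma clip01_close (b : bool) x : `|b%:R - clip01 x| <= `|b%:R - x|.
Proof.
rewrite /clip01; case: b => /=.
  have [x1|x1] := leP 1 x.
    by rewrite (max_idPr _) ?ler01// subrr normr0.
  have [x0|x0] := leP 0 x; first by [].
  by rewrite subr0 normr1 ger0_norm ?subr_ge0 ?(ltW x1)//; lra.
have [x1|x1] := leP 1 x.
  by rewrite (max_idPr _) ?ler01// !sub0r !normrN normr1 ger0_norm// (le_trans ler01).
have [x0|x0] := leP 0 x; first by [].
by rewrite subrr normr0.
Qed.

(* An indicator is L^2-close to a continuous function of compact support:
   clip an L^1-approximation to [0, 1] and cut it off outside [b, c]. *)
Lemma approx_id_indic (A : set R) (b c : R) (y : H) :
  measurable (A : set (measurableTypeR R)) -> A `<=` `[b, c] ->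
  isL2 (fun t => \1_A t *: y) /\ approx_id (fun t => \1_A t *: y).
Proof.
move=> mA Abc.
pose h t : H := \1_A t *: y.
have mI : measurable_fun (setT : set (measurableTypeR R)) (\1_A : R -> R).
  exact/measurable_indicP.
have lh : isL2 h.
  have m : strongly_measurable (h : measurableTypeR R -> H).
    by apply: smZ; [exact: measurable_sm|exact: sm_cst].
  split=> //; apply: rint_le (rintZ (`|y| ^+ 2) (rint_itv b c)); first exact: measurable_normX2.
  move=> t; rewrite ger0_norm ?sqr_ge0// /h normrZ exprMn mulrC.
  rewrite ler_wpM2l ?sqr_ge0// !indicE.
  have [/set_mem/Abc tbc|_] := boolP (t \in A).
    by rewrite mem_set// normr1 expr1n.
  by rewrite normr0 expr0n ler0n.
split=> //; apply: (approx_id_closed hip) => // e e0.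
pose K := `[b - 1, c + 1]%classic : set R.
have mK : measurable (K : set (measurableTypeR R)) by exact: measurable_itv.
have Kfin : (mu K < +oo)%E.
  by rewrite [X in (X < _)%E]lebesgue_measure_itv/= lte_fin; case: ifP => _; rewrite ?ltry// -EFinB ltry.
have iI : mu.-integrable K (EFin \o (\1_A : R -> R)).
  apply: measurable_bounded_integrable => //.
  exists 1; split=> [|x x1 t _ /=]; [exact: num_real|apply: le_trans (ltW x1)].
  by rewrite ger0_norm ?indic_ge0// indic_le1.
have [g [cg ig g0]] := approximation_continuous_integrable mK Kfin iI.
have y1 : 0 < 1 + `|y| ^+ 2 by rewrite ltr_wpDr// sqr_ge0.
have e1 : 0 < e / (1 + `|y| ^+ 2) by rewrite divr_gt0.
have [n hn] : exists n, (\int[mu]_(z in K) `|(\1_A z - g n z)%:E| <= (e / (1 + `|y| ^+ 2))%:E)%E.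
  have /fine_cvgP[_ /cvgrPdistC_le/(_ _ e1) [N _ hN]] := g0.
  have /fine_cvgP[[N' _ fN] _] := g0.
  exists (maxn N N'); have := hN (maxn N N') (leq_maxl _ _).
  have fi : (\int[mu]_(z in K) `|(\1_A z - g (maxn N N') z)%:E|)%E \is a fin_num.
    exact: fN (leq_maxr _ _).
  rewrite /= subr0 => h1; rewrite -(fineK fi) lee_fin; apply: le_trans h1; exact: ler_norm.
(* Piecewise linear cutoff, 1 on [b, c] and 0 outside [b - 1, c + 1]. *)
pose chi t : R := clip01 (t - (b - 1)) * clip01 (c + 1 - t).
have chi01 t : 0 <= chi t <= 1.
  have /andP[p1 p2] := clip01_bound (t - (b - 1)).
  have /andP[q1 q2] := clip01_bound (c + 1 - t).
  by rewrite mulr_ge0//= mulr_ile1.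
have chic : continuous chi.
  move=> t; apply: cvgM.
    apply: (cvg_comp (fun t => t - (b - 1)) clip01); last exact: clip01_continuous.
    by apply: cvgB; [exact: cvg_id|exact: cvg_cst].
  apply: (cvg_comp (fun t => c + 1 - t) clip01); last exact: clip01_continuous.
  by apply: cvgB; [exact: cvg_cst|exact: cvg_id].
have clip0 x : x <= 0 -> clip01 x = 0.
  by move=> x0; rewrite /clip01 (max_idPl _)// ge_min x0 orbT.
have clip1 x : 1 <= x -> clip01 x = 1.
  by move=> x0; rewrite /clip01 (min_idPl _)// (max_idPr _).
pose G t : R := chi t * clip01 (g n t).
have cG : continuous G.
  move=> t; apply: cvgM; first exact: chic.
  by apply: (cvg_comp (g n) clip01); [exact: cg|exact: clip01_continuous].
have G0 t : t < b - 1 \/ c + 1 < t -> G t = 0.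
  case=> tt; rewrite /G /chi; first by rewrite clip0 ?mul0r//; lra.
  by rewrite [X in _ * X * _]clip0 ?mulr0 ?mul0r//; lra.
have G01 t : 0 <= G t <= 1.
  have /andP[p1 p2] := chi01 t; have /andP[q1 q2] := clip01_bound (g n t).
  by rewrite mulr_ge0//= mulr_ile1.
(* Both functions take values in [0, 1], so the square of the difference is at most the difference:
   L^1-closeness becomes L^2-closeness. *)
have AG t : `|\1_A t - G t| ^+ 2 <= \1_K t * `|\1_A t - g n t|.
  have /andP[g1 g2] := G01 t.
  apply: (@le_trans _ _ `|\1_A t - G t|).
    rewrite expr2 ler_piMr// ler_norml.
    by have := indic_ge0 A t; have := indic_le1 A t; move: (\1_A t : R) => i *; apply/andP; split; lra.
  have [tK|tK] := pselect (K t); last first.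
    have tt : t < b - 1 \/ c + 1 < t.
      move: tK; rewrite /K /= in_itv /= => /negP; rewrite negb_and -!ltNge.
      by case/orP => ?; [left|right].
    rewrite G0// subr0 indicE memNset ?normr0 ?mulr_ge0 ?indic_ge0//.
    move=> /Abc /=; rewrite in_itv /= => /andP[h1 h2]; case: tt => tt.
      by have := le_lt_trans h1 tt; rewrite ltNge lerBlDr lerDl ler01.
    by have := lt_le_trans tt h2; rewrite ltNge lerDl ler01.
  rewrite [X in _ <= X * _]indicE mem_set// mul1r.
  apply: le_trans (clip01_close (t \in A) (g n t)); rewrite !indicE.
  have [tA|tA] := boolP (t \in A).
    move: (tA) => /set_mem/Abc /=; rewrite in_itv /= => /andP[t1 t2].
    have c1 : chi t = 1 by rewrite /chi !clip1 ?mul1r//; lra.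
    by rewrite /G c1 mul1r.
  rewrite !sub0r !normrN /G; have /andP[p1 p2] := chi01 t.
  have /andP[q1 q2] := clip01_bound (g n t).
  by rewrite normrM (ger0_norm p1) ler_piMl.
exists (fun t => G t *: y); split.
- apply: (continuous_isL2 (b := b - 1) (c := c + 1)).
    by move=> t; apply: cvgZr_tmp; exact: cG.
  by move=> t /G0 ->; rewrite scale0r.
- apply: (approx_id_continuous (b := b - 1) (c := c + 1)).
    by move=> t; apply: cvgZr_tmp; exact: cG.
  by move=> t /G0 ->; rewrite scale0r.
have mg : measurable_fun (setT : set (measurableTypeR R)) (fun t => `|\1_A t - g n t|).
  apply: measurableT_comp => //; apply: measurable_funB => //.
  by apply: continuous_measurable_fun; exact: cg.
have rg : rint mu (fun t => \1_K t * `|\1_A t - g n t|).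
  apply/rint_indicP => //; apply: le_lt_trans hn _; exact: ltry.
have hle : \int[mu]_t (\1_K t * `|\1_A t - g n t|) <= e / (1 + `|y| ^+ 2).
  by rewrite -lee_fin EFin_Rint// -integral_indic_mul.
apply: (@le_trans _ _ (\int[mu]_t (`|y| ^+ 2 * (\1_K t * `|\1_A t - g n t|)))).
  apply: le_Rintegral => //; last 2 first.
  - exact: rintZ.
  - move=> t _; rewrite -scalerBl normrZ exprMn mulrC ler_wpM2l ?sqr_ge0//.
  apply: (isL2B lh _).2; apply: (continuous_isL2 (b := b - 1) (c := c + 1)).
    by move=> t; apply: cvgZr_tmp; exact: cG.
  by move=> t /G0 ->; rewrite scale0r.
rewrite RintegralZl//; apply: (@le_trans _ _ (`|y| ^+ 2 * (e / (1 + `|y| ^+ 2)))).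
  by rewrite ler_wpM2l ?sqr_ge0.
rewrite mulrCA ler_piMr ?(ltW e0)// ler_pdivrMr// mul1r.
by rewrite lerDr.
Qed.

Lemma approx_id_sum (I : Type) (r : seq I) (F : I -> R -> H) :
  (forall i, isL2 (F i) /\ approx_id (F i)) ->
  isL2 (fun t => \sum_(i <- r) F i t) /\ approx_id (fun t => \sum_(i <- r) F i t).
Proof.
move=> hF; elim: r => [|i r [l1 a1]].
  rewrite (_ : (fun t => _) = fun=> 0); last by apply/funext => t; rewrite big_nil.
  split.
    by apply: (continuous_isL2 (b := 0) (c := 0)) => // x; exact: cvg_cst.
  by apply: (approx_id_continuous (b := 0) (c := 0)) => // x; exact: cvg_cst.
rewrite (_ : (fun t => _) = fun t => F i t + \sum_(j <- r) F j t); last first.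
  by apply/funext => t; rewrite big_cons.
split; first exact: isL2D (hF i).1 l1.
exact: (approx_idD hip (hF i).1 l1 (hF i).2 a1).
Qed.

(** The bound [|s n| <= 2 |h|] makes the simple approximations inherit the support of [h], so they
    are finite sums over indicators of bounded sets; dominated convergence brings them to [h] in
    L^2. *)
Lemma approx_id_compact h (b c : R) : isL2 h -> (forall t, t < b \/ c < t -> h t = 0) ->
  approx_id h.
Proof.
move=> lh h0; apply: (approx_id_closed hip) => // e e0.
have [s [hs s2 sf]] := sm_dominated lh.1.
have s0 n t : t < b \/ c < t -> s n t = 0.
  by move=> /h0 ht; apply/eqP; rewrite -normr_le0; have := s2 n t; rewrite ht normr0 mulr0.
have ss n : isL2 (s n) /\ approx_id (s n).
  set r : seq H := finmap.enum_fset (fset_set (range (s n))).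
  pose F y t : H := \1_((s n @^-1` [set y]) `&` `[b, c]) t *: y.
  have hF y : isL2 (F y) /\ approx_id (F y).
    apply: (@approx_id_indic _ b c) => //.
    by apply: measurableI; [exact: (hs n).2|exact: measurable_itv].
  rewrite (_ : s n = fun t => \sum_(y <- r) F y t); first exact: approx_id_sum.
  apply/funext => t.
  have [tI|tI] := pselect (`[b, c]%classic t); last first.
    rewrite s0; last first.
      move: tI; rewrite /= in_itv /= => /negP; rewrite negb_and -!ltNge.
      by case/orP => ?; [left|right].
    by rewrite big1// => y _; rewrite /F indicE memNset ?scale0r// => -[].
  have fs := (hs n).1.
  have mr : s n t \in r by rewrite in_fset_set// inE; exists t.
  rewrite (bigD1_seq (s n t))//= ?finmap.fset_uniq// {1}/F indicE mem_set// scale1r.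
  rewrite big1 ?addr0// => y yst; rewrite /F indicE memNset ?scale0r//.
  by move=> [/= /esym/eqP]; rewrite (negPf yst).
have [_ _ d0] : [/\ rint mu (fun t => 0), (forall n, rint mu (fun t => `|h t - s n t| ^+ 2)) &
   \int[mu]_t `|h t - s n t| ^+ 2 @[n --> \oo] --> \int[mu]_t (0 : R)].
  apply: (@rdct _ _ _ mu _ _ (fun t => 10 * `|h t| ^+ 2)).
  - by move=> n; exact: rint_measurable (isL2B lh (ss n).1).2.
  - move=> t; have c0 : `|h t - s n t| @[n --> \oo] --> (0 : R).
      rewrite -(normr0 H) -(subrr (h t)); apply: cvg_norm.
      by apply: cvgB; [exact: cvg_cst|exact: sf].
    rewrite -(mulr0 (0 : R)); under eq_fun do rewrite expr2.
    exact: cvgM.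
  - by apply: rintZ; exact: lh.2.
  - move=> n t; rewrite ger0_norm ?sqr_ge0//.
    have := normr2D (h t) (- s n t); rewrite normrN.
    have : `|s n t| ^+ 2 <= 4 * `|h t| ^+ 2.
      have -> : 4 * `|h t| ^+ 2 = (2 * `|h t|) ^+ 2 by ring.
      by rewrite lerXn2r ?nnegrE ?mulr_ge0.
    move: (`|s n t| ^+ 2) (`|h t| ^+ 2) => *; lra.
rewrite Rintegral_cst// mul0r in d0.
have /cvgrPdistC_le/(_ _ e0)[N _ hN] := d0.
exists (s N); split; [exact: (ss N).1|exact: (ss N).2|].
have := hN N (leqnn N); rewrite /= subr0; apply: le_trans; exact: ler_norm.
Qed.

End L2_approximation.

(** * The memory operator *)

Section memory_theory.
Context {R : realType} {H : completeNormedModType R}.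
Local Notation mu := (@lebesgue_measure R).
Variable ip : {dot H for idfun}.
Hypothesis hip : norm_of_dot ip.
Variable Q : R -> {linear H -> H}.
Hypothesis hQ : memory_kernel ip Q.

Let Qcont t : continuous (Q t). Proof. by have [/(_ t)[]] := hQ. Qed.
Let Qsym t : symmetric_op ip (Q t). Proof. by have [/(_ t)[]] := hQ. Qed.
Let Qneg t x : t < 0 -> Q t x = 0. Proof. by have [_ /(_ t) h _ _] := hQ => /h ->. Qed.
Let q t := opnorm (Q t).
Let qi : rint mu q. Proof. by have [_ _ _] := hQ. Qed.
Let q0 t : 0 <= q t. Proof. exact: opnorm_ge0. Qed.
Let Qq t x : `|Q t x| <= q t * `|x|. Proof. exact: opnorm_le. Qed.

(* Q is continuous on [0, oo[ only; precomposing with max(., 0) removes the jump. *)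
Lemma memory_kernel_cvg S (FS : set_system S) (FF : Filter FS) (s : S -> R) (y : S -> H) s0 y0 :
  s p @[p --> FS] --> s0 -> y p @[p --> FS] --> y0 ->
  Q (Num.max (s p) 0) (y p) @[p --> FS] --> Q (Num.max s0 0) y0.
Proof.
move=> cs cy; set t0 := Num.max s0 0.
have t00 : 0 <= t0 by rewrite le_max lexx orbT.
have [_ _ /(_ t0 t00) cQ _] := hQ.
have cm : Num.max (s p) 0 @[p --> FS] --> t0.
  apply: (cvg_comp s (fun x => Num.max x 0) cs).
  by apply: (@continuous_max R R id (fun=> 0) s0); [exact: cvg_id|exact: cvg_cst].
have co : opnorm (Q (Num.max (s p) 0) \- Q t0) @[p --> FS] --> (0 : R).
  apply: cvg_comp cQ => U hU.
  have hF : FS [set p | `[0, +oo[%classic (Num.max (s p) 0) -> U (Num.max (s p) 0)].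
    exact: cm _ hU.
  suff : FS [set p | U (Num.max (s p) 0)] by [].
  apply: filterS hF => p /=; apply.
  have p0 : 0 <= Num.max (s p) 0 by rewrite le_max lexx orbT.
  by rewrite in_itv /= p0.
have ny : `|y p - y0| @[p --> FS] --> (0 : R).
  by rewrite -(normr0 H) -(subrr y0); apply: cvg_norm; apply: cvgB => //; exact: cvg_cst.
have h : opnorm (Q (Num.max (s p) 0) \- Q t0) * `|y p| + q t0 * `|y p - y0| @[p --> FS] --> (0 : R).
  have := cvgD (cvgM co (cvg_norm cy)) (cvgM (cvg_cst (q t0)) ny).
  by rewrite mul0r mulr0 addr0; apply.
apply/cvgrPdistC_le => e e0.
move/cvgrPdistC_le : h => /(_ _ e0); apply: filterS => p.
rewrite subr0 => hp; apply: le_trans (le_trans (ler_norm _) hp).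
have -> : Q (Num.max (s p) 0) (y p) - Q t0 y0 =
  (Q (Num.max (s p) 0) \- Q t0) (y p) + Q t0 (y p - y0).
  by rewrite /= linearB addrA subrK.
apply: le_trans (ler_normD _ _) _; apply: lerD => //.
apply: (@opnorm_le _ _ _ (Q (Num.max (s p) 0) \- Q t0 : {linear H -> H})).
by move=> x; apply: cvgB; exact: Qcont.
Qed.

Lemma sm_memory_kernel d (T : measurableType d) (s : T -> R) (y : T -> H) :
  measurable_fun setT s -> strongly_measurable y ->
  strongly_measurable (fun p => Q (s p) (y p)).
Proof.
move=> ms my.
have m1 : strongly_measurable (fun p => Q (Num.max (s p) 0) (y p)).
  apply: (@sm_comp2 _ T R R H H (fun a b => Q (Num.max a 0) b) s y) => //.
    by move=> *; exact: memory_kernel_cvg.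
  exact: measurable_sm.
have mD : measurable [set p | 0 <= s p].
  rewrite (_ : [set p | _] = s @^-1` `[0, +oo[); last first.
    by apply/seteqP; split => p /=; rewrite in_itv /= andbT.
  by rewrite -[X in measurable X]setTI; apply: ms => //; exact: measurable_itv.
rewrite (_ : (fun p => _) = fun p => if p \in [set p | 0 <= s p] then
   Q (Num.max (s p) 0) (y p) else 0); first by apply: sm_if => //; exact: sm_cst.
apply/funext => p; case: ifPn => [/set_mem/= sp|]; first by rewrite (max_idPl _).
by rewrite notin_setE /= => /negP; rewrite -ltNge => /Qneg.
Qed.

Lemma bochner_reflect (F : R -> H) c : bint mu F ->
  bint mu (fun s => F (c - s)) /\ bochner mu (fun s => F (c - s)) = bochner mu F.
Proof.
move=> hF.
have b : bint mu (fun s => F (c - s)).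
  split; last exact: (rint_reflect c hF.2).
  exact: (@sm_comp_measurable _ _ _ _ _ _ _ _ (measurable_reflect c) hF.1).
split; first exact: b.
apply: (bochner_eq hip); first exact: b.
move=> x; rewrite (ip_bochner hip x hF).
by rewrite -(Rint_reflect c (bint_ip hip x hF)).
Qed.

(** Such functions are bounded on each ]-oo, t], so with an integrable kernel the memory integral
    converges absolutely at every time. *)
Definition causal_continuous (g : R -> H) :=
  continuous g /\ exists T, forall s, s < T -> g s = 0.

Lemma causal_bounded g t : causal_continuous g ->
  exists2 S, 0 <= S & forall s, s <= t -> `|g s| <= S.
Proof.
move=> [cg [T gT]]; have [Tt|tT] := leP T t; last first.
  by exists 0 => // s st; rewrite gT ?normr0//; exact: le_lt_trans tT.
have cn : continuous (fun x => `|g x|) by move=> x; apply: cvg_norm; exact: cg.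
have [c _ hc] := EVT_max Tt (continuous_subspaceT cn).
exists `|g c| => // s st; have [sT|Ts] := ltP s T; first by rewrite gT// normr0.
by apply: hc; rewrite in_itv /= Ts.
Qed.

Lemma bint_memory_refl g t : causal_continuous g -> bint mu (fun s => Q s (g (t - s))).
Proof.
move=> hg; have [S S0 hS] := causal_bounded t hg.
apply: (bint_le _ _ (rintZ S qi)).
  apply: (@sm_memory_kernel _ (measurableTypeR R) id (fun s => g (t - s))) => //.
  by apply: continuous_sm; apply: kernel_refl_continuous; exact: hg.1.
move=> s; have [s0|s0] := ltP s 0; first by rewrite Qneg// normr0 mulr_ge0.
apply: le_trans (Qq _ _) _; rewrite mulrC ler_wpM2r//; apply: hS.
by rewrite gerBl.
Qed.

(** With the time lag as variable the kernel no longer depends on [t], and only nonnegative lags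
    contribute, where [g (t - s)] is bounded. *)
Lemma memoryE g t : causal_continuous g ->
  bint mu (fun s => Q (t - s) (g s)) /\ memory Q g t = bochner mu (fun s => Q s (g (t - s))).
Proof.
move=> hg; have := bochner_reflect t (bint_memory_refl t hg).
rewrite /memory; have -> : (fun s => Q (t - s) (g (t - (t - s)))) = (fun s => Q (t - s) (g s)).
  by apply/funext => s; congr (Q _ (g _)); ring.
by [].
Qed.

Lemma norm_L1_ge0 : 0 <= norm_L1 Q.
Proof. by apply: Rintegral_ge0 => t _; exact: q0. Qed.

(** The bound [S] is required on the past only, because [Q] vanishes at negative lags; the energy
    estimate relies on exactly this. *)
Lemma norm_memory_le g t S : causal_continuous g -> (forall s, s <= t -> `|g s| <= S) ->
  `|memory Q g t| <= norm_L1 Q * S.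
Proof.
move=> hg hS; rewrite (memoryE t hg).2.
apply: le_trans (norm_bochner_le hip (bint_memory_refl t hg)) _.
rewrite /norm_L1 mulrC -RintegralZl//.
apply: le_Rintegral => //; [exact: (bint_memory_refl t hg).2|exact: rintZ|].
move=> s _; have [s0|s0] := ltP s 0.
  rewrite Qneg// normr0 mulr_ge0 ?q0//; apply: le_trans (hS t _) => //; exact: normr_ge0.
apply: le_trans (Qq _ _) _; rewrite mulrC ler_wpM2r//; apply: hS.
by rewrite gerBl.
Qed.

Lemma causal_continuousB g h : causal_continuous g -> causal_continuous h ->
  causal_continuous (fun s => g s - h s).
Proof.
move=> [cg [T gT]] [ch [T' hT']]; split; first by move=> s; apply: cvgB; [exact: cg|exact: ch].
exists (Num.min T T') => s; rewrite lt_min => /andP[/gT -> /hT' ->].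
by rewrite subrr.
Qed.

Lemma causal_continuousZ (c : R) g : causal_continuous g -> causal_continuous (fun s => c *: g s).
Proof.
move=> [cg [T gT]]; split; first by move=> s; apply: cvgZl_tmp; exact: cg.
by exists T => s /gT ->; rewrite scaler0.
Qed.

Lemma causal_continuous_shift h g : causal_continuous g -> causal_continuous (fun s => g (h + s)).
Proof.
move=> [cg [T gT]]; split.
  move=> s; apply: (cvg_comp (fun s => h + s) g); last exact: cg.
  by apply: cvgD; [exact: cvg_cst|exact: cvg_id].
by exists (T - h) => s sT; apply: gT; rewrite addrC -ltrBrDr.
Qed.

Lemma memoryB g h t : causal_continuous g -> causal_continuous h ->
  memory Q (fun s => g s - h s) t = memory Q g t - memory Q h t.
Proof.
move=> hg hh; rewrite /memory -(bochnerB hip (memoryE t hg).1 (memoryE t hh).1).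
by congr bochner; apply/funext => s; rewrite linearB.
Qed.

Lemma memoryZ (c : R) g t : causal_continuous g ->
  memory Q (fun s => c *: g s) t = c *: memory Q g t.
Proof.
move=> hg; rewrite /memory -(bochnerZ hip c (memoryE t hg).1).
by congr bochner; apply/funext => s; rewrite linearZ.
Qed.

(** Translation invariance: increments in time of the memory are memories of increments of [g], so
    regularity passes from [g] to its memory without differentiating [Q]. *)
Lemma memory_shift h g t : causal_continuous g ->
  memory Q (fun s => g (h + s)) t = memory Q g (h + t).
Proof.
move=> hg; rewrite (memoryE _ (causal_continuous_shift h hg)).2 (memoryE _ hg).2.
by congr bochner; apply/funext => s; rewrite addrA.
Qed.

(** Uniform continuity on a half-line: left of [T - 1] both values vanish, since the radius is at
    most 1. *)
Lemma causal_heine g t (e : R) : causal_continuous g -> 0 < e ->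
  exists2 dl, 0 < dl & forall s r, s <= t -> `|r - s| < dl -> `|g r - g s| <= e.
Proof.
move=> [cg [T gT]] e0; have [dl dl0 hdl] := heine (T - 1) t cg e0.
exists (Num.min dl 1); first by rewrite lt_min dl0 ltr01.
move=> s r st; rewrite lt_min => /andP[h1 h2].
have [sT|Ts] := ltP s (T - 1); last by apply: hdl => //; rewrite Ts.
rewrite !gT ?subrr ?normr0 ?ltW//; first by move: sT; lra.
by have := le_lt_trans (ler_norm _) h2; move: sT; lra.
Qed.

Lemma memory_continuous g : causal_continuous g -> continuous (memory Q g).
Proof.
move=> hg t; apply/cts_ed => e e0.
have n1 : 0 < 1 + norm_L1 Q by rewrite ltr_wpDr ?norm_L1_ge0.
have e1 : 0 < e / (1 + norm_L1 Q) by rewrite divr_gt0.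
have [dl dl0 hdl] := causal_heine t hg e1.
exists dl => // s st.
have -> : memory Q g s - memory Q g t = memory Q (fun r => g ((s - t) + r) - g r) t.
  rewrite memoryB ?memory_shift ?subrK//; exact: causal_continuous_shift.
have hc := causal_continuousB (causal_continuous_shift (s - t) hg) hg.
have b := @norm_memory_le _ t (e / (1 + norm_L1 Q)) hc.
apply: le_trans (b _) _.
  by move=> r rt; apply: hdl => //; rewrite addrK.
rewrite mulrCA ler_piMr ?(ltW e0)// ler_pdivrMr// mul1r.
by rewrite lerDr.
Qed.

(** The remainder of the memory is the memory of the remainder of [g], and the mean value inequality
    makes the latter small uniformly over the past of [t]. *)
Lemma memory_isD g g' t : causal_continuous g -> causal_continuous g' ->
  (forall s, isD g s (g' s)) -> isD (memory Q g) t (memory Q g' t).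
Proof.
move=> hg hg' gd; apply/isD_ed => e e0.
have n1 : 0 < 1 + norm_L1 Q by rewrite ltr_wpDr ?norm_L1_ge0.
have e1 : 0 < e / (1 + norm_L1 Q) by rewrite divr_gt0.
have [dl dl0 hdl] := causal_heine t hg' e1.
exists dl => // h hd.
have h1 := causal_continuousB (causal_continuous_shift h hg) hg.
have h2 := causal_continuousZ h hg'.
have -> : memory Q g (h + t) - memory Q g t - h *: memory Q g' t =
  memory Q (fun r => g (h + r) - g r - h *: g' r) t.
  rewrite memoryB// memoryB ?memoryZ ?memory_shift//; exact: causal_continuous_shift.
have b := @norm_memory_le _ t (e / (1 + norm_L1 Q) * `|h|) (causal_continuousB h1 h2).
apply: le_trans (b _) _.
  move=> r rt; apply: (mean_value_norm_le hip gd) => s sr.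
  by apply: hdl => //; exact: le_lt_trans sr hd.
rewrite mulrA ler_wpM2r// mulrCA ler_piMr ?(ltW e0)// ler_pdivrMr// mul1r.
by rewrite lerDr.
Qed.

Lemma memory_vanish g T t : causal_continuous g -> (forall s, s < T -> g s = 0) -> t < T ->
  memory Q g t = 0.
Proof.
move=> hg gT tT; apply/eqP; rewrite -normr_le0 -(mulr0 (norm_L1 Q)).
by apply: norm_memory_le => // s st; rewrite gT ?normr0//; exact: le_lt_trans tT.
Qed.

End memory_theory.

(** * Translation and Fubini for real integrals *)

Section real_fubini.
Context {R : realType}.
Local Notation mu := (@lebesgue_measure R).

Lemma Rint_shift (c : R) (g : R -> R) : rint mu g ->
  rint mu (fun x => g (x - c)) /\ \int[mu]_x g (x - c) = \int[mu]_x g x.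
Proof.
move=> gi; have i0 := rint_reflect 0 gi; have i1 := rint_reflect c i0.
have E : (fun x => g (0 - (c - x))) = (fun x => g (x - c)).
  by apply/funext => x; congr g; ring.
rewrite E in i1; split=> //.
have := Rint_reflect c i0; rewrite (Rint_reflect 0 gi) => <-.
by rewrite -E.
Qed.

Lemma Rfubini (f : R -> R -> R) (A : R -> R) :
  measurable_fun (setT : set (measurableTypeR R * measurableTypeR R)) (fun p => f p.1 p.2) ->
  (forall x, rint mu (f x)) -> (forall y, rint mu (fun x => f x y)) ->
  (forall x, \int[mu]_y `|f x y| <= A x) -> rint mu A ->
  rint mu (fun x => \int[mu]_y f x y) /\
  \int[mu]_x \int[mu]_y f x y = \int[mu]_y \int[mu]_x f x y.
Proof.
move=> mf f1 f2 fA Ai.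
pose F (p : R * R) : \bar R := (f p.1 p.2)%:E.
have mF : measurable_fun (setT : set (measurableTypeR R * measurableTypeR R)) F.
  exact/measurable_EFinP.
have h : (\int[mu]_x \int[mu]_y `|F (x, y)| < +oo)%E.
  have Ai' := (rintP mu (rint_measurable Ai)).1 Ai.
  apply: le_lt_trans Ai'; apply: ge0_le_integral => //.
  - by move=> x _; apply: integral_ge0.
  - apply: (@measurable_fun_fubini_tonelli_F _ _ _ _ R mu (abse \o F)).
      exact: measurableT_comp.
    by move=> p; exact: abse_ge0.
  - by apply/measurable_EFinP; apply: measurableT_comp => //; exact: rint_measurable Ai.
  - move=> x _; rewrite /F /=.
    rewrite -(EFin_Rint (rint_norm (f1 x))) lee_fin; apply: le_trans (fA x) _; exact: ler_norm.
have iF := (@integrable12ltyP _ _ _ _ R mu mu F mF).2 h.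
have E1 x : (\int[mu]_y F (x, y) = (\int[mu]_y f x y)%:E)%E by rewrite EFin_Rint.
have E2 y : (\int[mu]_x F (x, y) = (\int[mu]_x f x y)%:E)%E.
  by rewrite (EFin_Rint (f2 y)).
split.
  have := integrable_fubini_F iF; congr (mu.-integrable _ _).
  by apply/funext => x; rewrite /fubini_F E1.
rewrite /Rintegral; congr fine.
transitivity (\int[mu]_x fubini_F mu F x)%E.
  by apply: eq_integral => x _; rewrite /fubini_F E1.
rewrite (Fubini iF); apply: eq_integral => y _.
by rewrite /fubini_G E2.
Qed.

End real_fubini.

(** * Duality between the memory operator and its formal adjoint *)

Section memory_duality.
Context {R : realType} {H : completeNormedModType R}.
Local Notation mu := (@lebesgue_measure R).
Variable ip : {dot H for idfun}.
Hypothesis hip : norm_of_dot ip.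
Variable Q : R -> {linear H -> H}.
Hypothesis hQ : memory_kernel ip Q.

Let Qcont t : continuous (Q t). Proof. by have [/(_ t)[]] := hQ. Qed.
Let Qsym t : symmetric_op ip (Q t). Proof. by have [/(_ t)[]] := hQ. Qed.
Let Qneg t x : t < 0 -> Q t x = 0. Proof. by have [_ /(_ t) h _ _] := hQ => /h ->. Qed.
Let q t := opnorm (Q t).
Let qi : rint mu q. Proof. by have [_ _ _] := hQ. Qed.
Let q0 t : 0 <= q t. Proof. exact: opnorm_ge0. Qed.
Let Qq t x : `|Q t x| <= q t * `|x|. Proof. exact: opnorm_le. Qed.

Lemma causal_reflect (phi : R -> H) b : continuous phi -> (forall s, b < s -> phi s = 0) ->
  causal_continuous (fun s => phi (- s)).
Proof.
move=> cphi phib; split.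
  move=> s; apply: (cvg_comp (fun s => - s) phi); last exact: cphi.
  by apply: cvgN; exact: cvg_id.
by exists (- b) => s sb; apply: phib; rewrite ltrNr.
Qed.

(** Time reversal turns the formal adjoint into the memory operator itself, so continuity and
    vanishing carry over. *)
Lemma memory_adjE phi b t : continuous phi -> (forall s, b < s -> phi s = 0) ->
  bint mu (fun s => Q (s - t) (phi s)) /\
  memory_adj Q phi t = memory Q (fun s => phi (- s)) (- t).
Proof.
move=> cphi phib; have hc := causal_reflect cphi phib.
have b0 := (memoryE hip hQ (- t) hc).1.
have [b1 E] := bochner_reflect hip 0 b0.
have e : (fun s => Q (- t - (0 - s)) (phi (- (0 - s)))) = (fun s => Q (s - t) (phi s)).
  by apply/funext => s; congr (Q _ (phi _)); ring.
by rewrite e in b1 E; split.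
Qed.

Lemma memory_adj_continuous phi b : continuous phi -> (forall s, b < s -> phi s = 0) ->
  continuous (memory_adj Q phi).
Proof.
move=> cphi phib.
rewrite (_ : memory_adj Q phi = fun t => memory Q (fun s => phi (- s)) (- t)).
  move=> t; apply: (cvg_comp (fun s => - s) (memory Q (fun s => phi (- s)))).
    by apply: cvgN; exact: cvg_id.
  by apply: (memory_continuous hip hQ); exact: causal_reflect phib.
by apply/funext => t; exact: (memory_adjE _ cphi phib).2.
Qed.

Lemma memory_adj_vanish phi b t : continuous phi -> (forall s, b < s -> phi s = 0) ->
  b < t -> memory_adj Q phi t = 0.
Proof.
move=> cphi phib bt; rewrite (memory_adjE _ cphi phib).2.
apply: (memory_vanish hip hQ (T := - b)); first exact: causal_reflect phib.
  by move=> s sb; apply: phib; rewrite ltrNr.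
by rewrite ltrN2.
Qed.

(** The two one-sided supports meet in [a, b], where [u] is integrable and [G] bounded. *)
Lemma rint_ip_causal (u G : R -> H) (a b : R) : L1loc u ->
  {ae mu, forall t, t < a -> u t = 0} -> continuous G -> (forall t, b < t -> G t = 0) ->
  rint mu (fun t => ip (u t) (G t)).
Proof.
move=> [mu_ ui] ua cG Gb.
have mG : strongly_measurable (G : measurableTypeR R -> H) by exact: continuous_sm.
have m := sm_ip hip mu_ mG.
have [M M0 hM] : exists2 M, 0 <= M & forall t, a <= t <= b -> `|G t| <= M.
  have [ab|ab] := leP a b; last by exists 0 => // t /andP[h1 h2]; lra.
  have cn : continuous (fun x => `|G x|) by move=> x; apply: cvg_norm; exact: cG.
  have [c _ hc] := EVT_max ab (continuous_subspaceT cn).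
  by exists `|G c| => // t tab; apply: hc; rewrite in_itv.
have gi := rintZ M (ui a b).
apply/(rintP _ m); apply: le_lt_trans ((rintP _ (rint_measurable gi)).1 gi).
apply: ae_ge0_le_integral => //.
- by apply/measurable_EFinP; exact: measurableT_comp.
- apply/measurable_EFinP; apply: measurableT_comp => //; exact: rint_measurable gi.
move: ua; apply: aeS => t hua _; rewrite lee_fin [leRHS]ger0_norm ?mulr_ge0 ?indic_ge0//.
have [ta|at_] := ltP t a.
  by rewrite hua// ip0l normr0 mulr_ge0 ?mulr_ge0 ?indic_ge0.
have [bt|tb] := ltP b t.
  by rewrite Gb// ip0r normr0 mulr_ge0 ?mulr_ge0 ?indic_ge0.
rewrite indicE mem_set ?mul1r; last by rewrite /= in_itv /= at_.
apply: le_trans (ip_CS hip _ _) _; rewrite mulrC ler_wpM2r// hM//.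
by rewrite at_.
Qed.

Lemma measurable_diffC : measurable_fun (setT : set (measurableTypeR R * measurableTypeR R))
  ((fun p => p.2 - p.1) : measurableTypeR R * measurableTypeR R -> R).
Proof.
exact: (@measurable_funB _ (measurableTypeR R * measurableTypeR R)%type R setT
  (fun p => p.2 : R) (fun p => p.1 : R) measurable_snd measurable_fst).
Qed.

(** Fubini and the symmetry of [Q (s - t)]. The integrand can be nonzero only for
    [T <= t <= s <= b], which provides the integrable majorant [A]. *)
Lemma memory_duality (g phi : R -> H) (a b : R) : causal_continuous g ->
  continuous phi -> (forall s, s < a \/ b < s -> phi s = 0) ->
  \int[mu]_t ip (g t) (memory_adj Q phi t) = \int[mu]_s ip (memory Q g s) (phi s).
Proof.
move=> hg cphi phi0; have phib s : b < s -> phi s = 0 by move=> ?; apply: phi0; right.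
have [M M0 hM] := bounded_support cphi phi0.
have [cg [T gT]] := hg.
pose f t s := ip (Q (s - t) (phi s)) (g t).
have b1 t := (memory_adjE t cphi phib).1.
have b2 s := (memoryE hip hQ s hg).1.
have f1 t : rint mu (f t) by exact: (bint_ip hip (g t) (b1 t)).
have fE t s : f t s = ip (Q (s - t) (g t)) (phi s) by rewrite /f Qsym ipC.
have f2 s : rint mu (f ^~ s).
  by have := bint_ip hip (phi s) (b2 s); congr (rint mu _); apply/funext => t; rewrite fE.
have E1 t : ip (g t) (memory_adj Q phi t) = \int[mu]_s f t s.
  by rewrite ipC /memory_adj (ip_bochner hip).
have E2 s : ip (memory Q g s) (phi s) = \int[mu]_t f t s.
  rewrite /memory (ip_bochner hip)//; apply: eq_Rintegral => t _; by rewrite fE.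
under eq_Rintegral do rewrite E1.
under [RHS]eq_Rintegral do rewrite E2.
pose A t := M * norm_L1 Q * (\1_(`[T, b]) t * `|g t|).
apply: (Rfubini (A := A) _ f1 f2 _ _).2; last first.
- by apply: rintZ; exact: (continuous_L1loc cg).2.
- move=> t.
  have qs := Rint_shift t qi.
  have -> : A t = \int[mu]_s (M * (\1_(`[T, b]) t * `|g t|) * q (s - t)).
    by rewrite RintegralZl//; [rewrite qs.2 /A /norm_L1; ring|exact: qs.1].
  apply: le_trans (ler_norm _) _; apply: le_norm_Rint.
  - exact: rint_norm (f1 t).
  - exact: rintZ _ qs.1.
  move=> s; rewrite normr_id indicE.
  have r0 : 0 <= M * ((t \in `[T, b]%classic)%:R * `|g t|) * q (s - t).
    by rewrite !mulr_ge0.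
  have [tT|Tt] := ltP t T; first by have -> : f t s = 0 by [rewrite /f gT// ip0r]; rewrite normr0.
  have [bt|tb] := ltP b t.
    rewrite /f; have [st|ts] := ltP s t; first by rewrite Qneg ?subr_lt0// ip0l normr0.
    by rewrite phib ?(lt_le_trans bt)// linear0 ip0l normr0.
  rewrite mem_set ?mul1r; last by rewrite /= in_itv /= Tt.
  apply: le_trans (ip_CS hip _ _) _; rewrite [leRHS]mulrAC; apply: ler_wpM2r => //.
  apply: le_trans (Qq _ _) _; rewrite mulrC; exact: ler_wpM2r.
- have m1 := @sm_memory_kernel _ _ _ _ hQ _ (measurableTypeR R * measurableTypeR R)%type
     (fun p => p.2 - p.1) (fun p => phi p.2) measurable_diffC.
  have m2 : strongly_measurable (fun p : measurableTypeR R * measurableTypeR R => phi p.2).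
    exact: (sm_comp_measurable measurable_snd (continuous_sm cphi)).
  have m3 : strongly_measurable (fun p : measurableTypeR R * measurableTypeR R => g p.1).
    exact: (sm_comp_measurable measurable_fst (continuous_sm cg)).
  exact: (sm_ip hip (m1 m2) m3).
Qed.

(* With phi = K (tau - .) w the substitution s -> tau + t - s moves the
   mollification from the test function onto u. *)
Lemma memory_conv (u : R -> H) (T a tau : R) (K : R -> R) (w : H) : L1loc u ->
  (forall t, t < T -> u t = 0) -> kernel_on a K -> causal_continuous (conv K u) ->
  \int[mu]_t ip (u t) (memory_adj Q (fun s => K (tau - s) *: w) t) =
  ip (memory Q (conv K u) tau) w.
Proof.
move=> hu uT hK hc; have [M M0 hM] := kernel_bounded hK.
have [mu_ ui] := hu.
have cK := hK.1.
pose phi s := K (tau - s) *: w.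
have cphi : continuous phi.
  by move=> s; apply: cvgZr_tmp; exact: kernel_refl_continuous.
have phib s : tau < s -> phi s = 0.
  by move=> ts; rewrite /phi hK.2 ?scale0r//; left; rewrite subr_lt0.
pose f t s := K (s - t) * ip (Q (tau - s) w) (u t).
have qr := rint_reflect tau qi.
have fbound t s : `|f t s| <= M * (\1_(`[T, tau]) t * `|u t|) * `|w| * q (tau - s).
  have r0 : 0 <= M * (\1_(`[T, tau]) t * `|u t|) * `|w| * q (tau - s).
    by rewrite !mulr_ge0 ?indic_ge0.
  have [tT|Tt] := ltP t T; first by have -> : f t s = 0 by [rewrite /f uT// ip0r mulr0]; rewrite normr0.
  have [bt|tb] := ltP tau t.
    rewrite /f; have [st|ts] := ltP s t; first by rewrite hK.2 ?mul0r ?normr0//; left; rewrite subr_lt0.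
    by rewrite Qneg ?subr_lt0 ?(lt_le_trans bt)// ip0l mulr0 normr0.
  rewrite indicE mem_set ?mul1r; last by rewrite /= in_itv /= Tt.
  rewrite normrM -!mulrA; apply: ler_pM => //.
  apply: le_trans (ip_CS hip _ _) _; rewrite mulrC; apply: ler_wpM2l => //.
  by rewrite mulrC; exact: Qq.
have mf1 t : measurable_fun (setT : set (measurableTypeR R)) (f t).
  apply: measurable_funM.
    have /continuous_measurable_fun := cK => h; exact: (measurableT_comp h (measurable_shift t)).
  apply: (sm_ip hip); last exact: sm_cst.
  apply: (@sm_memory_kernel _ _ _ _ hQ _ (measurableTypeR R) (fun s => tau - s) (fun=> w)).
    exact: measurable_reflect.
  exact: sm_cst.
have f1 t : rint mu (f t) by apply: rint_le (mf1 t) (fbound t) (rintZ _ qr).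
have hr s : kernel_on a K := hK.
have f2 s : rint mu (f ^~ s).
  have := rint_conv hip s (Q (tau - s) w) hK hu.
  by congr (rint mu _); apply/funext => t; rewrite /f (ipC _ (u t)).
have E1 t : ip (u t) (memory_adj Q phi t) = \int[mu]_s f t s.
  have b1 := (memory_adjE t cphi phib).1.
  rewrite ipC /memory_adj (ip_bochner hip)//.
  rewrite -(Rint_reflect (tau + t) (bint_ip hip (u t) b1)).
  apply: eq_Rintegral => s _; rewrite /phi /f linearZ ipZl.
  by congr (K _ * ip (Q _ w) _); ring.
have E2 : ip (memory Q (conv K u) tau) w = \int[mu]_s \int[mu]_t f t s.
  have b2 := (memoryE hip hQ tau hc).1.
  rewrite /memory (ip_bochner hip)//; apply: eq_Rintegral => s _.
  rewrite Qsym (ip_conv hip _ _ hK hu); apply: eq_Rintegral => t _.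
  by rewrite /f (ipC _ (u t)).
rewrite E2 -/phi; under eq_Rintegral do rewrite E1.
pose A t := M * (\1_(`[T, tau]) t * `|u t|) * `|w| * norm_L1 Q.
apply: (Rfubini (A := A) _ f1 f2 _ _).2; last first.
- have := rintZ (M * `|w| * norm_L1 Q) (ui T tau); congr (rint mu _).
  by apply/funext => t; rewrite /A; ring.
- move=> t.
  have -> : A t = \int[mu]_s (M * (\1_(`[T, tau]) t * `|u t|) * `|w| * q (tau - s)).
    by rewrite RintegralZl// (Rint_reflect tau qi).
  apply: le_trans (ler_norm _) _; apply: le_norm_Rint.
  - exact: rint_norm (f1 t).
  - exact: rintZ _ qr.
  by move=> s; rewrite normr_id; exact: fbound.
- have mQ := @sm_memory_kernel _ _ _ _ hQ _ (measurableTypeR R * measurableTypeR R)%type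
     (fun p => tau - p.2) (fun=> w).
  have m3 : strongly_measurable (fun p : measurableTypeR R * measurableTypeR R => u p.1).
    exact: (sm_comp_measurable measurable_fst mu_).
  apply: measurable_funM.
    have /continuous_measurable_fun h := cK; exact: (measurableT_comp h measurable_diffC).
  apply: (sm_ip hip) => //; apply: mQ; last exact: sm_cst.
  exact: (measurableT_comp (measurable_reflect tau) measurable_snd).
Qed.

End memory_duality.

(** * Localized mollification and weak derivatives *)

Section local_L2.
Context {R : realType} {H : completeNormedModType R}.
Local Notation mu := (@lebesgue_measure R).
Variable ip : {dot H for idfun}.
Hypothesis hip : norm_of_dot ip.
Implicit Types (h g f u : R -> H) (psi : R -> R).

Let itvm (i : interval R) : measurable ([set` i] : set (measurableTypeR R)).
Proof. exact: measurable_itv. Qed.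

Lemma isL2_cut h (D : set R) : measurable (D : set (measurableTypeR R)) ->
  strongly_measurable (h : measurableTypeR R -> H) ->
  rint mu (fun t => \1_D t * `|h t| ^+ 2) -> isL2 (fun t => \1_D t *: h t).
Proof.
move=> mD mh hi.
have m : strongly_measurable ((fun t => \1_D t *: h t) : measurableTypeR R -> H).
  by apply: smZ => //; apply: measurable_sm; exact/measurable_indicP.
split=> //; move: hi; congr (rint mu _); apply/funext => t.
rewrite normrZ ger0_norm ?indic_ge0// exprMn; congr (_ * _).
by rewrite indicE; case: (_ \in _); rewrite ?expr1n ?expr0n.
Qed.

Lemma rint_cut_normX2 h (D : set R) : measurable (D : set (measurableTypeR R)) -> isL2 h ->
  rint mu (fun t => \1_D t * `|h t| ^+ 2).
Proof. by move=> mD hh; apply: rint_indic => //; exact: hh.2. Qed.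

Lemma Rint_cut_le (D : set R) (g : R -> R) : measurable (D : set (measurableTypeR R)) ->
  rint mu g -> (forall t, 0 <= g t) ->
  \int[mu]_t (\1_D t * g t) <= \int[mu]_t g t.
Proof.
move=> mD gi g0; apply: le_Rintegral => //; first exact: rint_indic.
by move=> t _; rewrite ler_piMl// indic_le1.
Qed.

Lemma conv_cut a psi h (D : set R) tau : measurable (D : set (measurableTypeR R)) ->
  mollifier a psi -> L1loc h -> L1loc (fun t => \1_D t *: h t) ->
  (forall t, tau - a <= t <= tau -> D t) ->
  conv psi h tau = conv psi (fun t => \1_D t *: h t) tau.
Proof.
move=> mD hp hh hD tD; apply: (conv_ae hip (mollifier_kernel0 hp)) => //.
by apply: aeT => t /tD Dt; rewrite indicE mem_set// scale1r.
Qed.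

Lemma rint_conv_sub h a psi b c : mollifier a psi -> L2loc h ->
  rint mu (fun t => \1_(`[b, c]) t * `|conv psi h t - h t| ^+ 2).
Proof.
move=> hp hh; have hl := L2loc_L1loc hh; have cc := conv0_continuous hip hp hl.
have L := isL2_cut (itvm _) hh.1 (L2loc_rint b c hh).
have mc : strongly_measurable (conv psi h : measurableTypeR R -> H) by exact: continuous_sm.
have mm := smB mc hh.1.
have [M M0 hM] : exists2 M, 0 <= M & forall t, b <= t <= c -> `|conv psi h t| <= M.
  have [ab|ab] := leP b c; last by exists 0 => // t /andP[h1 h2]; lra.
  have cn : continuous (fun x => `|conv psi h x|) by move=> x; apply: cvg_norm; exact: cc.
  have [d _ hd] := EVT_max ab (continuous_subspaceT cn).
  by exists `|conv psi h d| => // t tab; apply: hd; rewrite in_itv.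
apply: rint_le (rintD (rintZ (2 * M ^+ 2) (rint_itv b c)) (rintZ 2 (L2loc_rint b c hh))).
  by apply: measurable_indicM => //; exact: measurable_normX2.
move=> t; rewrite ger0_norm ?mulr_ge0 ?indic_ge0 ?sqr_ge0// indicE.
have [/set_mem|_] := boolP (t \in _); last by rewrite !mul0r !mulr0 addr0.
rewrite /= in_itv /= mulr1 !mul1r => tb.
have := normr2D (conv psi h t) (- h t); rewrite normrN => /le_trans; apply.
rewrite lerD2r ler_pM2l// lerXn2r ?nnegrE//; exact: hM.
Qed.

(** At times in [b, c] a mollifier supported in [0, 1] sees [h] only on [b - 1, c]; cutting off
    there reduces the claim to bounded support. *)
Lemma conv_L2loc_cvg h b c : L2loc h -> forall e : R, 0 < e -> exists2 dl : R, 0 < dl &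
  forall a psi, 0 < a -> a <= dl -> mollifier a psi ->
    \int[mu]_t (\1_(`[b, c]) t * `|conv psi h t - h t| ^+ 2) <= e.
Proof.
move=> hh e e0; have hl := L2loc_L1loc hh.
pose D : set R := `[b - 1, c]; pose g t := \1_D t *: h t.
have lg : isL2 g by apply: isL2_cut; [exact: itvm|exact: hh.1|exact: L2loc_rint].
have g0 t : t < b - 1 \/ c < t -> g t = 0.
  move=> tt; rewrite /g indicE memNset ?scale0r// /D /= in_itv /= => /andP[h1 h2].
  by case: tt => tt; [have := le_lt_trans h1 tt|have := le_lt_trans h2 tt]; rewrite ltxx.
have [dl dl0 hdl] := approx_id_compact hip lg g0 e0.
exists (Num.min dl 1); first by rewrite lt_min dl0 ltr01.
move=> a psi a0; rewrite le_min => /andP[a1 a2] hp.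
apply: (le_trans _ (hdl a psi a0 a1 hp)).
have l2 := isL2B (conv_contraction hip hp lg).1 lg.
apply: (le_trans _ (Rint_cut_le (itvm `[b, c]%R) l2.2 (fun t => sqr_ge0 _))).
rewrite le_eqVlt; apply/orP; left; apply/eqP; apply: eq_Rintegral => t _.
rewrite !indicE; have [/set_mem|_] := boolP (t \in _); last by rewrite !mul0r.
rewrite /= in_itv /= => /andP[t1 t2].
have -> : conv psi h t = conv psi g t.
  apply: (@conv_cut a psi h D t) => //; [exact: itvm|exact: isL2_L1loc|].
  by move=> s /andP[s1 s2]; rewrite /D /= in_itv /=; apply/andP; split; lra.
suff -> : g t = h t by [].
rewrite /g indicE mem_set ?scale1r// /D /= in_itv /= t2 andbT.
by move: t1; lra.
Qed.

Lemma rint_ray h t : L2plus h -> rint mu (fun s => \1_(`]-oo, t]) s * `|h s| ^+ 2).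
Proof.
move=> [[mh hloc] hp]; apply/rint_indicP; [exact: itvm|exact: measurable_normX2| |exact: hp].
by move=> s; exact: sqr_ge0.
Qed.

(** Cutting [h] off after [t] leaves the convolution unchanged up to [t], so the global contraction
    localizes to ]-oo, t]. *)
Lemma conv_contraction_ray a psi h t : mollifier a psi -> 0 < a -> L2plus h ->
  rint mu (fun s => \1_(`]-oo, t]) s * `|conv psi h s| ^+ 2) /\
  \int[mu]_s (\1_(`]-oo, t]) s * `|conv psi h s| ^+ 2) <=
  \int[mu]_s (\1_(`]-oo, t]) s * `|h s| ^+ 2).
Proof.
move=> hp a0 hh; have hl := L2loc_L1loc hh.1.
pose D : set R := `]-oo, t]; pose g s := \1_D s *: h s.
have lg : isL2 g by apply: isL2_cut; [exact: itvm|exact: hh.1.1|exact: rint_ray].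
have [lc cle] := conv_contraction hip hp lg.
have E s : \1_D s * `|conv psi h s| ^+ 2 = \1_D s * `|conv psi g s| ^+ 2.
  rewrite !indicE; have [/set_mem|_] := boolP (s \in _); last by rewrite [LHS]mul0r [RHS]mul0r.
  rewrite /D /= in_itv /= => st; suff -> : conv psi h s = conv psi g s by [].
  apply: (@conv_cut a psi h D s) => //; [exact: itvm|exact: isL2_L1loc|].
  by move=> r /andP[_ rs]; rewrite /D /= in_itv /=; exact: le_trans st.
have Eh : (fun s => \1_D s * `|h s| ^+ 2) = (fun s => `|g s| ^+ 2).
  apply/funext => s; rewrite /g normrZ exprMn !indicE.
  by case: (_ \in _); rewrite ?normr1 ?normr0 ?expr1n ?expr0n.
rewrite (_ : (fun s => _) = fun s => \1_D s * `|conv psi g s| ^+ 2); last by apply/funext => s; exact: E.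
split; first by apply: rint_cut_normX2 => //; exact: itvm.
rewrite -/D Eh; apply: (le_trans _ cle).
by apply: Rint_cut_le; [exact: itvm|exact: lc.2|move=> s; exact: sqr_ge0].
Qed.

Lemma ae_zero_cut (g : R -> R) (D : set R) : measurable (D : set (measurableTypeR R)) ->
  rint mu (fun t => \1_D t * g t ^+ 2) -> \int[mu]_t (\1_D t * g t ^+ 2) <= 0 ->
  {ae mu, forall t, D t -> g t = 0}.
Proof.
move=> mD gi gle.
have h0 : \int[mu]_t (\1_D t * g t ^+ 2) = 0.
  apply/le_anti; rewrite gle /=; apply: Rintegral_ge0 => t _.
  by rewrite mulr_ge0 ?indic_ge0 ?sqr_ge0.
have mg : measurable_fun (setT : set (measurableTypeR R)) (EFin \o (fun t => \1_D t * g t ^+ 2)).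
  by apply/measurable_EFinP; exact: rint_measurable gi.
pose G t : R := \1_D t * g t ^+ 2.
have hz : (\int[mu]_x `|(EFin \o G) x| = 0)%E.
  rewrite -[RHS](congr1 EFin h0) (EFin_Rint gi); apply: eq_integral => x _ /=.
  by rewrite ger0_norm// mulr_ge0 ?indic_ge0 ?sqr_ge0.
have := (@ae_eq_integral_abs _ _ _ mu setT measurableT _ mg).1 hz.
apply: aeS => t /(_ I) /= [] + Dt; rewrite indicE mem_set// mul1r => /eqP.
by rewrite sqrf_eq0 => /eqP.
Qed.

(** Countably many compact intervals with rational endpoints exhaust the open set [D], so it is
    enough to treat each of them. *)
Lemma ae_zero_loc h (D : set R) : (forall b c : R,
    (forall t, b <= t <= c -> D t) ->
    rint mu (fun t => \1_(`[b, c]) t * `|h t| ^+ 2) /\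
    \int[mu]_t (\1_(`[b, c]) t * `|h t| ^+ 2) <= 0) ->
  open D -> {ae mu, forall t, D t -> h t = 0}.
Proof.
move=> hD oD.
pose P n (x : R) := if @unpickle (rat * rat)%type n is Some (p, q) then
  (forall t, ratr p <= t <= ratr q -> D t) -> ratr p <= x <= ratr q -> h x = 0
  else True.
have : {ae mu, forall x, forall n, P n x}.
  apply: ae_foralln => n; rewrite /P.
  case: unpickle => [[p q]|]; last exact: aeT.
  have [H0|H0] := pselect (forall t, ratr p <= t <= ratr q -> D t); last by apply: aeT => x /H0.
  have [r1 r2] := hD _ _ H0.
  have := ae_zero_cut (itvm _) r1 r2.
  apply: aeS => x hx _ xpq; apply/eqP; rewrite -normr_eq0; apply/eqP; apply: hx.
  by rewrite /= in_itv.
apply: aeS => x hx Dx.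
have /nbhs_ballP[e /= e0 he] : nbhs x D by exact: open_nbhs_nbhs.
have xe : x - e < x by rewrite ltrBlDr ltrDl.
have [p] := rat_in_itvoo xe; rewrite in_itv /= => /andP[p1 p2].
have ex : x < x + e by rewrite ltrDl.
have [q] := rat_in_itvoo ex; rewrite in_itv /= => /andP[q1 q2].
have := hx (pickle (p, q)); rewrite /P pickleK; apply; last by rewrite (ltW p2) (ltW q1).
move=> t /andP[pt tq]; apply: he.
rewrite -ball_normE /= ltr_norml; apply/andP; split; lra.
Qed.

Lemma causal_L2plus h T : L2loc h -> {ae mu, forall t, t < T -> h t = 0} -> L2plus h.
Proof.
move=> hh h0; split=> // b.
have mh := measurable_normX2 hh.1.
have gi := L2loc_rint T b hh.
rewrite integral_indic_mul.
apply: le_lt_trans ((rintP _ (rint_measurable gi)).1 gi).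
apply: ae_ge0_le_integral => //.
- by apply/measurable_EFinP; apply: measurable_indicM; [exact: itvm|].
- apply/measurable_EFinP; apply: measurableT_comp => //; exact: rint_measurable gi.
move: h0; apply: aeS => t h0 _; rewrite lee_fin [leRHS]ger0_norm ?mulr_ge0 ?indic_ge0 ?sqr_ge0//.
have [tT|Tt] := ltP t T.
  by rewrite h0// normr0 expr0n mulr0 mulr_ge0 ?indic_ge0.
apply: ler_wpM2r; first exact: sqr_ge0.
rewrite !indicE; have [/set_mem|_] := boolP (t \in `]-oo, b]%classic) => //.
by rewrite /= in_itv /= => tb; rewrite mem_set// /= in_itv /= Tt.
Qed.

(** The sign from the reflected kernel cancels the sign in the definition of weak derivatives. Hence
    differentiating a mollification of [f] up to the Sobolev order costs nothing: it mollifies the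
    weak derivative. *)
Lemma conv_weak_deriv a psi l f g tau : mollifier a psi -> L1loc f -> L1loc g ->
  is_weak_deriv l f g -> conv psi^`(l) f tau = conv psi g tau.
Proof.
move=> hp hf hg fg.
have [tf td] := @test_fun_mollifier R R a psi 0 tau 1 hp.
have phiE : (fun t : R => derive1n 0 psi (tau - t) *: (1 : R)) = (fun t => psi (tau - t)).
  by apply/funext => t; rewrite derive1n0 [_ *: _]mulr1.
have := fg _ tf.
rewrite (_ : (fun t => _ *: f t) = fun t => (-1) ^+ l *: (derive1n l psi (tau - t) *: f t)).
  rewrite (bochnerZ hip); last exact: bint_conv (mollifier_kernel l hp) hf.
  move=> h; have : (-1) ^+ l *: conv psi^`(l) f tau = (-1) ^+ l *: conv psi g tau.
    apply: (etrans h); congr (_ *: bochner _ _).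
    by apply/funext => t; rewrite derive1n0 [_ *: (1 : R)]mulr1.
  by move/(scalerI (negbT (signr_eq0 R l))).
by apply/funext => t; rewrite td add0n [_ *: (1 : R)]mulr1 scalerA.
Qed.

Lemma mollifier_small (dl : R) : 0 < dl -> exists a psi, [/\ 0 < a, a <= dl & mollifier a psi].
Proof. by move=> dl0; have [psi hp] := mollifier_exists dl0; exists dl, psi. Qed.

(** Before [T] the mollified [g] equals a convolution of [f] with a kernel looking backwards, hence
    0; its L^2 limit is [g]. *)
Lemma weak_deriv_vanish l f g T : L2loc f -> L2loc g -> is_weak_deriv l f g ->
  {ae mu, forall t, t < T -> f t = 0} -> {ae mu, forall t, t < T -> g t = 0}.
Proof.
move=> hf hg fg f0; apply: (@ae_zero_loc g [set t | t < T]); last exact: open_lt.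
move=> b c bc; split; first exact: L2loc_rint.
apply/ler_addgt0Pl => e e0; rewrite addr0.
have [dl dl0 hdl] := conv_L2loc_cvg b c hg e0.
have [a [psi [a0 adl hp]]] := mollifier_small dl0.
apply: (le_trans _ (hdl a psi a0 adl hp)); rewrite le_eqVlt; apply/orP; left; apply/eqP.
apply: eq_Rintegral => t _; rewrite !indicE.
have [/set_mem|_] := boolP (t \in _); last by rewrite !mul0r.
rewrite /= in_itv /= => /bc /= tT.
rewrite -(conv_weak_deriv _ hp (L2loc_L1loc hf) (L2loc_L1loc hg) fg).
rewrite (conv_vanish hip (mollifier_kernel l hp) (L2loc_L1loc hf) f0 tT).
by rewrite sub0r normrN.
Qed.

Lemma wderivP k f l : Hkloc k f -> (l <= k)%N ->
  L2loc (wderiv l f) /\ is_weak_deriv l f (wderiv l f).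
Proof.
move=> [_ h] /h[g hg fg]; rewrite /wderiv.
by case: xgetP => [g' _|/(_ g) h']; [exact|case: h'; split].
Qed.

End local_L2.

(** * The energy estimate with the source integrated over a half-line *)

Section energy_integral.
Context {R : realType} {H : completeNormedModType R}.
Local Notation mu := (@lebesgue_measure R).
Variable ip : {dot H for idfun}.
Hypothesis hip : norm_of_dot ip.

Lemma energy_integral (A : {linear H -> H}) (Cl nB nQ : R) (y y' z : R -> H) (T1 T0 T t : R) :
  continuous A -> symmetric_op ip A -> 0 < Cl -> (forall x, Cl * ip x x <= ip (A x) x) ->
  0 <= nB -> 0 <= nQ ->
  (forall s, isD y s (y' s)) -> (forall s, s < T1 -> y s = 0) ->
  continuous z -> (forall s, s < T0 -> z s = 0) ->
  (forall s S, (forall r, r <= s -> `|y r| <= S) ->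
     ip (A (y' s)) (y s) <= (`|z s| + nB * `|y s| + nQ * S) * `|y s|) ->
  t <= T ->
  `|y t| ^+ 2 <= energy_const Cl nB nQ T0 T * \int[mu]_s (\1_(`]-oo, t]) s * `|z s| ^+ 2).
Proof.
move=> cA sA Cl0 cl nB0 nQ0 yd y0 cz z0 bal tT.
(* [a] is chosen where both [y] and the source are still 0. The primitive [Z] starts at [a - 1],
   which makes [a] an interior point for the fundamental theorem of calculus. *)
pose a := Num.min (T1 - 1) (Num.min T0 t).
have at_ : a <= t by rewrite !ge_min lexx !orbT.
have aT0 : a <= T0 by rewrite !ge_min lexx orbT.
have aT1 : a <= T1 - 1 by rewrite ge_min lexx.
pose f s := `|z s| ^+ 2.
have cf : continuous f.
  rewrite (_ : f = fun s => `|z s| * `|z s|); last by apply/funext => s; rewrite /f expr2.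
  by move=> s; apply: cvgM; apply: cvg_norm; exact: cz.
have fint b c : mu.-integrable `[b, c] (EFin \o f).
  by apply: continuous_compact_integrable; [exact: segment_compact|exact: continuous_subspaceT].
pose Z s := \int[mu]_(r in `[a - 1, s]) f r.
have Zd s : a <= s -> isD Z s (`|z s| ^+ 2).
  move=> as_; apply/isDP.
  have s1 : s < s + 1 by rewrite ltrDl.
  apply: (@continuous_FTC1_closed _ f (a - 1) s (s + 1) s1 (fint _ _)); last exact: cf.
  by apply: lt_le_trans as_; rewrite ltrBlDr ltrDl.
have Zvan : forall r, a <= r <= T0 -> Z r = 0.
  move=> s /andP[as_ sT]; rewrite /Z -Rintegral_itv_bndo_bndc; last first.
    by apply: integrableS (fint (a - 1) s) => //; exact: subset_itv_co_cc.
  have -> : \int[mu]_(r in `[a - 1, s[) f r = \int[mu]_(r in `[a - 1, s[) (0 : R).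
    apply: eq_Rintegral => r; rewrite inE /= in_itv /= => /andP[_ rs].
    by rewrite /f z0 ?normr0 ?expr0n// (lt_le_trans rs).
  by rewrite Rintegral_cst// mul0r.
have ya : forall s, s <= a -> y s = 0 by move=> s sa; apply: y0; move: (le_trans sa aT1); lra.
have Za : 0 <= Z a by apply: Rintegral_ge0 => r _; exact: sqr_ge0.
have key := @energy_estimate _ _ _ hip A Cl nB nQ cA sA Cl0 cl nB0 nQ0 y y' (fun s => `|z s|) Z a t T0 T
  yd ya (fun s S _ h => bal s S h) Zd Za Zvan at_ tT.
apply: le_trans key _; apply: ler_wpM2l; first exact: energy_const_ge0.
have zc : rint mu (fun s => \1_(`]-oo, t]) s * `|z s| ^+ 2).
  have [M M0 hM] := causal_bounded t (conj cz (ex_intro _ T0 z0)).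
  apply: rint_le (rintZ (M ^+ 2) (rint_itv T0 t)).
    apply: measurable_indicM; first exact: measurable_itv.
    by apply: measurable_normX2; exact: continuous_sm.
  move=> s; rewrite ger0_norm ?mulr_ge0 ?indic_ge0 ?sqr_ge0// !indicE.
  have [/set_mem|_] := boolP (s \in `]-oo, t]%classic); last first.
    by rewrite mul0r mulr_ge0 ?sqr_ge0.
  rewrite /= in_itv /= mul1r => st.
  have [sT|Ts] := ltP s T0; first by rewrite z0// normr0 expr0n mulr_ge0 ?sqr_ge0.
  by rewrite mem_set ?mulr1 ?lerXn2r ?nnegrE ?hM//= in_itv /= Ts.
have E : Z t = \int[mu]_s (\1_(`[a - 1, t]) s * `|z s| ^+ 2).
  rewrite /Z /Rintegral; congr fine.
  by rewrite (integral_indic_mul `[a - 1, t]%classic f).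
rewrite E; apply: le_Rintegral => //.
- apply/rint_indicP => //; first by apply: measurable_normX2; exact: continuous_sm.
  by have /integrableP[_] := fint (a - 1) t; under eq_integral do rewrite /= ger0_norm ?sqr_ge0//.
- move=> s _; apply: ler_wpM2r; first exact: sqr_ge0.
  rewrite !indicE; have [/set_mem|_] := boolP (s \in `[a - 1, t]%classic) => //.
  by rewrite /= in_itv /= => /andP[_ st]; rewrite mem_set//= in_itv /=.
Qed.

End energy_integral.

(** * Passage to the limit *)

Section uniform_limits.
Context {R : realType} {H : completeNormedModType R}.

(** Uniformity on half-lines and not merely on compact intervals, because the memory at time [t]
    depends on all earlier times. *)
Definition ray_cauchy (W : nat -> R -> H) := forall (T e : R), 0 < e ->
  exists N : nat, forall n m : nat, (N <= n)%N -> (N <= m)%N ->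
    forall t, t <= T -> `|W n t - W m t| <= e.

Definition ray_limit (W : nat -> R -> H) (t : R) : H := lim (W n t @[n --> \oo]).

Lemma ray_limit_cvg W t : ray_cauchy W -> W n t @[n --> \oo] --> ray_limit W t.
Proof.
move=> hW; apply: cauchy_seq_cvg => e e0; have [N hN] := hW t e e0.
by exists N => n m Nn Nm; exact: hN.
Qed.

Lemma ray_limit_unif W (T e : R) : ray_cauchy W -> 0 < e -> exists N : nat, forall n : nat,
  (N <= n)%N -> forall t, t <= T -> `|W n t - ray_limit W t| <= e.
Proof.
move=> hW e0; have [N hN] := hW T e e0; exists N => n Nn t tT.
have c : `|W n t - W m t| @[m --> \oo] --> `|W n t - ray_limit W t|.
  by apply: cvg_norm; apply: cvgB; [exact: cvg_cst|exact: ray_limit_cvg].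
by apply: (cvgr_to_le c); exists N => // m /= Nm; exact: hN.
Qed.

Lemma ray_limit_continuous W : ray_cauchy W -> (forall n, continuous (W n)) ->
  continuous (ray_limit W).
Proof.
move=> hW cW t; apply/cts_ed => e e0; have e3 : 0 < e / 3 by rewrite divr_gt0.
have [N hN] := ray_limit_unif (t + 1) hW e3.
have /cts_ed/(_ _ e3)[dl dl0 hdl] := cW N t.
exists (Num.min dl 1); first by rewrite lt_min dl0 ltr01.
move=> s; rewrite lt_min => /andP[/hdl h1 h2].
have s1 : s <= t + 1 by have := le_lt_trans (ler_norm _) h2; lra.
have t1 : t <= t + 1 by lra.
have a1 := hN N (leqnn N) s s1; have a2 := hN N (leqnn N) t t1.
have -> : ray_limit W s - ray_limit W t =
  - (W N s - ray_limit W s) + (W N s - W N t) + (W N t - ray_limit W t).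
  by rewrite opprB subrKA subrKA.
apply: le_trans (ler_normD _ _) _; apply: le_trans (lerD (ler_normD _ _) (lexx _)) _.
rewrite normrN; lra.
Qed.

Variable ip : {dot H for idfun}.
Hypothesis hip : norm_of_dot ip.

Lemma ray_limit_isD W W' t : ray_cauchy W -> ray_cauchy W' ->
  (forall n s, isD (W n) s (W' n s)) -> (forall n, continuous (W' n)) ->
  isD (ray_limit W) t (ray_limit W' t).
Proof.
move=> hW hW' dW cW'; apply: (isD_lim hip dW).
- by move=> s; exact: ray_limit_cvg.
- exact: ray_limit_continuous.
- move=> e e0; have [N hN] := ray_limit_unif (t + 1) hW' e0.
  exists N => n Nn s st; apply: hN => //.
  by have := le_trans (ler_norm _) st; lra.
Qed.

Local Notation mu := (@lebesgue_measure R).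

(** The same convolutions tend to [h] in L^2 on bounded intervals and uniformly to their ray limit,
    so the two limits agree almost everywhere. *)
Lemma ray_limit_ae (h : R -> H) (a : nat -> R) (psi : nat -> R -> R) :
  (forall n, mollifier (a n) (psi n)) -> (forall n, 0 < a n) -> a n @[n --> \oo] --> (0 : R) ->
  L2loc h -> ray_cauchy (fun n => conv (psi n) h) ->
  {ae mu, forall t, h t = ray_limit (fun n => conv (psi n) h) t}.
Proof.
move=> hp a0 ac hh hW; set w := ray_limit _; have hl := L2loc_L1loc hh.
have cw : continuous w by apply: ray_limit_continuous => // n; exact: (conv0_continuous hip (hp n)).
have wl : L2loc w.
  split=> [|b c]; first exact: continuous_sm.
  have cw2 : continuous (fun t => `|w t| ^+ 2).
    rewrite (_ : (fun t => _) = fun t => `|w t| * `|w t|); last by apply/funext => t; rewrite expr2.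
    by move=> s; apply: cvgM; apply: cvg_norm; exact: cw.
  have := continuous_compact_integrable (@segment_compact _ b c) (continuous_subspaceT cw2).
  move=> /integrableP[_]; congr (_ < _)%E.
  by apply: eq_integral => t _ /=; rewrite ger0_norm// sqr_ge0.
have dl2 : L2loc (fun t => h t - w t).
  have mm := smB hh.1 wl.1.
  split=> // b c; have := rintD (rintZ 2 (L2loc_rint b c hh)) (rintZ 2 (L2loc_rint b c wl)).
  move=> gi; apply/rint_indicP => //; [exact: measurable_normX2|].
  apply: rint_le gi.
    by apply: measurable_indicM => //; exact: measurable_normX2.
  move=> t; rewrite ger0_norm ?mulr_ge0 ?indic_ge0 ?sqr_ge0//.
  have := ler_wpM2l (indic_ge0 `[b, c]%classic t) (normr2D (h t) (- w t)).
  by rewrite normrN => /le_trans; apply; rewrite le_eqVlt; apply/orP; left; apply/eqP; ring.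
have : {ae mu, forall t, setT t -> h t - w t = 0}.
  apply: ae_zero_loc openT => b c _; split; first exact: L2loc_rint.
  apply/ler_addgt0Pl => e e0; rewrite addr0.
  have e4 : 0 < e / 4 by rewrite divr_gt0.
  have [dl dl0 hdl] := conv_L2loc_cvg hip b c hh e4.
  pose L := Num.max (c - b) 1.
  have L0 : 0 < L by rewrite lt_max ltr01 orbT.
  have eta0 : 0 < Num.min 1 (e / 4 / L) by rewrite lt_min ltr01 !divr_gt0.
  set eta := Num.min _ _ in eta0.
  have [N hN] := ray_limit_unif c hW eta0.
  have /cvgrPdistC_le/(_ _ dl0)[N' _ hN'] := ac.
  pose n := maxn N N'.
  have an : a n <= dl.
    by have := hN' n (leq_maxr _ _); rewrite /= subr0; apply: le_trans; exact: ler_norm.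
  have i1 := hdl _ _ (a0 n) an (hp n).
  have r1 := rint_conv_sub hip b c (hp n) hh.
  have r2 := rint_itv b c.
  apply: (@le_trans _ _ (\int[mu]_t (2 * (\1_(`[b, c]) t * `|conv (psi n) h t - h t| ^+ 2) +
     (2 * eta ^+ 2) * \1_(`[b, c]) t))).
    apply: le_Rintegral => //; first exact: L2loc_rint.
      by apply: rintD; apply: rintZ.
    move=> t _; rewrite indicE; have [/set_mem|_] := boolP (t \in _); last by rewrite !mul0r !mulr0 addr0.
    rewrite /= in_itv /= !mul1r mulr1 => /andP[_ tc].
    have -> : h t - w t = - (conv (psi n) h t - h t) + (conv (psi n) h t - w t).
      by rewrite opprB subrKA.
    apply: le_trans (normr2D _ _) _; rewrite normrN lerD2l ler_pM2l// lerXn2r ?nnegrE ?(ltW eta0)//.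
    exact: hN (leq_maxl _ _) _ tc.
  have E1 : \int[mu]_t (2 * (\1_(`[b, c]) t * `|conv (psi n) h t - h t| ^+ 2)) =
    2 * \int[mu]_t (\1_(`[b, c]) t * `|conv (psi n) h t - h t| ^+ 2) by apply: RintegralZl.
  have E2 : \int[mu]_t ((2 * eta ^+ 2) * \1_(`[b, c]) t) =
    (2 * eta ^+ 2) * \int[mu]_t (\1_(`[b, c]) t : R) by apply: RintegralZl.
  rewrite (RintegralD measurableT (rintZ 2 r1) (rintZ (2 * eta ^+ 2) r2)) E1 E2.
  have i2 : \int[mu]_t (\1_(`[b, c]) t : R) <= L.
    rewrite /Rintegral integral_indic// setIT [X in fine X]lebesgue_measure_itv/= lte_fin.
    case: ifP => _; last by rewrite ltW.
    by rewrite -EFinB /= le_max lexx.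
  have eta1 : eta ^+ 2 <= e / 4 / L.
    apply: (@le_trans _ _ eta); last by rewrite ge_min lexx orbT.
    by rewrite expr2 ler_piMr ?(ltW eta0)// ge_min lexx.
  have i3 : eta ^+ 2 * L <= e / 4 by rewrite -ler_pdivlMr.
  have i4 : eta ^+ 2 * \int[mu]_t (\1_(`[b, c]) t : R) <= eta ^+ 2 * L.
    by rewrite ler_wpM2l ?sqr_ge0.
  move: i1 i3 i4; rewrite -(mulrA 2).
  move: (\int[mu]_t _) (eta ^+ 2 * _) (eta ^+ 2 * _) => x y z *; lra.
by apply: aeS => t /(_ I)/eqP; rewrite subr_eq0 => /eqP.
Qed.

Lemma Rint_deriv0 (g g' : R -> R) (a b : R) : (forall t, isD g t (g' t)) -> continuous g' ->
  (forall t, t < a \/ b < t -> g t = 0 /\ g' t = 0) -> \int[mu]_t g' t = 0.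
Proof.
move=> gd cg' g0.
pose c := Num.min a b - 1; pose d := Num.max a b + 1.
have ma : Num.min a b <= a by rewrite ge_min lexx.
have bM : b <= Num.max a b by rewrite le_max lexx orbT.
have aM : a <= Num.max a b by rewrite le_max lexx.
have ca : c < a by rewrite /c; move: (Num.min a b) ma => m *; lra.
have bd : b < d by rewrite /d; move: (Num.max a b) bM => m *; lra.
have cd : c < d by apply: (lt_trans ca); rewrite /d; move: (Num.max a b) aM => m *; lra.
have -> : \int[mu]_t g' t = \int[mu]_(t in `[c, d]) g' t.
  rewrite [RHS]Rintegral_mkcond; apply: eq_Rintegral => t _; rewrite patchE.
  have [//|tI] := boolP (t \in _).
  apply: (g0 t _).2; move: tI; rewrite notin_setE /= in_itv /= => /negP; rewrite negb_and -!ltNge.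
  by case/orP => h; [left; exact: lt_trans ca|right; exact: lt_trans h].
rewrite /Rintegral (@continuous_FTC2 _ g' g c d cd).
- by rewrite (g0 d (or_intror bd)).1 (g0 c (or_introl ca)).1 -EFinB subrr.
- exact: continuous_subspaceT.
- split.
  + by move=> x _; exact: isD_derivable (gd x).
  + by apply: cvg_at_right_filter; exact: isD_cts (gd c).
  + by apply: cvg_at_left_filter; exact: isD_cts (gd d).
- by move=> x _; exact: isD_derive1 (gd x).
Qed.

End uniform_limits.

(** * Mollified weak solutions are classical solutions *)

Section regularized.
Context {R : realType} {H V : completeNormedModType R}.
Local Notation mu := (@lebesgue_measure R).
Variables (ip : {dot H for idfun}) (iota P : {linear V -> H}).
Hypotheses (hip : norm_of_dot ip) (iota_cont : continuous iota) (P_cont : continuous P)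
  (P_skew : skew_adjoint ip iota P).
Variables (A B : {linear H -> H}) (Q : R -> {linear H -> H}) (Cl : R).
Hypotheses (A_cont : continuous A) (A_sym : symmetric_op ip A) (Cl_gt0 : 0 < Cl)
  (A_coer : forall x, Cl * ip x x <= ip (A x) x) (B_cont : continuous B)
  (hQ : memory_kernel ip Q).

(** The pair [(iota v, - P v)] lies in the adjoint graph; it is tested with [v] itself. This removes
    the unbounded operator from the energy balance. *)
Lemma skew_ip0 v : ip (P v) (iota v) = 0.
Proof.
have : adjoint_graph ip iota P (iota v, - P v) by rewrite P_skew; exists v.
move=> /(_ v) /= /eqP; rewrite ipNr -addr_eq0 (ipC _ (iota v)) -mulr2n mulrn_eq0 /=.
by move/eqP.
Qed.

(** Membership in the domain of [P] is expressed by a preimage at each time, with no regularity in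
    [V] demanded, and the equation is solved for [P v]: this is the form that the adjoint graph
    delivers. *)
Definition classical_sol (y y' z : R -> H) :=
  [/\ forall t, isD y t (y' t), causal_continuous y, continuous z &
   forall t, exists2 v, iota v = y t &
     P v = z t - A (y' t) - B (y t) - memory Q y t].

Lemma classical_solB y y' z u u' g : classical_sol y y' z -> classical_sol u u' g ->
  classical_sol (fun t => y t - u t) (fun t => y' t - u' t) (fun t => z t - g t).
Proof.
move=> [yd yc zc yv] [ud uc gc uv]; split.
- by move=> t; apply: isDB.
- exact: causal_continuousB.
- by move=> t; apply: cvgB; [exact: zc|exact: gc].
move=> t; have [v vy Pv] := yv t; have [w wu Pw] := uv t.
exists (v - w); first by rewrite linearB vy wu.
rewrite linearB Pv Pw (memoryB hip hQ)// [A (_ - _)]linearB [B (_ - _)]linearB.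
have subACA (a b c d : H) : a - b - (c - d) = a - c - (b - d).
  by rewrite !opprD addrACA.
by do 3! (rewrite [LHS]subACA; congr (_ - _)).
Qed.

Lemma classical_sol_energy y y' z T0 T t : classical_sol y y' z ->
  (forall s, s < T0 -> z s = 0) -> t <= T ->
  `|y t| ^+ 2 <= energy_const Cl (opnorm B) (norm_L1 Q) T0 T *
    \int[mu]_s (\1_(`]-oo, t]) s * `|z s| ^+ 2).
Proof.
move=> [yd yc zc yv] z0 tT; have [cy [T1 yT1]] := yc.
apply: (@energy_integral _ _ _ hip A Cl (opnorm B) (norm_L1 Q) y y' z T1 T0 T t) => //.
- exact: opnorm_ge0.
- exact: norm_L1_ge0.
move=> s S hS; have [v vy Pv] := yv s.
have E : A (y' s) = z s - P v - B (y s) - memory Q y s.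
  by rewrite Pv; apply: (ip_ext hip) => x; rewrite !ipBl; ring.
rewrite E !ipBl -{2}vy skew_ip0 subr0 !mulrDl.
have h1 := ip_le hip (z s) (y s).
have h2 := ip_le hip (- B (y s)) (y s); rewrite ipNl normrN in h2.
have h3 := ip_le hip (- memory Q y s) (y s); rewrite ipNl normrN in h3.
have h4 : `|B (y s)| * `|y s| <= opnorm B * `|y s| * `|y s|.
  by rewrite ler_wpM2r// opnorm_le.
have h5 : `|memory Q y s| * `|y s| <= norm_L1 Q * S * `|y s|.
  by rewrite ler_wpM2r// (norm_memory_le hip hQ).
move: (ip _ _) (ip _ _) (ip _ _) (`|z s| * _) (`|B _| * _) (`|memory _ _ _| * _) h1 h2 h3 h4 h5 => *.
lra.
Qed.

Lemma adjointZ (c : R) y : adjoint ip B (c *: y) = c *: adjoint ip B y.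
Proof.
apply: (ip_ext hip) => x; rewrite ipZl !(ipC _ _ x) -!(adjointE hip _ _ B_cont).
by rewrite ipZr.
Qed.

(** Moving [A] and the adjoint of [B] to the other side of the inner product leaves [w] only in
    [P w] and [iota w], which is the shape of the adjoint graph condition. *)
Lemma graph_of_test y y' r z w :
  ip y (P w) - ip y' (A (iota w)) - ip y (adjoint ip B (iota w)) - ip r (iota w)
    = - ip z (iota w) ->
  ip (P w) y = ip (iota w) (A y' + B y + r - z).
Proof.
rewrite -(adjointE hip _ _ B_cont) -A_sym (ipC _ (P w)) (ipC _ (iota w)) ipBl !ipDl.
move: (ip _ (P w)) (ip (A _) _) (ip (B _) _) (ip r _) (ip z _) => x1 x2 x3 x4 x5 h; lra.
Qed.

(** The tested equation holds for every [w] in [V], so the mollified value and [p] form a pair in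
    the adjoint graph; since this graph equals that of [- P], the mollified value lies in the
    domain. *)
Lemma mollified_weak_solution (u f : R -> H) (Tu a : R) psi j :
  L2plus u -> (forall t, t < Tu -> u t = 0) -> L2loc f ->
  (forall phi : R -> V, test_fun phi ->
    \int[mu]_t ip (u t) (A (iota ((phi^`())%classic t)) + P (phi t)
                         - adjoint ip B (iota (phi t))
                         - memory_adj Q (iota \o phi) t) =
    - \int[mu]_t ip (f t) (iota (phi t))) ->
  mollifier a psi ->
  classical_sol (conv psi^`(j) u) (conv psi^`(j.+1) u) (conv psi^`(j) f).
Proof.
move=> hu uT hf hw hp.
have ul := L2loc_L1loc hu.1; have fl := L2loc_L1loc hf.
have hK := mollifier_kernel j hp; have hK1 := mollifier_kernel j.+1 hp.
have dU t := @conv_mollifier_isD _ _ _ hip a psi j u t hp ul.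
have cU : continuous (conv psi^`(j) u) by exact: (conv_continuous hip hp ul).
have U0 t : t < Tu -> conv psi^`(j) u t = 0.
  by apply: (conv_vanish hip hK ul); apply: aeT.
have hc : causal_continuous (conv psi^`(j) u) by split=> //; exists Tu.
split; [exact: dU|exact: hc|exact: (conv_continuous hip hp fl)|].
move=> tau; set p := A (conv psi^`(j.+1) u tau) + B (conv psi^`(j) u tau)
  + memory Q (conv psi^`(j) u) tau - conv psi^`(j) f tau.
have : adjoint_graph ip iota P (conv psi^`(j) u tau, p).
  move=> w /=.
  pose K (t : R) := derive1n j psi (tau - t); pose K' (t : R) := derive1n j.+1 psi (tau - t).
  have [tphi dphi] := @test_fun_mollifier R V a psi j tau w hp.
  have dphi1 (t : R) : ((fun t => K t *: w)^`())%classic t = - K' t *: w.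
    by have := dphi 1%N t; rewrite derive1n1 expr1 mulN1r addn1.
  have cK : continuous (fun t => K t *: iota w).
    by move=> t; apply: cvgZr_tmp; apply: kernel_refl_continuous; exact: hK.1.
  have K0 s : tau < s -> K s *: iota w = 0.
    by move=> ts; rewrite /K hK.2 ?scale0r//; left; rewrite subr_lt0.
  have cR := memory_adj_continuous hip hQ cK K0.
  have R0 t : tau < t -> memory_adj Q (fun s => K s *: iota w) t = 0.
    exact: (memory_adj_vanish hip hQ cK K0).
  have r1 := rint_conv hip tau (A (iota w)) hK1 ul.
  have r2 := rint_conv hip tau (P w) hK ul.
  have r3 := rint_conv hip tau (adjoint ip B (iota w)) hK ul.
  have r4 := rint_ip_causal hip (a := Tu) ul (aeT uT) cR R0.
  have E4 := memory_conv hip hQ tau (iota w) ul uT hK hc.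
  have E1 := ip_conv hip tau (A (iota w)) hK1 ul.
  have E2 := ip_conv hip tau (P w) hK ul.
  have E3 := ip_conv hip tau (adjoint ip B (iota w)) hK ul.
  have E5 := ip_conv hip tau (iota w) hK fl.
  have := hw _ tphi.
  rewrite (_ : (fun t => ip (f t) _) = fun t => K t * ip (f t) (iota w)); last first.
    by apply/funext => t; rewrite linearZ ipZr.
  rewrite -E5.
  have r12 := rintB r2 r1; have r123 := rintB r12 r3.
  have -> : \int[mu]_t ip (u t) (A (iota (((fun t => K t *: w)^`())%classic t)) + P (K t *: w)
                         - adjoint ip B (iota (K t *: w))
                         - memory_adj Q (iota \o (fun t => K t *: w)) t) =
     \int[mu]_t (K t * ip (u t) (P w) - K' t * ip (u t) (A (iota w))
        - K t * ip (u t) (adjoint ip B (iota w)) -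
        ip (u t) (memory_adj Q (fun s => K s *: iota w) t)).
    apply: eq_Rintegral => t _; rewrite dphi1 !linearZ /= adjointZ !ipBr ipDr !ipZr.
    have -> : iota \o (fun t => K t *: w) = fun t => K t *: iota w.
      by apply/funext => s /=; rewrite linearZ.
    by rewrite mulNr [- _ + _]addrC !scalerN.
  rewrite (RintegralB measurableT r123 r4) (RintegralB measurableT r12 r3).
  rewrite (RintegralB measurableT r2 r1) -E1 -E2 -E3 E4.
  exact: graph_of_test.
have oppE (a1 a2 a3 a4 : H) : - (a1 + a2 + a3 - a4) = a4 - a1 - a2 - a3.
  by rewrite !opprD opprK addrC !addrA.
(* Here [- P v = p], which is the equation at [tau] up to the order of the terms. *)
rewrite P_skew => -[v _ [vU Pv]]; exists v; first exact: vU.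
rewrite -[P v]opprK Pv; exact: oppE.
Qed.

(** The adjoint is linear and inherits the bound [M] of [B]: pair [B] of the vector [adjoint ip B y]
    with [y] and apply Cauchy-Schwarz. *)
Lemma adjoint_comp_continuous (g : R -> H) :
  continuous g -> continuous (fun t => adjoint ip B (g t)).
Proof.
move=> gc; have [M M0 hM] := bounded_op B_cont.
have adjB x y : adjoint ip B (x - y) = adjoint ip B x - adjoint ip B y.
  apply: (ip_ext hip) => w; rewrite !(ipC _ _ w) ipBr -!(adjointE hip _ _ B_cont).
  by rewrite ipBr.
have adj_le y : `|adjoint ip B y| <= M * `|y|.
  have := ip_le hip (B (adjoint ip B y)) y; rewrite (adjointE hip _ _ B_cont) -hip => h.
  have [->|z0] := eqVneq (adjoint ip B y) 0; first by rewrite normr0 mulr_ge0.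
  rewrite -(@ler_pM2r _ `|adjoint ip B y|) ?normr_gt0// -expr2 (le_trans h)//.
  by rewrite mulrAC ler_wpM2r.
have M1 : 0 < 1 + M by rewrite ltr_pwDl.
move=> t; apply/cts_ed => e e0.
have [dl dl0 hdl] := (cts_ed _ _).1 (gc t) (e / (1 + M)) (divr_gt0 e0 M1).
exists dl => // s /hdl; rewrite ler_pdivlMr// => hs; rewrite -adjB.
apply: (le_trans (adj_le _)); apply: (le_trans _ hs).
by rewrite mulrC ler_wpM2l// lerDr.
Qed.

End regularized.

(** * Classical solutions satisfy the weak equation *)

Section testing.
Context {R : realType} {H V : completeNormedModType R}.
Local Notation mu := (@lebesgue_measure R).
Variables (ip : {dot H for idfun}) (iota P : {linear V -> H}).
Hypotheses (hip : norm_of_dot ip) (iota_cont : continuous iota) (P_cont : continuous P)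
  (P_skew : skew_adjoint ip iota P).
Variables (A B : {linear H -> H}) (Q : R -> {linear H -> H}).
Hypotheses (A_cont : continuous A) (A_sym : symmetric_op ip A) (B_cont : continuous B)
  (hQ : memory_kernel ip Q).

Lemma test_support (E : normedModType R) (phi : R -> E) : test_fun phi ->
  exists a b, forall j s, s < a \/ b < s -> derive1n j phi s = 0.
Proof.
move=> [_ /compact_bounded [M [Mr hM]]].
have [b [Mb b0]] : exists b, M < b /\ 0 < b.
  exists (`|M| + 1); split; last by rewrite ltr_wpDl.
  by apply: le_lt_trans (ler_norm _) _; rewrite ltrDl.
have z s : b < `|s| -> phi s = 0.
  move=> bs; apply/eqP/negPn/negP => ps.
  have cl : closure [set t | phi t != 0] s by apply: subset_closure.
  by have := hM b Mb s cl; rewrite /= leNgt bs.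
exists (- b), b => j s [sb|bs].
- apply: (@smooth_vanish _ _ _ `]-oo, (- b)[); [exact: interval_open| |by rewrite /= in_itv].
  move=> x; rewrite /= in_itv /= => xb; apply: z.
  by rewrite ltrNr in xb; apply: lt_le_trans xb _; rewrite -normrN ler_norm.
- apply: (@smooth_vanish _ _ _ `]b, +oo[); [exact: interval_open| |by rewrite /= in_itv /= bs].
  move=> x; rewrite /= in_itv /= andbT => xb; apply: z.
  by apply: lt_le_trans xb _; rewrite ler_norm.
Qed.

Lemma rint_ip_bounded (g h : R -> H) a b : continuous g -> continuous h ->
  (forall s, s < a \/ b < s -> h s = 0) -> rint mu (fun t => ip (g t) (h t)).
Proof.
move=> gc hc h0; have c : continuous (fun t => ip (g t) (h t)).
  by move=> t; apply: (cvg_ip hip); [exact: gc|exact: hc].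
have z s : s < a \/ b < s -> ip (g s) (h s) = 0 by move=> /h0 ->; rewrite ip0r.
have [M _ hM] := bounded_support c z.
apply: (rint_bounded_support _ hM z).
exact: continuous_measurable_fun.
Qed.

Definition test_expr (phi : R -> V) (t : R) : H :=
  A (iota ((phi^`())%classic t)) + P (phi t) - adjoint ip B (iota (phi t))
    - memory_adj Q (iota \o phi) t.

Section test_function.
Variables (phi : R -> V) (a b : R).
Hypotheses (tphi : test_fun phi)
  (phi0 : forall j s, s < a \/ b < s -> derive1n j phi s = 0).

Let phic j : continuous (derive1n j phi).
Proof. exact: smooth_continuous tphi.1 j. Qed.

Let iphic j : continuous (fun t => iota (derive1n j phi t)).
Proof. by move=> t; apply: (cvg_comp (derive1n j phi) iota); [exact: phic|exact: iota_cont]. Qed.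

Let iphi0 j s : s < a \/ b < s -> iota (derive1n j phi s) = 0.
Proof. by move=> /phi0 ->; rewrite linear0. Qed.

Let b0 s : b < s -> (iota \o phi) s = 0.
Proof. by move=> bs; apply: (@iphi0 0); right. Qed.

Lemma test_expr_continuous : continuous (test_expr phi).
Proof.
move=> t; apply: cvgB; last first.
  exact: (memory_adj_continuous hip hQ (@iphic 0) b0).
apply: cvgB; last exact: (adjoint_comp_continuous hip B_cont (@iphic 0)).
apply: cvgD.
  apply: (cvg_comp (fun t => iota (derive1n 1 phi t)) A); [exact: iphic|exact: A_cont].
by apply: (cvg_comp phi P); [exact: (@phic 0)|exact: P_cont].
Qed.

Lemma test_expr_vanish s : b < s -> test_expr phi s = 0.
Proof.
move=> bs; rewrite /test_expr (memory_adj_vanish hip hQ (@iphic 0) b0 bs) subr0.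
have -> : phi s = 0 by apply: (@phi0 0 _); right.
rewrite [_^`()%classic s](@phi0 1 _); last by right.
rewrite !linear0 !add0r; apply/eqP; rewrite oppr_eq0; apply/eqP.
by apply: (ip_ext hip) => x; rewrite !(ipC _ _ x) -(adjointE hip _ _ B_cont) !ip0r.
Qed.

(* Testing the pointwise equation: the time derivatives combine into a total
   derivative, and the two memory terms are dual to each other. *)
Lemma classical_sol_weak y y' z :
  classical_sol iota P A B Q y y' z -> continuous y' ->
  \int[mu]_t ip (y t) (test_expr phi t) = - \int[mu]_t ip (z t) (iota (phi t)).
Proof.
move=> [yd yc zc yv] y'c; have [cy [T1 yT1]] := yc.
have ip1 := @iphic 0; have ip2 := @iphic 1.
have Ay : continuous (A \o y) by move=> t; apply: (cvg_comp y A); [exact: cy|exact: A_cont].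
have Ay' : continuous (A \o y').
  by move=> t; apply: (cvg_comp y' A); [exact: y'c|exact: A_cont].
pose D t := ip (A (y' t)) (iota (phi t)) + ip (A (y t)) (iota (derive1n 1 phi t)).
have D0 : \int[mu]_t D t = 0.
  apply: (@Rint_deriv0 _ (fun t => ip (A (y t)) (iota (phi t))) D a b).
  - move=> t; have dA := isD_lin A_cont (yd t).
    have di := isD_lin iota_cont (@smooth_isD _ _ _ tphi.1 0%N t).
    exact: (isD_ip hip dA di).
  - move=> t; apply: cvgD; apply: (cvg_ip hip).
    + exact: Ay'.
    + exact: ip1.
    + exact: Ay.
    + exact: ip2.
  - move=> t tab; rewrite /D (@iphi0 0)// (@iphi0 1)// !ip0r; split=> //.
    by rewrite addr0.
have Rc := memory_continuous hip hQ yc.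
have rD : rint mu D.
  by apply: rintD; [apply: (rint_ip_bounded Ay' ip1 (@iphi0 0))|
                    apply: (rint_ip_bounded Ay ip2 (@iphi0 1))].
have rz := rint_ip_bounded zc ip1 (@iphi0 0).
have rR := rint_ip_bounded Rc ip1 (@iphi0 0).
have cR := memory_adj_continuous hip hQ ip1 b0.
have rRs := rint_ip_causal hip (a := T1) (continuous_L1loc cy) (aeT yT1) cR
   (fun t => memory_adj_vanish hip hQ ip1 b0 (t := t)).
have dual := memory_duality hip hQ yc ip1 (@iphi0 0).
transitivity (\int[mu]_t (D t - ip (z t) (iota (phi t)) +
   ip (memory Q y t) (iota (phi t)) - ip (y t) (memory_adj Q (iota \o phi) t))).
  apply: eq_Rintegral => t _; rewrite /test_expr ipBr; congr (_ - _).
  have [v vy Pv] := yv t.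
  have : adjoint_graph ip iota P (iota v, - P v) by rewrite P_skew; exists v.
  move=> /(_ (phi t)) /=; rewrite vy Pv ipNr !ipBr !(ipC _ (iota (phi t))).
  rewrite ipDr -(A_sym (y t)) -(adjointE hip _ _ B_cont) (ipC _ (y t) (P _)) /D.
  rewrite -[_^`()%classic t]/(derive1n 1 phi t).
  move: (ip (A (y t)) _) (ip (A (y' t)) _) (ip (P _) _) (ip (B _) _) (ip (z t) _)
    (ip (memory _ _ _) _) => x1 x2 x3 x4 x5 x6 ->; lra.
have r1 := rintB rD rz; have r2 := rintD r1 rR.
rewrite (RintegralB measurableT r2 rRs) (RintegralD measurableT r1 rR).
rewrite (RintegralB measurableT rD rz) D0 dual sub0r addrK.
by [].
Qed.

End test_function.

End testing.

Section chain.
Context {R : realType} {E : normedModType R}.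

Lemma derive1n_chain (w : nat -> R -> E) k : (forall j t, (j < k)%N -> isD (w j) t (w j.+1 t)) ->
  forall j, (j <= k)%N -> derive1n j (w 0%N) = w j.
Proof.
move=> hw; elim=> [|j IH] jk //.
rewrite derive1nS IH; last exact: ltnW.
by apply/funext => t; apply: isD_derive1; exact: hw.
Qed.

Lemma Ck_chain (w : nat -> R -> E) k : (forall j t, (j < k)%N -> isD (w j) t (w j.+1 t)) ->
  continuous (w k) -> Ck k (w 0%N).
Proof.
move=> hw wc; split=> [j jk t|]; last by rewrite (derive1n_chain hw).
by rewrite (derive1n_chain hw) ?(ltnW jk)//; have /isDP[] := hw j t jk.
Qed.

End chain.

(** * Regularity in [V] through the graph norm *)

Section graph_norm.
Context {R : realType} {H V : completeNormedModType R}.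
Variables (iota P : {linear V -> H}) (c1 : R).
Hypotheses (c1_gt0 : 0 < c1) (graph_ge : forall v, c1 * `|v| <= graph_norm iota P v).

Lemma graph_norm_sqr v : c1 ^+ 2 * `|v| ^+ 2 <= `|iota v| ^+ 2 + `|P v| ^+ 2.
Proof.
have p : 0 <= `|iota v| ^+ 2 + `|P v| ^+ 2 by rewrite addr_ge0.
rewrite -exprMn -[leRHS]sqr_sqrtr// ler_sqr ?nnegrE ?sqrtr_ge0//; last first.
  by rewrite mulr_ge0// ltW.
Qed.

Lemma graph_norm_le v : `|v| <= c1^-1 * (`|iota v| + `|P v|).
Proof.
rewrite -(@ler_pM2l _ c1)// mulVKf ?gt_eqF//.
apply: le_of_sqr; first by rewrite addr_ge0.
rewrite exprMn (le_trans (graph_norm_sqr v))// sqrrD -addrA lerD2l lerDr.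
by rewrite mulrn_wge0// mulr_ge0.
Qed.

Lemma graph_continuous (x : R -> V) t : {for t, continuous (iota \o x)} ->
  {for t, continuous (P \o x)} -> {for t, continuous x}.
Proof.
move=> /cts_ed hi /cts_ed hP; apply/cts_ed => e e0.
have e1 : 0 < c1 * e / 2 by rewrite divr_gt0// mulr_gt0.
have [d1 d10 h1] := hi _ e1; have [d2 d20 h2] := hP _ e1.
exists (Num.min d1 d2); first by rewrite lt_min d10 d20.
move=> s; rewrite lt_min => /andP[s1 s2]; apply: (le_trans (graph_norm_le _)).
rewrite !linearB ler_pdivrMl//.
by apply: (le_trans (lerD (h1 _ s1) (h2 _ s2))); rewrite -splitr.
Qed.

(** The remainder is a vector of [V], so its norm is controlled by its images under [iota] and [P],
    both of which are remainders in [H]. *)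
Lemma graph_isD (x : R -> V) t d : isD (iota \o x) t (iota d) -> isD (P \o x) t (P d) ->
  isD x t d.
Proof.
move=> /isD_ed hi /isD_ed hP; apply: (isD_ed _ _ _).2 => e e0.
have e1 : 0 < c1 * e / 2 by rewrite divr_gt0// mulr_gt0.
have [d1 d10 h1] := hi _ e1; have [d2 d20 h2] := hP _ e1.
exists (Num.min d1 d2); first by rewrite lt_min d10 d20.
move=> s; rewrite lt_min => /andP[s1 s2]; apply: (le_trans (graph_norm_le _)).
rewrite !linearB !linearZ/= !scalerN ler_pdivrMl//.
apply: (le_trans (lerD (h1 _ s1) (h2 _ s2))).
by rewrite -mulrDl -splitr mulrA.
Qed.

Lemma graph_bound_op c2 : (forall v, graph_norm iota P v <= c2 * `|v|) ->
  forall v, `|P v| <= c2 * `|v|.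
Proof.
move=> h v; apply: le_trans (h v); rewrite -[leLHS](ger0_norm)// -sqrtr_sqr.
by rewrite ler_wsqrtr// lerDr.
Qed.

End graph_norm.

Section causal_functions.
Context {R : realType} {H : completeNormedModType R}.
Local Notation mu := (@lebesgue_measure R).

Lemma continuous_L2loc (v : R -> H) : continuous v -> L2loc v.
Proof.
move=> vc; split; first exact: continuous_sm.
move=> a b; have sc : continuous (fun t => `|v t| ^+ 2 : R^o).
  move=> t; have nc : {for t, continuous (fun s => `|v s|)} by apply: cvg_norm; exact: vc.
  by apply: (cvg_comp (fun s => `|v s|) (fun x : R => x ^+ 2)); [exact: nc|exact: exprn_continuous].
have := (continuous_L1loc sc).2 a b.
under eq_fun do rewrite ger0_norm//.
move/rint_indicP; apply => //; first exact: continuous_measurable_fun.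
Qed.

Lemma causal_continuous_L2plus (v : R -> H) : causal_continuous v -> L2plus v.
Proof.
move=> [vc [T vT]]; apply: (causal_L2plus (continuous_L2loc vc) (T := T)).
exact: aeT.
Qed.

Lemma causal_continuous_causal (v : R -> H) : causal_continuous v -> causal v.
Proof. by move=> [_ [T vT]]; exists T; exact: vanish_ess_supp. Qed.

End causal_functions.

Section symmetric_bound.
Context {R : realType} {H : completeNormedModType R}.
Variables (ip : {dot H for idfun}) (A : {linear H -> H}) (Cl Cu : R).
Hypotheses (hip : norm_of_dot ip) (A_sym : symmetric_op ip A) (Cl_gt0 : 0 < Cl)
  (Cl_le : Cl <= Cu) (A_bnd : forall x, Cl * ip x x <= ip (A x) x <= Cu * ip x x).

(* Positivity of [A] at [x - Cu^-1 *: A x]. *)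
Lemma symmetric_norm_le x : `|A x| <= Cu * `|x|.
Proof.
have Cu0 : 0 < Cu by apply: lt_le_trans Cl_le.
apply: le_of_sqr; first by rewrite mulr_ge0// ltW.
have [_ h1] := andP (A_bnd x); have [_ h2] := andP (A_bnd (A x)).
have [+ _] := andP (A_bnd (x - Cu^-1 *: A x)).
move=> /(le_trans (mulr_ge0 (ltW Cl_gt0) _)); rewrite -hip sqr_ge0 => /(_ isT).
rewrite [A (_ - _)]linearB [A (_ *: _)]linearZ/= ipBl ipZl !ipBr !ipZr (A_sym (A x)) -hip => h3.
rewrite exprMn !hip.
(* Together with [<A A x, A x> <= Cu |A x|^2] this gives [|A x|^2 <= Cu <A x, x>], and the upper
   form bound concludes. *)
have E : Cu ^+ 2 * (ip (A x) x - Cu^-1 * ip (A x) (A x) -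
   Cu^-1 * (ip (A x) (A x) - Cu^-1 * ip (A (A x)) (A x))) =
   Cu ^+ 2 * ip (A x) x - 2 * Cu * ip (A x) (A x) + ip (A (A x)) (A x).
  by field; rewrite gt_eqF.
have {}h3 : 0 <= Cu ^+ 2 * ip (A x) x - 2 * Cu * ip (A x) (A x) + ip (A (A x)) (A x).
  rewrite -E mulr_ge0 ?sqr_ge0//; move: h3; rewrite hip; lra.
have h4 : Cu * ip (A x) (A x) <= Cu * (Cu * ip (A x) x) by lra.
move: h4; rewrite ler_pM2l// => /le_trans; apply.
by rewrite expr2 -mulrA ler_wpM2l// ltW.
Qed.

End symmetric_bound.

(** * Limit of a sequence of classical solutions *)

Section limit.
Context {R : realType} {H V : completeNormedModType R}.
Local Notation mu := (@lebesgue_measure R).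
Variables (ip : {dot H for idfun}) (iota P : {linear V -> H}).
Hypotheses (hip : norm_of_dot ip) (iota_cont : continuous iota) (P_cont : continuous P)
  (P_skew : skew_adjoint ip iota P).
Variables (A B : {linear H -> H}) (Q : R -> {linear H -> H}) (Cl : R).
Hypotheses (A_cont : continuous A) (A_sym : symmetric_op ip A) (Cl_gt0 : 0 < Cl)
  (A_coer : forall x, Cl * ip x x <= ip (A x) x) (B_cont : continuous B)
  (hQ : memory_kernel ip Q).
(** [U n j] and [F n j] play the role of the j-th derivatives of the n-th mollified solution and
    source, [g j] that of the j-th weak derivative of f. They exist for all [j], but sources
    converge, in local L^2, only up to order [k]. *)
Variables (U F : nat -> nat -> R -> H) (g : nat -> R -> H) (Tu T0 : R) (k : nat).
Hypotheses (solUF : forall n j, classical_sol iota P A B Q (U n j) (U n j.+1) (F n j))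
  (U0 : forall n j s, s < Tu -> U n j s = 0) (F0 : forall n j s, s < T0 -> F n j s = 0)
  (dF : forall n j t, isD (F n j) t (F n j.+1 t))
  (gL2 : forall j, (j <= k)%N -> L2plus (g j))
  (F_ray : forall n j t, (j <= k)%N ->
    \int[mu]_s (\1_(`]-oo, t]) s * `|F n j s| ^+ 2) <=
    \int[mu]_s (\1_(`]-oo, t]) s * `|g j s| ^+ 2))
  (F_cvg : forall j b c e, (j <= k)%N -> 0 < e -> exists N, forall n, (N <= n)%N ->
    rint mu (fun s => \1_(`[b, c]) s * `|F n j s - g j s| ^+ 2) /\
    \int[mu]_s (\1_(`[b, c]) s * `|F n j s - g j s| ^+ 2) <= e).

Let Uc n j : continuous (U n j).
Proof. by have [_ []] := solUF n j. Qed.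
Let Fc n j : continuous (F n j).
Proof. by have [] := solUF n j. Qed.

Lemma source_cauchy j T e : (j <= k)%N -> 0 < e -> exists N, forall n m,
  (N <= n)%N -> (N <= m)%N -> forall t, t <= T ->
  \int[mu]_s (\1_(`]-oo, t]) s * `|F n j s - F m j s| ^+ 2) <= e.
Proof.
move=> jk e0; have e4 : 0 < e / 4 by rewrite divr_gt0.
have [N hN] := F_cvg T0 T jk e4; exists N => n m nN mN t tT.
have [rn In] := hN _ nN; have [rm Im] := hN _ mN.
have r2n := rintZ 2 rn; have r2m := rintZ 2 rm; have r := rintD r2n r2m.
(* All sources vanish before [T0], so the half-line integral is one over [T0, T], where local
   convergence applies. *)
have bnd s : `|\1_(`]-oo, t]) s * `|F n j s - F m j s| ^+ 2| <=
    2 * (\1_(`[T0, T]) s * `|F n j s - g j s| ^+ 2) +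
    2 * (\1_(`[T0, T]) s * `|F m j s - g j s| ^+ 2).
  rewrite ger0_norm ?mulr_ge0 ?indic_ge0//.
  have [sT0|T0s] := ltP s T0.
    rewrite !F0// subrr normr0 expr0n mulr0.
    by rewrite addr_ge0// mulr_ge0// mulr_ge0 ?indic_ge0 ?sqr_ge0.
  have [st|ts] := leP s t; last first.
    rewrite [X in X * _ <= _]indicE memNset ?mul0r; last first.
      by rewrite /= in_itv /= leNgt ts.
    by rewrite addr_ge0// mulr_ge0// mulr_ge0 ?indic_ge0 ?sqr_ge0.
  rewrite !indicE !mem_set ?mul1r; first last.
  - by rewrite /= in_itv.
  - by rewrite /= in_itv /= T0s (le_trans st).
  have -> : F n j s - F m j s = (F n j s - g j s) + - (F m j s - g j s).
    by rewrite opprB addrA subrK.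
  by rewrite (le_trans (normr2D _ _))// normrN.
have rL : rint mu (fun s => \1_(`]-oo, t]) s * `|F n j s - F m j s| ^+ 2).
  apply: (@rint_le _ (measurableTypeR R) _ mu _ _ _ bnd r); apply: measurable_indicM; first exact: measurable_itv.
  apply: measurable_normX2; apply: continuous_sm => s.
  by apply: cvgB; exact: Fc.
have := le_norm_Rint rL r bnd; rewrite RintegralD// !RintegralZl// => h.
apply: (le_trans (ler_norm _)); apply: (le_trans h).
move: In Im; set x := \int[mu]_s _; set y := \int[mu]_s _ => hx hy; lra.
Qed.

(** A difference of two approximations solves the same equation with the difference of the sources,
    so L^2 convergence of sources becomes uniform convergence of solutions, top order [k]
    included. *)
Lemma sol_ray_cauchy j : (j <= k)%N -> ray_cauchy (U^~ j).
Proof.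
move=> jk T e e0; set C := energy_const Cl (opnorm B) (norm_L1 Q) T0 T.
have C0 : 0 <= C by exact: energy_const_ge0.
have C1 : 0 < 1 + C by rewrite ltr_pwDl.
have e1 : 0 < e ^+ 2 / (1 + C) by rewrite divr_gt0// exprn_gt0.
have [N hN] := source_cauchy T jk e1; exists N => n m nN mN t tT.
apply: le_of_sqr; first exact: ltW.
have z s : s < T0 -> F n j s - F m j s = 0 by move=> sT; rewrite !F0// subrr.
have := classical_sol_energy hip P_skew A_cont A_sym Cl_gt0 A_coer B_cont hQ
  (classical_solB hip hQ (solUF n j) (solUF m j)) z tT.
move/le_trans; apply; apply: (le_trans (ler_wpM2l C0 (hN n m nN mN t tT))).
rewrite mulrCA ler_piMr ?sqr_ge0// ler_pdivrMr// mul1r lerDr//.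
Qed.

(** The energy estimate for the identity in place of [A] and without the other operators: a function
    is controlled pointwise by the L^2 norm of its derivative. *)
Lemma primitive_energy (y y' : R -> H) t T : (forall s, isD y s (y' s)) -> continuous y' ->
  (forall s, s < T0 -> y s = 0) -> (forall s, s < T0 -> y' s = 0) -> t <= T ->
  `|y t| ^+ 2 <= energy_const 1 0 0 T0 T * \int[mu]_s (\1_(`]-oo, t]) s * `|y' s| ^+ 2).
Proof.
move=> yd y'c y0 y'0 tT.
apply: (@energy_integral _ _ _ hip idfun 1 0 0 y y' y' T0 T0 T t) => //.
- by move=> x; exact: cvg_id.
- by move=> x; rewrite mul1r.
- by move=> s S _; rewrite !mul0r !addr0; exact: ip_le.
Qed.

(** Uniform convergence at order [j] uses L^2 convergence at order [j.+1], hence the strict bound on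
    [j]; it limits the regularity in [V] to order k - 1. *)
Lemma source_ray_cauchy j : (j < k)%N -> ray_cauchy (F^~ j).
Proof.
move=> jk T e e0; set C := energy_const 1 0 0 T0 T.
have C0 : 0 <= C by exact: energy_const_ge0.
have C1 : 0 < 1 + C by rewrite ltr_pwDl.
have e1 : 0 < e ^+ 2 / (1 + C) by rewrite divr_gt0// exprn_gt0.
have [N hN] := source_cauchy T jk e1; exists N => n m nN mN t tT.
apply: le_of_sqr; first exact: ltW.
have z i s : s < T0 -> F n i s - F m i s = 0 by move=> sT; rewrite !F0// subrr.
have dd s : isD (fun s => F n j s - F m j s) s (F n j.+1 s - F m j.+1 s) by exact: isDB.
have dc : continuous (fun s => F n j.+1 s - F m j.+1 s).
  by move=> s; apply: cvgB; exact: Fc.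
have := primitive_energy dd dc (z j) (z j.+1) tT.
move/le_trans; apply; apply: (le_trans (ler_wpM2l C0 (hN n m nN mN t tT))).
rewrite mulrCA ler_piMr ?sqr_ge0// ler_pdivrMr// mul1r lerDr//.
Qed.

Definition sol_limit j := ray_limit (U^~ j).
Definition source_limit j := ray_limit (F^~ j).

Lemma sol_limit_vanish j s : s < Tu -> sol_limit j s = 0.
Proof.
move=> sT; rewrite /sol_limit /ray_limit; apply/cvg_lim => //.
under eq_fun do rewrite U0//.
exact: cvg_cst.
Qed.

Lemma sol_limit_causal j : (j <= k)%N -> causal_continuous (sol_limit j).
Proof.
move=> jk; split; first by apply: ray_limit_continuous => //; exact: sol_ray_cauchy.
by exists Tu; exact: sol_limit_vanish.
Qed.

Lemma sol_limit_isD j t : (j < k)%N -> isD (sol_limit j) t (sol_limit j.+1 t).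
Proof.
move=> jk; apply: (ray_limit_isD hip).
- exact: (sol_ray_cauchy (ltnW jk)).
- exact: sol_ray_cauchy.
- by move=> n s; have [] := solUF n j.
- by move=> n; exact: Uc.
Qed.

Lemma source_limit_isD j t : (j.+1 < k)%N -> isD (source_limit j) t (source_limit j.+1 t).
Proof.
move=> jk; apply: (ray_limit_isD hip).
- exact: (source_ray_cauchy (ltnW jk)).
- exact: source_ray_cauchy.
- by move=> n s; exact: dF.
- by move=> n; exact: Fc.
Qed.

Lemma source_limit_continuous j : (j < k)%N -> continuous (source_limit j).
Proof. by move=> jk; apply: ray_limit_continuous => //; exact: source_ray_cauchy. Qed.

Lemma sol_limit_cvg j t : (j <= k)%N -> U n j t @[n --> \oo] --> sol_limit j t.
Proof. by move=> jk; exact: (@ray_limit_cvg _ _ (U^~ j) t (sol_ray_cauchy jk)). Qed.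

Lemma source_limit_cvg j t : (j < k)%N -> F n j t @[n --> \oo] --> source_limit j t.
Proof. by move=> jk; exact: (@ray_limit_cvg _ _ (F^~ j) t (source_ray_cauchy jk)). Qed.

Lemma memory_sol_cvg j t : (j <= k)%N ->
  memory Q (U n j) t @[n --> \oo] --> memory Q (sol_limit j) t.
Proof.
move=> jk; apply/cvgrPdistC_le => e e0.
have N0 := norm_L1_ge0 Q; have N1 : 0 < 1 + norm_L1 Q by rewrite ltr_pwDl.
have [N hN] := ray_limit_unif t (sol_ray_cauchy jk) (divr_gt0 e0 N1).
exists N => // n /= nN.
have uc : causal_continuous (U n j) by have [] := solUF n j.
rewrite -(memoryB hip hQ)//; last exact: sol_limit_causal.
have b := norm_memory_le hip hQ (causal_continuousB uc (sol_limit_causal jk)) (hN _ nN).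
apply: (le_trans b); rewrite mulrCA ler_piMr ?(ltW e0)// ler_pdivrMr// mul1r lerDr//.
Qed.

(** The adjoint graph is defined by pairings and is therefore closed under the limits of both
    components; skew-adjointness turns the limit pair back into a vector of [V]. *)
Lemma sol_limit_domain j t : (j < k)%N -> exists2 v, iota v = sol_limit j t &
  P v = source_limit j t - A (sol_limit j.+1 t) - B (sol_limit j t)
        - memory Q (sol_limit j) t.
Proof.
move=> jk; set p := source_limit j t - _ - _ - _.
suff : adjoint_graph ip iota P (sol_limit j t, - p).
  by rewrite P_skew => -[v _ [vU /oppr_inj Pv]]; exists v.
move=> w /=.
pose pn n := F n j t - A (U n j.+1 t) - B (U n j t) - memory Q (U n j) t.
have cU := @sol_limit_cvg j t (ltnW jk); have cU1 := @sol_limit_cvg j.+1 t jk.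
have cF := @source_limit_cvg j t jk.
have cp : pn n @[n --> \oo] --> p.
  apply: cvgB; last exact: (@memory_sol_cvg j t (ltnW jk)).
  apply: cvgB; last by apply: (cvg_comp _ B cU); exact: B_cont.
  by apply: cvgB => //; apply: (cvg_comp _ A cU1); exact: A_cont.
have l1 : ip (P w) (U n j t) @[n --> \oo] --> ip (P w) (sol_limit j t).
  by apply: (cvg_ip hip) => //; exact: cvg_cst.
have l2 : ip (iota w) (- pn n) @[n --> \oo] --> ip (iota w) (- p).
  by apply: (cvg_ip hip); [exact: cvg_cst|exact: cvgN].
have eqn : (fun n => ip (P w) (U n j t)) = (fun n => ip (iota w) (- pn n)).
  apply/funext => n; have [_ _ _ /(_ t) [v vU Pv]] := solUF n j.
  have : adjoint_graph ip iota P (iota v, - P v) by rewrite P_skew; exists v.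
  by move=> /(_ w) /=; rewrite vU Pv.
rewrite -(cvg_lim _ l1)// -(cvg_lim _ l2)//.
by rewrite eqn.
Qed.

Let ray j t := \int[mu]_s (\1_(`]-oo, t]) s * `|g j s| ^+ 2).

Lemma sol_limit_bound j t T : (j <= k)%N -> t <= T ->
  `|sol_limit j t| ^+ 2 <= energy_const Cl (opnorm B) (norm_L1 Q) T0 T * ray j t.
Proof.
move=> jk tT; set C := energy_const _ _ _ _ _.
have C0 : 0 <= C by exact: energy_const_ge0.
have cU : `|U n j t| ^+ 2 @[n --> \oo] --> `|sol_limit j t| ^+ 2.
  rewrite hip; under eq_fun do rewrite hip.
  by apply: (cvg_ip hip); exact: (@sol_limit_cvg j t jk).
rewrite -(cvg_lim _ cU)//; apply: limr_le; first by apply/cvg_ex; eexists; exact: cU.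
apply: nearW => n.
have := classical_sol_energy hip P_skew A_cont A_sym Cl_gt0 A_coer B_cont hQ
  (solUF n j) (F0 n j) tT.
by move/le_trans; apply; rewrite ler_wpM2l//; exact: F_ray.
Qed.

Lemma source_limit_bound j t T : (j < k)%N -> t <= T ->
  `|source_limit j t| ^+ 2 <= energy_const 1 0 0 T0 T * ray j.+1 t.
Proof.
move=> jk tT; set C := energy_const _ _ _ _ _.
have C0 : 0 <= C by exact: energy_const_ge0.
have cU : `|F n j t| ^+ 2 @[n --> \oo] --> `|source_limit j t| ^+ 2.
  rewrite hip; under eq_fun do rewrite hip.
  by apply: (cvg_ip hip); exact: (@source_limit_cvg j t jk).
rewrite -(cvg_lim _ cU)//; apply: limr_le; first by apply/cvg_ex; eexists; exact: cU.
apply: nearW => n.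
have := primitive_energy (@dF n j) (@Fc n j.+1) (F0 n j) (F0 n j.+1) tT.
by move/le_trans; apply; rewrite ler_wpM2l//; exact: F_ray.
Qed.


Definition rhs_limit j t := source_limit j t - A (sol_limit j.+1 t) - B (sol_limit j t)
  - memory Q (sol_limit j) t.

Lemma rhs_limit_continuous j : (j < k)%N -> continuous (rhs_limit j).
Proof.
move=> jk t; apply: cvgB; last first.
  exact: (memory_continuous hip hQ (sol_limit_causal (ltnW jk))).
apply: cvgB; last first.
  apply: (cvg_comp (sol_limit j) B); last exact: B_cont.
  exact: (sol_limit_causal (ltnW jk)).1.
apply: cvgB; first exact: source_limit_continuous.
apply: (cvg_comp (sol_limit j.+1) A); last exact: A_cont.
exact: (sol_limit_causal jk).1.
Qed.

Lemma rhs_limit_isD j t : (j.+1 < k)%N -> isD (rhs_limit j) t (rhs_limit j.+1 t).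
Proof.
move=> jk; have jk1 := ltnW jk; apply: isDB; last first.
  apply: (memory_isD hip hQ (sol_limit_causal (ltnW jk1)) (sol_limit_causal jk1)).
  by move=> s; exact: sol_limit_isD.
apply: isDB; last by apply: (isD_lin B_cont); exact: sol_limit_isD.
apply: isDB; first exact: source_limit_isD.
by apply: (isD_lin A_cont); exact: sol_limit_isD.
Qed.

(** A pointwise choice of preimage, which exists for [j < k]. Continuity and derivatives in [V] are
    recovered from its images under [iota] and [P]. *)
Definition vsol_limit j t : V :=
  xget 0 [set v | iota v = sol_limit j t /\ P v = rhs_limit j t].

Lemma vsol_limitE j t : (j < k)%N ->
  iota (vsol_limit j t) = sol_limit j t /\ P (vsol_limit j t) = rhs_limit j t.
Proof.
move=> jk; rewrite /vsol_limit; case: xgetP => [v _ //|].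
by have [v vU Pv] := @sol_limit_domain j t jk; move=> /(_ v) []; split.
Qed.

Variables (c1 Cu : R).
Hypotheses (c1_gt0 : 0 < c1) (graph_ge : forall v, c1 * `|v| <= graph_norm iota P v)
  (A_le : forall x, `|A x| <= Cu * `|x|).

Lemma vsol_limit_continuous j : (j < k)%N -> continuous (vsol_limit j).
Proof.
move=> jk t; apply: (graph_continuous c1_gt0 graph_ge).
  have -> : iota \o vsol_limit j = sol_limit j.
    by apply/funext => s; exact: (vsol_limitE s jk).1.
  exact: (sol_limit_causal (ltnW jk)).1.
have -> : P \o vsol_limit j = rhs_limit j.
  by apply/funext => s; exact: (vsol_limitE s jk).2.
exact: rhs_limit_continuous.
Qed.

Lemma vsol_limit_isD j t : (j.+1 < k)%N -> isD (vsol_limit j) t (vsol_limit j.+1 t).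
Proof.
move=> jk; have jk1 := ltnW jk; apply: (graph_isD c1_gt0 graph_ge).
  have -> : iota \o vsol_limit j = sol_limit j.
    by apply/funext => s; exact: (vsol_limitE s jk1).1.
  by rewrite (vsol_limitE t jk).1; exact: sol_limit_isD.
have -> : P \o vsol_limit j = rhs_limit j.
  by apply/funext => s; exact: (vsol_limitE s jk1).2.
by rewrite (vsol_limitE t jk).2; exact: rhs_limit_isD.
Qed.

Lemma ray_mono j s t : (j <= k)%N -> s <= t -> ray j s <= ray j t.
Proof.
move=> jk st; apply: (le_trans (ler_norm _)).
apply: le_norm_Rint; try exact: rint_ray (gL2 jk).
move=> r; rewrite ger0_norm ?mulr_ge0 ?indic_ge0// ler_wpM2r//.
rewrite !indicE; have [rs|_] := boolP (r \in `]-oo, s]%classic); last by rewrite ler0n.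
rewrite mem_set//; move: rs; rewrite inE /= !in_itv /=; by move/le_trans; apply.
Qed.

(* The graph norm is bounded through [P u = f - A u' - B u - R u], where [u] and
   [u'] are controlled by the energy estimate and [f] by the one for the
   trivial equation [y' = f'] with solution [f]. *)
Definition regularity_const T0 T Cl Cu nB nQ : R :=
  Num.max 0 ((c1 ^+ 2)^-1 *
    ((1 + 4 * nB ^+ 2 + 4 * nQ ^+ 2 + 4 * Cu ^+ 2) * energy_const Cl nB nQ T0 T
     + 4 * energy_const 1 0 0 T0 T)).

Lemma vsol_limit_bound j t T : (j < k)%N -> t <= T ->
  `|vsol_limit j t| ^+ 2 <= regularity_const T0 T Cl Cu (opnorm B) (norm_L1 Q) *
    (ray j t + ray j.+1 t).
Proof.
move=> jk tT; have jk' := ltnW jk.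
have ray0 i : 0 <= ray i t by apply: Rintegral_ge0 => // s _; rewrite mulr_ge0 ?indic_ge0.
set nB := opnorm B; set nQ := norm_L1 Q.
have nB0 : 0 <= nB by exact: opnorm_ge0.
have nQ0 : 0 <= nQ by exact: norm_L1_ge0.
set C1 := energy_const Cl nB nQ T0 T; set C2 := energy_const 1 0 0 T0 T.
have C10 : 0 <= C1 by exact: energy_const_ge0.
have C20 : 0 <= C2 by exact: energy_const_ge0.
have b0 : `|sol_limit j t| ^+ 2 <= C1 * ray j t by exact: sol_limit_bound.
have b1 : `|sol_limit j.+1 t| ^+ 2 <= C1 * ray j.+1 t by exact: sol_limit_bound.
have b2 : `|source_limit j t| ^+ 2 <= C2 * ray j.+1 t by exact: source_limit_bound.
have bA : `|A (sol_limit j.+1 t)| ^+ 2 <= Cu ^+ 2 * (C1 * ray j.+1 t).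
  apply: (@le_trans _ _ (Cu ^+ 2 * `|sol_limit j.+1 t| ^+ 2)).
    rewrite -exprMn ler_sqr ?nnegrE//; apply: (le_trans _ (A_le _)); exact: normr_ge0.
  by rewrite ler_wpM2l ?sqr_ge0.
have bB : `|B (sol_limit j t)| ^+ 2 <= nB ^+ 2 * (C1 * ray j t).
  apply: (@le_trans _ _ (nB ^+ 2 * `|sol_limit j t| ^+ 2)).
    by rewrite -exprMn ler_sqr ?nnegrE ?mulr_ge0// opnorm_le.
  by rewrite ler_wpM2l ?sqr_ge0.
have bR : `|memory Q (sol_limit j) t| ^+ 2 <= nQ ^+ 2 * (C1 * ray j t).
  have r0 : 0 <= C1 * ray j t by rewrite mulr_ge0.
  rewrite -[C1 * ray j t]sqr_sqrtr// -exprMn ler_sqr ?nnegrE ?mulr_ge0 ?sqrtr_ge0//.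
  apply: (norm_memory_le hip hQ (sol_limit_causal jk')) => s st.
  apply: le_of_sqr; rewrite ?sqrtr_ge0// sqr_sqrtr//.
  apply: (le_trans (sol_limit_bound jk' (le_trans st tT))).
  by rewrite ler_wpM2l// ray_mono.
have c20 : 0 < c1 ^+ 2 by rewrite exprn_gt0.
have := graph_norm_sqr c1_gt0 graph_ge (vsol_limit j t).
have [-> ->] := vsol_limitE t jk; move=> bv.
(* Four summands split by two levels of [normr2D], hence the factors 4. *)
have bP : `|rhs_limit j t| ^+ 2 <= 4 * `|source_limit j t| ^+ 2 +
   4 * `|A (sol_limit j.+1 t)| ^+ 2 + 4 * `|B (sol_limit j t)| ^+ 2 +
   4 * `|memory Q (sol_limit j) t| ^+ 2.
  have -> : rhs_limit j t = (source_limit j t - A (sol_limit j.+1 t)) +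
     (- B (sol_limit j t) - memory Q (sol_limit j) t) by rewrite addrA.
  have h1 := normr2D (source_limit j t - A (sol_limit j.+1 t))
     (- B (sol_limit j t) - memory Q (sol_limit j) t).
  have h2 := normr2D (source_limit j t) (- A (sol_limit j.+1 t)).
  have h3 := normr2D (- B (sol_limit j t)) (- memory Q (sol_limit j) t).
  move: h1 h2 h3; rewrite !normrN.
  move: (`|_ + _| ^+ 2) (`|_ + _| ^+ 2) (`|_ + _| ^+ 2) => x1 x2 x3.
  move: (`|_| ^+ 2) (`|_| ^+ 2) (`|_| ^+ 2) (`|_| ^+ 2) => *; lra.
have K0 : 0 <= (c1 ^+ 2)^-1 by rewrite invr_ge0 ltW.
rewrite /regularity_const -/nB -/nQ -/C1 -/C2.
apply: (@le_trans _ _ ((c1 ^+ 2)^-1 *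
    ((1 + 4 * nB ^+ 2 + 4 * nQ ^+ 2 + 4 * Cu ^+ 2) * C1 + 4 * C2) *
    (ray j t + ray j.+1 t))); last first.
  by rewrite ler_wpM2r ?addr_ge0// le_max lexx orbT.
rewrite -(@ler_pM2l _ (c1 ^+ 2))// -[X in _ <= _ * X]mulrA mulVKf ?gt_eqF//.
apply: (le_trans bv).
have r0 := ray0 j; have r1 := ray0 j.+1.
(* Each term is bounded by only one of the two ray integrals, while the claim multiplies the
   constant by their sum; the surplus products are nonnegative. *)
have n0 : 0 <= nB ^+ 2 * (C1 * ray j.+1 t) by rewrite mulr_ge0 ?sqr_ge0// mulr_ge0.
have n1 : 0 <= nQ ^+ 2 * (C1 * ray j.+1 t) by rewrite mulr_ge0 ?sqr_ge0// mulr_ge0.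
have n2 : 0 <= Cu ^+ 2 * (C1 * ray j t) by rewrite mulr_ge0 ?sqr_ge0// mulr_ge0.
have n3 : 0 <= C1 * ray j.+1 t by rewrite mulr_ge0.
have n4 : 0 <= C2 * ray j t by rewrite mulr_ge0.
have -> : ((1 + 4 * nB ^+ 2 + 4 * nQ ^+ 2 + 4 * Cu ^+ 2) * C1 + 4 * C2) *
   (ray j t + ray j.+1 t) = C1 * ray j t + C1 * ray j.+1 t +
   4 * (nB ^+ 2 * (C1 * ray j t)) + 4 * (nB ^+ 2 * (C1 * ray j.+1 t)) +
   4 * (nQ ^+ 2 * (C1 * ray j t)) + 4 * (nQ ^+ 2 * (C1 * ray j.+1 t)) +
   4 * (Cu ^+ 2 * (C1 * ray j t)) + 4 * (Cu ^+ 2 * (C1 * ray j.+1 t)) +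
   4 * (C2 * ray j t) + 4 * (C2 * ray j.+1 t) by ring.
lra.
Qed.


Lemma vsol_limit_derive j : (j < k)%N -> derive1n j (vsol_limit 0) = vsol_limit j.
Proof.
move=> jk; apply: (derive1n_chain (k := k.-1)).
  by move=> i t ik; apply: vsol_limit_isD; move: ik; case: (k).
by move: jk; case: (k).
Qed.

Lemma sol_limit_derive j : (j <= k)%N -> derive1n j (sol_limit 0) = sol_limit j.
Proof. by apply: derive1n_chain => i t; exact: sol_limit_isD. Qed.

Lemma sol_limit_Ck : Ck k (sol_limit 0).
Proof.
apply: Ck_chain; first by move=> i t; exact: sol_limit_isD.
exact: (sol_limit_causal (leqnn k)).1.
Qed.

Hypothesis (k_gt0 : (0 < k)%N).

Lemma vsol_limit_Ck : Ck k.-1 (vsol_limit 0).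
Proof.
apply: Ck_chain; last by apply: vsol_limit_continuous; rewrite prednK.
by move=> i t ik; apply: vsol_limit_isD; rewrite -(prednK k_gt0).
Qed.

Lemma iota_vsol_limit : iota \o vsol_limit 0 = sol_limit 0.
Proof. by apply/funext => t; exact: (vsol_limitE t k_gt0).1. Qed.

Lemma sol_limit_strong : strong_solution iota A P B Q (source_limit 0) (vsol_limit 0).
Proof.
have c0 := sol_limit_causal (leq0n k).
split; rewrite ?iota_vsol_limit.
- split=> [[|//] _ t|].
    by have /isDP[] := @sol_limit_isD 0 t k_gt0.
  by rewrite sol_limit_derive//; exact: (sol_limit_causal k_gt0).1.
- by split=> //; exact: vsol_limit_continuous.
- exact: causal_continuous_L2plus.
move=> t; split.
  exists (memory Q (sol_limit 0) t).
  have -> : (fun s => Q (t - s) (iota (vsol_limit 0 s))) = fun s => Q (t - s) (sol_limit 0 s).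
    by apply/funext => s; rewrite (vsol_limitE s k_gt0).1.
  exact: (bochner_is_bochner hip (memoryE hip hQ t c0).1).
rewrite (isD_derive1 (@sol_limit_isD 0 t k_gt0)).
have [-> ->] := vsol_limitE t k_gt0; rewrite /rhs_limit.
move: (source_limit _ _) (A _) (B _) (memory _ _ _) => x1 x2 x3 x4.
have -> : x1 - x2 - x3 - x4 = x1 - (x2 + x3 + x4) by rewrite !opprD !addrA.
by rewrite [x2 + (x1 - _)]addrC -!addrA addNr addr0.
Qed.

Hypothesis g0 : forall j, (j <= k)%N -> {ae mu, forall t, t < T0 -> g j t = 0}.

(** The left side passes to the limit by uniform convergence up to the end of the support of [phi],
    the right side by L^2 convergence of the sources there. The argument thus reaches order [k],
    where only L^2 convergence of sources is available. *)
Lemma sol_limit_weak j : (j <= k)%N ->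
  weak_solution ip iota A P B Q (g j) (sol_limit j).
Proof.
move=> jk; have Lc := sol_limit_causal jk; split; first exact: causal_continuous_L2plus.
move=> phi tphi; have [a [b phi0]] := test_support tphi.
rewrite -/(test_expr ip iota P A B Q phi _).
set G := test_expr ip iota P A B Q phi.
have Gc : continuous G by exact: test_expr_continuous tphi phi0.
have G0 t : b < t -> G t = 0 by exact: (test_expr_vanish P hip iota_cont A B_cont hQ tphi phi0).
have ic : continuous (fun t => iota (phi t)).
  by move=> t; apply: (cvg_comp phi iota); [exact: (@smooth_continuous _ _ _ tphi.1 0%N)|exact: iota_cont].
have i0 s : s < a \/ b < s -> iota (phi s) = 0 by move=> h; rewrite [phi s](phi0 0%N _ h) linear0.
have [M M0 hM] := bounded_support ic i0.
have i0' s : b < s -> iota (phi s) = 0 by move=> h; apply: i0; right.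
have rL := rint_ip_causal hip (a := Tu) (continuous_L1loc Lc.1)
  (aeT (@sol_limit_vanish j)) Gc G0.
have rU n := rint_ip_causal hip (a := Tu) (continuous_L1loc (@Uc n j)) (aeT (@U0 n j)) Gc G0.
have rg := rint_ip_causal hip (a := T0) (L2loc_L1loc (gL2 jk).1) (g0 jk) ic i0'.
have rF n := rint_ip_causal hip (a := T0) (continuous_L1loc (@Fc n j)) (aeT (@F0 n j)) ic i0'.
have rG := (continuous_L1loc Gc).2 Tu b.
have r1 := rint_itv a b.
set x := \int[mu]_t _; set y := \int[mu]_t _.
set M1 := \int[mu]_t (\1_(`[Tu, b]) t * `|G t|).
have M10 : 0 <= M1 by apply: Rintegral_ge0 => // t _; rewrite mulr_ge0 ?indic_ge0.
set l := \int[mu]_t (\1_(`[a, b]) t).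
have l0 : 0 <= l by apply: Rintegral_ge0 => // t _; rewrite indic_ge0.
suff small e : 0 < e -> `|x + y| <= e.
  apply/eqP; rewrite -addr_eq0 -normr_le0; apply/ler_addgt0Pr => e e0.
  by rewrite add0r; exact: small.
move=> e0.
have M1p : 0 < 2 * (1 + M1) by rewrite mulr_gt0// ltr_pwDl.
have [N hN] := ray_limit_unif b (sol_ray_cauchy jk) (divr_gt0 e0 M1p).
have Ml : 0 < 1 + M ^+ 2 * l by rewrite ltr_pwDl// mulr_ge0 ?sqr_ge0.
(* Weight in Young's inequality [z M <= L z^2 + M^2 / L]: it makes the second term integrate to at
   most [e / 4]; the L^2 error is then required to be below [e / (4 L)]. *)
pose L := 4 * (1 + M ^+ 2 * l) / e.
have L0 : 0 < L by rewrite divr_gt0// mulr_gt0.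
have [N' hN'] := F_cvg a b jk (divr_gt0 e0 (mulr_gt0 (ltr0n _ 4) L0)).
pose n := maxn N N'.
have [rn In] := hN' n (leq_maxr _ _).
have dU : `|\int[mu]_t ip (U n j t) (G t) - x| <= e / 2.
  rewrite -(RintegralB measurableT (rU n) rL).
  have bnd t : `|ip (U n j t) (G t) - ip (sol_limit j t) (G t)| <=
      e / (2 * (1 + M1)) * (\1_(`[Tu, b]) t * `|G t|).
    have e1 : 0 <= e / (2 * (1 + M1)) by rewrite ltW// divr_gt0.
    have [tT|Tt] := ltP t Tu.
      by rewrite U0// sol_limit_vanish// subrr normr0 mulr_ge0// mulr_ge0 ?indic_ge0.
    have [tb|bt] := leP t b; last first.
      by rewrite G0// !ip0r subrr normr0 mulr_ge0// mulr_ge0 ?indic_ge0.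
    rewrite -ipBl indicE mem_set ?mul1r; last by rewrite /= in_itv /= Tt.
    apply: (le_trans (ip_CS hip _ _)); rewrite ler_wpM2r//.
    exact: (hN n (leq_maxl _ _) t tb).
  apply: (le_trans (le_norm_Rint (rintB (rU n) rL) (rintZ _ rG) bnd)).
  have p1 : 0 < 1 + M1 by rewrite ltr_pwDl.
  have -> : \int[mu]_t (e / (2 * (1 + M1)) * (\1_(`[Tu, b]) t * `|G t|)) =
      e / 2 * (M1 / (1 + M1)).
    by rewrite RintegralZl// -/M1; field; rewrite gt_eqF.
  by rewrite ler_piMr ?divr_ge0 ?(ltW e0)// ler_pdivrMr// mul1r lerDr.
have dF' : `|y - \int[mu]_t ip (F n j t) (iota (phi t))| <= e / 2.
  rewrite -(RintegralB measurableT rg (rF n)).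
  have bnd t : `|ip (g j t) (iota (phi t)) - ip (F n j t) (iota (phi t))| <=
      L * (\1_(`[a, b]) t * `|F n j t - g j t| ^+ 2) + M ^+ 2 / L * \1_(`[a, b]) t.
    have [tab|tab] := boolP (a <= t <= b); last first.
      have -> : iota (phi t) = 0.
        apply: i0; move: tab; rewrite negb_and -!ltNge => /orP[]; [by left|by right].
      rewrite !ip0r subrr normr0; apply: addr_ge0; apply: mulr_ge0.
      - exact: ltW.
      - by rewrite mulr_ge0 ?indic_ge0.
      - by rewrite divr_ge0 ?sqr_ge0 ?(ltW L0).
      - exact: indic_ge0.
    rewrite -ipBl indicE mem_set ?mul1r ?mulr1; last by rewrite /= in_itv.
    apply: (le_trans (ip_CS hip _ _)); rewrite distrC.
    apply: (@le_trans _ _ (`|F n j t - g j t| * M)); first by rewrite ler_wpM2l.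
    move: (`|F n j t - g j t|) => z.
    have -> : L * z ^+ 2 + M ^+ 2 / L = L * (z ^+ 2 + (M / L) ^+ 2).
      by field; rewrite gt_eqF.
    have -> : z * M = L * (z * (M / L)) by field; rewrite gt_eqF.
    rewrite ler_pM2l//; move: (M / L) => w.
    have := sqr_ge0 (z - w); have := sqr_ge0 z; have := sqr_ge0 w.
    rewrite sqrrB; move: (z * w) (z ^+ 2) (w ^+ 2) => q1 q2 q3; rewrite mulr2n; lra.
  have r2 := rintZ L rn; have r3 := rintZ (M ^+ 2 / L) r1.
  apply: (le_trans (le_norm_Rint (rintB rg (rF n)) (rintD r2 r3) bnd)).
  rewrite (RintegralD measurableT r2 r3) !RintegralZl// -/l.
  have h1 : L * \int[mu]_s (\1_(`[a, b]) s * `|F n j s - g j s| ^+ 2) <= e / 4.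
    apply: (le_trans (ler_wpM2l (ltW L0) In)).
    by rewrite le_eqVlt; apply/orP; left; apply/eqP; field; rewrite gt_eqF.
  have h2 : M ^+ 2 / L * l <= e / 4.
    rewrite mulrAC ler_pdivrMr// /L.
    have -> : e / 4 * (4 * (1 + M ^+ 2 * l) / e) = 1 + M ^+ 2 * l.
      by field; rewrite gt_eqF.
    by rewrite lerDr.
  move: h1 h2; move: (L * _) (M ^+ 2 / L * l) => q1 q2 *; lra.
have E := classical_sol_weak hip iota_cont P_skew A_cont A_sym B_cont hQ tphi phi0
  (solUF n j) (@Uc n j.+1).
move: dU dF'; rewrite E; move: (\int[mu]_t _) => w.
rewrite !ler_norml => /andP[? ?] /andP[? ?]; apply/andP; split; lra.
Qed.

Lemma limit_regularity : exists v : R -> V,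
  [/\ iota \o v = sol_limit 0,
      Ck k (iota \o v) /\ Ck k.-1 v,
      forall T t j, t <= T -> (j < k)%N ->
        `|derive1n j v t| ^+ 2 <=
          regularity_const T0 T Cl Cu (opnorm B) (norm_L1 Q) * (ray j t + ray j.+1 t),
      continuous (source_limit 0) /\ strong_solution iota A P B Q (source_limit 0) v &
      forall j, (j <= k)%N -> causal (derive1n j (iota \o v)) /\
        weak_solution ip iota A P B Q (g j) (derive1n j (iota \o v))].
Proof.
exists (vsol_limit 0); rewrite iota_vsol_limit; split.
- by [].
- by split; [exact: sol_limit_Ck|exact: vsol_limit_Ck].
- by move=> T t j tT jk; rewrite vsol_limit_derive//; exact: vsol_limit_bound.
- by split; [exact: source_limit_continuous|exact: sol_limit_strong].
move=> j jk; rewrite sol_limit_derive//; split; last exact: sol_limit_weak.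
by apply: causal_continuous_causal; exact: sol_limit_causal.
Qed.

End limit.

(** * Construction of the approximating sequences *)

Section approximation.
Context {R : realType} {H : completeNormedModType R}.
Local Notation mu := (@lebesgue_measure R).
Variables (ip : {dot H for idfun}) (hip : norm_of_dot ip).

(** Selects a representative that vanishes everywhere before [T], and not just almost everywhere, as
    the mollified equation assumes. *)
Definition cut (T : R) (u : R -> H) t := if t \in `[T, +oo[%classic then u t else 0.

Lemma cut_vanish T u t : t < T -> cut T u t = 0.
Proof. by move=> tT; rewrite /cut memNset//= in_itv /= andbT leNgt tT. Qed.

Lemma cut_ae T u : {ae mu, forall t, t < T -> u t = 0} -> {ae mu, forall t, cut T u t = u t}.
Proof.
apply: aeS => t h; rewrite /cut; case: ifPn => //.
rewrite notin_setE /= in_itv /= andbT => /negP; rewrite -ltNge => tT.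
by rewrite h.
Qed.

Lemma cut_L2plus T u : L2loc u -> L2plus (cut T u).
Proof.
move=> [us ui]; apply: (@causal_L2plus _ _ _ T); last first.
  by apply: aeT => t; exact: cut_vanish.
have sc : strongly_measurable (cut T u : measurableTypeR R -> H).
  apply: (sm_if _ us); [exact: measurable_itv|exact: sm_cst].
split=> // a b; apply: (le_lt_trans _ (ui a b)).
apply: ge0_le_integral => //.
- by apply/measurable_EFinP; apply: measurable_funTS; exact: measurable_normX2.
- by apply/measurable_EFinP; apply: measurable_funTS; exact: measurable_normX2.
move=> t _; rewrite lee_fin /cut; case: ifP => // _.
by rewrite normr0 expr0n /= sqr_ge0.
Qed.

Variables (V : completeNormedModType R) (iota P : {linear V -> H}).
Hypotheses (iota_cont : continuous iota) (P_cont : continuous P)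
  (P_skew : skew_adjoint ip iota P).
Variables (A B : {linear H -> H}) (Q : R -> {linear H -> H}).
Hypotheses (A_cont : continuous A) (A_sym : symmetric_op ip A) (B_cont : continuous B)
  (hQ : memory_kernel ip Q).

Lemma cut_weak_solution T f u : {ae mu, forall t, t < T -> u t = 0} ->
  weak_solution ip iota A P B Q f u -> weak_solution ip iota A P B Q f (cut T u).
Proof.
move=> u0 [uL2 uw]; split; first exact: cut_L2plus uL2.1.
move=> phi tphi; rewrite -uw//; have [a [b phi0]] := test_support tphi.
rewrite -/(test_expr ip iota P A B Q phi _).
have Gc := test_expr_continuous hip iota_cont P_cont A_cont B_cont hQ tphi phi0.
have G0 := test_expr_vanish P hip iota_cont A B_cont hQ tphi phi0.
apply: Rint_ae.
- apply: (rint_ip_causal hip (a := T) _ _ Gc G0).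
    exact: (L2loc_L1loc (cut_L2plus T uL2.1).1).
  by apply: aeT => t; exact: cut_vanish.
- exact: (rint_ip_causal hip (a := T) (L2loc_L1loc uL2.1) u0 Gc G0).
by apply: aeS (cut_ae u0) => t ->.
Qed.

(** One sequence of mollifiers serves all orders: [u] and [f] are convolved with its j-th
    derivatives. For [j <= k] the derivative moves onto [f], so the sources are mollifications of
    [g j] and inherit contraction and convergence. *)
Lemma approximations (k : nat) (f u : R -> H) (g : nat -> R -> H) (Tu T0 : R) :
  weak_solution ip iota A P B Q f u -> (forall t, t < Tu -> u t = 0) -> L2loc f ->
  {ae mu, forall t, t < T0 -> f t = 0} ->
  (forall j, (j <= k)%N -> L2plus (g j) /\ is_weak_deriv j f (g j)) ->
  exists U F : nat -> nat -> R -> H,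
  [/\ forall n j, classical_sol iota P A B Q (U n j) (U n j.+1) (F n j),
      forall n j s, s < Tu -> U n j s = 0,
      forall n j s, s < T0 -> F n j s = 0,
      forall n j t, isD (F n j) t (F n j.+1 t) &
      forall n j t, (j <= k)%N ->
        \int[mu]_s (\1_(`]-oo, t]) s * `|F n j s| ^+ 2) <=
        \int[mu]_s (\1_(`]-oo, t]) s * `|g j s| ^+ 2)] /\
  [/\ forall j b c e, (j <= k)%N -> 0 < e -> exists N, forall n, (N <= n)%N ->
        rint mu (fun s => \1_(`[b, c]) s * `|F n j s - g j s| ^+ 2) /\
        \int[mu]_s (\1_(`[b, c]) s * `|F n j s - g j s| ^+ 2) <= e,
      ray_cauchy (U^~ 0%N) -> {ae mu, forall t, u t = sol_limit U 0 t} &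
      ray_cauchy (F^~ 0%N) -> {ae mu, forall t, f t = source_limit F 0 t}].
Proof.
move=> [uL2 uw] u0 fL2 f0 hg.
pose a n : R := n.+1%:R^-1.
have a0 n : 0 < a n by rewrite invr_gt0.
have [psi hpsi] := choice (fun n => mollifier_exists (a0 n)).
have ul := L2loc_L1loc uL2.1; have fl := L2loc_L1loc fL2.
have a_cvg : a n @[n --> \oo] --> (0 : R) by exact: cvg_harmonic.
exists (fun n j => conv (derive1n j (psi n)) u), (fun n j => conv (derive1n j (psi n)) f).
have FE n j t : (j <= k)%N -> conv (derive1n j (psi n)) f t = conv (psi n) (g j) t.
  move=> /hg[gL2 gw].
  exact: (conv_weak_deriv hip t (hpsi n) fl (L2loc_L1loc gL2.1) gw).
split; split.
- by move=> n j; exact: (mollified_weak_solution hip P_skew A_sym B_cont hQ j uL2 u0 fL2 uw (hpsi n)).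
- by move=> n j s; apply: (conv_vanish hip (mollifier_kernel j (hpsi n)) ul); exact: aeT.
- by move=> n j s; exact: (conv_vanish hip (mollifier_kernel j (hpsi n)) fl f0).
- by move=> n j t; exact: (conv_mollifier_isD hip (hpsi n) fl).
- move=> n j t jk; under eq_Rintegral do rewrite FE//.
  exact: (conv_contraction_ray hip t (hpsi n) (a0 n) (hg j jk).1).2.
- move=> j b c e jk e0.
  have [dl dl0 hdl] := conv_L2loc_cvg hip b c (hg j jk).1.1 e0.
  have [N hN] := invn_small dl0; exists N => n /hN nd.
  have -> : (fun s => \1_(`[b, c]) s * `|conv (derive1n j (psi n)) f s - g j s| ^+ 2) =
      (fun s => \1_(`[b, c]) s * `|conv (psi n) (g j) s - g j s| ^+ 2).
    by apply/funext => s; rewrite FE.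
  split; first exact: (rint_conv_sub hip b c (hpsi n) (hg j jk).1.1).
  exact: (hdl (a n)).
- exact: (ray_limit_ae hip hpsi a0 a_cvg uL2.1).
- exact: (ray_limit_ae hip hpsi a0 a_cvg fL2).
Qed.

End approximation.

Lemma bounded_linear_continuous_norm (R : realType) (E F : normedModType R)
  (L : {linear E -> F}) (c : R) : 0 < c -> (forall x, `|L x| <= c * `|x|) -> continuous L.
Proof.
move=> c0 hL x; apply/cvgrPdist_le => e e0.
have /cvgrPdist_le/(_ (e / c) (divr_gt0 e0 c0)) := @cvg_id _ (nbhs x).
apply: filterS => y /= xy; rewrite -linearB; apply: (le_trans (hL _)).
by rewrite mulrC -ler_pdivlMr.
Qed.

Theorem theorem6 (R : realType) (H V : completeNormedModType R)
  (ip : {dot H for idfun}) (ipV : {dot V for idfun})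
  (iota P : {linear V -> H})
  (H_hilbert : norm_of_dot ip) (H_sep : separable_space H)
  (V_hilbert : norm_of_dot ipV) (V_sep : separable_space V)
  (V_sub : dense_inclusion iota)
  (P_skew : skew_adjoint ip iota P) (P_graph : graph_norm_equiv iota P) :
  exists C : R -> R -> R -> R -> R -> R -> R,
  (forall T0 T Cl Cu nB nQ, 0 <= C T0 T Cl Cu nB nQ) /\
  forall (A B : {linear H -> H}) (Q : R -> {linear H -> H}) (Cl Cu : R),
    continuous A -> symmetric_op ip A -> 0 < Cl -> Cl <= Cu ->
    (forall x, Cl * ip x x <= ip (A x) x <= Cu * ip x x) ->
    continuous B ->
    memory_kernel ip Q ->
  forall (k : nat) (f : R -> H) (T0 : R),
    (1 <= k)%N -> L2plus f -> Hkloc k f -> ess_supp f `<=` `[T0, +oo[ ->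
  forall u : R -> H, causal u -> weak_solution ip iota A P B Q f u ->
  exists v : R -> V,
    [/\ u = iota \o v %[ae lebesgue_measure],
        Ck k (iota \o v) /\ Ck k.-1 v,
        forall T, T0 <= T -> forall t, t <= T -> forall j, (j < k)%N ->
          ((`|(v^`(j))%classic t| ^+ 2)%:E <=
           (C T0 T Cl Cu (opnorm B) (norm_L1 Q))%:E *
           \sum_(0 <= l < j.+2)
             \int[lebesgue_measure]_(s in `]-oo, t]) (`|wderiv l f s| ^+ 2)%:E)%E,
        (exists g : R -> H, [/\ continuous g, f = g %[ae lebesgue_measure] &
           strong_solution iota A P B Q g v]) &
        forall j, (j <= k)%N ->
          causal ((iota \o v)^`(j))%classic /\
          weak_solution ip iota A P B Q (wderiv j f) ((iota \o v)^`(j))%classic].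
Proof.
have [_ iota_cont _] := V_sub.
have [c1 [c2 [c1_gt0 c2_gt0 graph]]] := P_graph.
have graph_ge v : c1 * `|v| <= graph_norm iota P v by have /andP[] := graph v.
have graph_le v : graph_norm iota P v <= c2 * `|v| by have /andP[] := graph v.
have P_cont : continuous P.
  exact: (bounded_linear_continuous_norm c2_gt0 (graph_bound_op graph_le)).
(* [c1] depends only on [P] and the norm of [V], so the constant is fixed before [A], [B] and [Q]
   appear. The maximum with 0 in it gives the sign for arbitrary real arguments, including
   [Cl <= 0]. *)
exists (regularity_const c1); split; first by move=> *; rewrite le_max lexx.
move=> A B Q Cl Cu A_cont A_sym Cl_gt0 Cl_le A_bnd B_cont hQ k f T0 k_gt0 fL2 fH fsupp.
move=> u [Tu usupp] uw.
have u0 := ae_ess_supp usupp; have f0 := ae_ess_supp fsupp.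
have gw j : (j <= k)%N -> L2loc (wderiv j f) /\ is_weak_deriv j f (wderiv j f).
  by move=> jk; exact: wderivP fH jk.
have g0 j : (j <= k)%N -> {ae lebesgue_measure, forall t, t < T0 -> wderiv j f t = 0}.
  by move=> /gw[gL2 gd]; exact: (weak_deriv_vanish H_hilbert fL2.1 gL2 gd f0).
have gL2 j : (j <= k)%N -> L2plus (wderiv j f).
  by move=> jk; exact: (causal_L2plus (gw j jk).1 (g0 j jk)).
(* The given solution is exchanged for the representative that vanishes identically before [Tu]; the
   final almost-everywhere identity undoes the exchange. *)
have cw := cut_weak_solution H_hilbert iota_cont P_cont A_cont B_cont hQ u0 uw.
have [|U [F [[solUF U0 F0 dF F_ray] [F_cvg uU fF]]]] := approximations H_hilbert P_skew
  A_sym B_cont hQ (k := k) (g := fun j => wderiv j f) cw (@cut_vanish _ _ Tu u) fL2.1 f0.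
  by move=> j jk; split; [exact: gL2|exact: (gw j jk).2].
have A_coer x : Cl * ip x x <= ip (A x) x by have /andP[] := A_bnd x.
have A_le := symmetric_norm_le H_hilbert A_sym Cl_gt0 Cl_le A_bnd.
have Uae := uU (sol_ray_cauchy H_hilbert P_skew A_cont A_sym Cl_gt0 A_coer B_cont hQ
  solUF F0 F_cvg (leq0n k)).
have Fae := fF (source_ray_cauchy H_hilbert solUF F0 dF F_cvg k_gt0).
have [v [vU vCk bnd strong weak]] := limit_regularity H_hilbert iota_cont P_cont P_skew
  A_cont A_sym Cl_gt0 A_coer B_cont hQ solUF U0 F0 dF gL2 F_ray F_cvg c1_gt0 graph_ge
  A_le k_gt0 g0.
exists v; split => //.
- apply: aeS (aeI (cut_ae u0) Uae) => t [<- ->] _; by rewrite vU.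
- move=> T _ t tT j jk.
  have rayE l : (l < j.+2)%N ->
      (\int[lebesgue_measure]_(s in `]-oo, t]) (`|wderiv l f s| ^+ 2)%:E)%E =
      (\int[lebesgue_measure]_s (\1_(`]-oo, t]) s * `|wderiv l f s| ^+ 2))%:E.
    move=> lj; rewrite integral_indic_mul EFin_Rint//.
    by apply: rint_ray; apply: gL2; exact: leq_trans jk.
  rewrite (eq_big_nat _ _ (fun l lj => rayE l (andP lj).2)) sumEFin -EFinM lee_fin.
  apply: (le_trans (bnd T t j tT jk)).
  rewrite ler_wpM2l ?le_max ?lexx//.
  (* The bound uses the two top terms [l = j] and [l = j.+1]; the lower ones are nonnegative and
     only enlarge the sum. *)
  rewrite !big_nat_recr//= -addrA lerDr sumr_ge0// => l _.
  by apply: Rintegral_ge0 => // s _; rewrite mulr_ge0 ?indic_ge0.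
- exists (source_limit F 0); split; [exact: strong.1| |exact: strong.2].
  by apply: aeS Fae => t -> _.
Qed.
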